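(* Let $n\ge1$, let $f\in\mathcal{L}$, and let $p_1,\ldots,p_{n+1}\in(-1,\infty)$ be distinct. (i) There exist unique functions $f_+\in\mathcal{L}_n^+$ and $f_-\in\mathcal{L}_n^-$ such that $$m_i(f)=m_i(f_+)=m_i(f_-)\quad\text{for every } i=1,\ldots,n.$$ (ii) Let $p_{i_1}<p_{i_2}<\cdots<p_{i_{n+1}}$ be the increasing rearrangement of $p_1,\ldots,p_{n+1}$, and let $k$ be the index with $i_k=n+1$. If $n+1-k$ is even, then $$m_{n+1}(f_-)\le m_{n+1}(f)\le m_{n+1}(f_+).$$ If $n+1-k$ is odd, then these inequalities are reversed. Moreover, equality $m_{n+1}(f)=m_{n+1}(f_+)$ (respectively $m_{n+1}(f)=m_{n+1}(f_-)$) holds only if $f=f_+$ (respectively $f=f_-$) almost everywhere.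
   Context: Write $\mathbb{R}_+=[0,\infty)$ and $x_+=\max(x,0)$. A function $f:\mathbb{R}\to\mathbb{R}_+$ is log-concave if $f=e^{-V}$ for a convex function $V:\mathbb{R}\to\mathbb{R}\cup\{\infty\}$. $\mathcal{L}$ is the class of symmetric (even) log-concave functions $f:\mathbb{R}\to\mathbb{R}_+$ with $f(0)=1$. The moment functionals are $m_i(f)=\int_0^\infty t^{p_i}f(t)\,\mathrm{d}t\in[0,\infty]$. The classes $\mathcal{L}_n^\pm$ of simple log-concave functions on $\mathbb{R}$ are defined as follows: $\mathcal{L}_{2k}^-$ ($k\ge1$) is the set of functions $f(t)=\exp\big(-a_1|t|-a_2(|t|-b_2)_+-\cdots-a_k(|t|-b_k)_+\big)\mathbf{1}_{|t|\le b_{k+1}}$; $\mathcal{L}_{2k+1}^+$ ($k\ge0$) is the set of functions $f(t)=\exp\big(-a_1|t|-a_2(|t|-b_2)_+-\cdots-a_{k+1}(|t|-b_{k+1})_+\big)$; $\mathcal{L}_{2k}^+$ ($k\ge1$) is the set of functions $f(t)=\exp\big(-a_1(|t|-b_1)_+-\cdots-a_k(|t|-b_k)_+\big)$; $\mathcal{L}_{2k+1}^-$ ($k\ge0$) is the set of functions $f(t)=\exp\big(-a_1(|t|-b_1)_+-\cdots-a_k(|t|-b_k)_+\big)\mathbf{1}_{|t|\le b_{k+1}}$. Here the parameters range over all $a_1,a_2,\ldots\in[0,\infty]$ and $0\le b_1\le b_2\le\cdots\le\infty$ (only those that occur in the formula), with the conventions $\infty\cdot0=0$ and $e^{-\infty}=0$.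 E.g. $\mathcal{L}_1^+=\{e^{-a|t|}:a\in[0,\infty]\}$ and $\mathcal{L}_1^-=\{\mathbf{1}_{|t|\le b}:b\in[0,\infty]\}$. *)

(* Defs.v *)
(* MathComp-Analysis, over an arbitrary realType. *)
From mathcomp Require Import all_boot all_order all_algebra.
From mathcomp Require Import all_classical all_reals all_analysis.
Import Order.TTheory GRing.Theory Num.Theory.
Import numFieldNormedType.Exports.

Set Implicit Arguments.
Unset Strict Implicit.
Unset Printing Implicit Defensive.

Local Open Scope classical_set_scope.
Local Open Scope ring_scope.

(* The library's [convex_function] covers only finite-valued functions.  Since
   0 * +oo = 0 in [\bar R], the endpoints l = 0 and l = 1 impose nothing. *)
Definition convex_ereal (R : realType) (V : R -> \bar R) : Prop :=
  forall (x y l : R), 0 <= l <= 1 ->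
    (V (l * x + (1 - l) * y)%R <= l%:E * V x + (1 - l)%:E * V y)%E.

Definition log_concave (R : realType) (f : R -> R) : Prop :=
  exists V : R -> \bar R,
    [/\ forall x, V x != -oo%E,
        convex_ereal V &
        forall x, (f x)%:E = expeR (- V x)%E].

Definition calL (R : realType) : set (R -> R) :=
  [set f : R -> R | [/\ log_concave f, forall x, f (- x) = f x & f 0 = 1]].

Definition moment (R : realType) (q : R) (f : R -> R) : \bar R :=
  (\int[lebesgue_measure]_(t in `]0%R, +oo[) (t `^ q * f t)%:E)%E.

Definition hinge (R : realType) (b : \bar R) (t : R) : \bar R :=
  maxe (`|t|%:E - b)%E 0%E.

(* Values in [0, +oo].  Each class below uses only finitely many of the a i and
   b i; the remaining ones, in particular those of index 0, play no role, as any
   admissible finite family extends to an admissible sequence. *)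
Definition admissible (R : realType) (a b : nat -> \bar R) : Prop :=
  [/\ forall i, (0 <= a i)%E,
      forall i, (0 <= b i)%E &
      forall i j, (i <= j)%N -> (b i <= b j)%E].

Definition Lminus_even (R : realType) (k : nat) : set (R -> R) :=
  [set f : R -> R | exists a b : nat -> \bar R, admissible a b /\
    forall t : R,
      (f t)%:E = (expeR (- (a 1%N * `|t|%:E
                            + \sum_(2 <= i < k.+1) a i * hinge (b i) t))
                  * (\1_[set u : R | (`|u|%:E <= b k.+1)%E] t)%:E)%E].

Definition Lplus_odd (R : realType) (k : nat) : set (R -> R) :=
  [set f : R -> R | exists a b : nat -> \bar R, admissible a b /\
    forall t : R,
      (f t)%:E = expeR (- (a 1%N * `|t|%:E
                           + \sum_(2 <= i < k.+2) a i * hinge (b i) t))%E].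

Definition Lplus_even (R : realType) (k : nat) : set (R -> R) :=
  [set f : R -> R | exists a b : nat -> \bar R, admissible a b /\
    forall t : R,
      (f t)%:E = expeR (- (\sum_(1 <= i < k.+1) a i * hinge (b i) t))%E].

Definition Lminus_odd (R : realType) (k : nat) : set (R -> R) :=
  [set f : R -> R | exists a b : nat -> \bar R, admissible a b /\
    forall t : R,
      (f t)%:E = (expeR (- (\sum_(1 <= i < k.+1) a i * hinge (b i) t))
                  * (\1_[set u : R | (`|u|%:E <= b k.+1)%E] t)%:E)%E].

(* Meaningful for n >= 1; for n even, n = 2k with k = n./2, and for n odd,
   n = 2k + 1 with k = n./2. *)
Definition Lplus (R : realType) (n : nat) : set (R -> R) :=
  if odd n then Lplus_odd n./2 else Lplus_even (R := R) n./2.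

Definition Lminus (R : realType) (n : nat) : set (R -> R) :=
  if odd n then Lminus_odd n./2 else Lminus_even (R := R) n./2.

(* The exponents are indexed from 0: p i stands for p_{i+1}, so that i < n
   selects the first n of them. *)
Definition same_moments (R : realType) (n : nat) (p : 'I_n.+1 -> R)
    (f g : R -> R) : Prop :=
  forall i : 'I_n.+1, (i < n)%N -> moment (p i) f = moment (p i) g.

(* Main.v *)
Require Import Defs.
From mathcomp Require Import all_boot all_order all_algebra perm.
From mathcomp Require Import ring lra zify.
From mathcomp Require Import all_classical all_reals all_analysis.
From mathcomp Require Import measurable_realfun.
Import Order.TTheory GRing.Theory Num.Theory.
Import numFieldNormedType.Exports.
Set Implicit Arguments.
Unset Strict Implicit.
Unset Printing Implicit Defensive.
Local Open Scope classical_set_scope.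
Local Open Scope ring_scope.

(** All the functions are even, so only [[0, +oo[] matters.  Both classes of
    simple functions belong to one family: products of [K] kinks
    exp (- a (|t| - b)_+), where the first node may be pinned at [b = 0], and
    the last slope may be pinned at [a = +oo], which makes the last factor the
    indicator of |t| <= b.  If [pin0] and [pinC] record these two constraints,
    [n = 2 K - pin0 - pinC] parameters are left free; for each [n] there is one
    way to reach it without a cut-off, L_n^+, and one with a cut-off, L_n^-
    ([Lplus_simples], [Lminus_simples]).

    Comparison.  Let [g] be a simple function with the same first [n] moments as
    [f].  Where [g] has no node it is log-convex, while [f] is log-concave; so if
    [g - f] is nonpositive, positive and nonpositive again at three successive
    points, a node of [g] lies between them.  Counting nodes, [g - f] has at most
    [n] sign changes, the last sign being imposed by the presence of a cut-off,
    and it has [n] of them, or [n - 1] of both types, only if all the nodes are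
    distinct and effective ([no_alternation_neg], [no_alternation_pos],
    [alternation_generic_nodes]).  On the other side, the powers t^{p_i} obey the
    rule of signs of Descartes: given [n] points, some combination of the [n + 1]
    powers vanishes exactly there, changes sign at each of them, and its
    coefficients alternate in sign when the exponents are sorted
    ([descartes_combination]).  For the points where [g - f] changes sign, the
    product of the combination and of [g - f] has a constant sign.  In its
    integral only the last moment survives, and the sign of its coefficient gives
    the inequality of (ii); if the integral is [0] then [f = g] almost everywhere
    ([last_moment_sign]).  Fewer than [n] sign changes force [f = g] at once
    ([degenerate_ae]).  Uniqueness is the case where [f] itself is simple.

    Existence, by a continuity argument.  Take a simple function [g0] whose nodes
    are all effective, and join it to [f] by the log-concave functions
    f_s(t) = f(s t) g0((1 - s) t) exp(- s (1 - s) t^2).  The set of those [s] for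
    which some simple function has the moments of f_s is closed, because simple
    functions with a bounded moment form a compact family ([simple_compact]).  It
    is also open to the right.  Let [s < 1] be in this set, and for [s'] slightly
    above [s], let [g'] minimise the sum of the squares of the differences of
    moments with f_{s'}.  As [s'] decreases to [s], these minimisers converge to
    a simple function with the moments of f_s.  All nodes of that limit are
    effective, as otherwise f_s would be simple; the Gaussian factor excludes
    this for [s > 0], and for [s = 0] the function [g0] determines its nodes.
    Therefore the nodes of [g'] are effective, and its parameters can be moved in
    both directions.  Stationarity then says that P(t) = sum_i v_i t^{p_i}, where
    the [v_i] are the differences of moments, is orthogonal, with weight [g'], to
    the affine functions on every piece between nodes.  So [P] has two zeros in
    each piece, hence as many zeros as terms, and [v = 0]: the minimiser has the
    moments of f_{s'} ([stationary_matches], [continuation], [simple_exists]).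

    There remain [f = 1], the only log-concave function with infinite moments,
    and [f = 0] off the origin; both are simple. *)

(** * Sums of exponentials and the rule of signs of Descartes *)
Section ExpSum.
Variables (R : realType) (I : eqType).
Implicit Types (s : seq I) (c q : I -> R) (x y : R) (xs ys : seq R).

Definition expsum s c q x := \sum_(i <- s) c i * expR (q i * x).

Lemma is_derive_expsum s c q x :
  is_derive x 1 (expsum s c q) (expsum s (fun i => c i * q i) q x).
Proof.
elim: s => [|i s IH].
  have -> : expsum [::] c q = cst 0 by apply/funext => y; rewrite /expsum big_nil.
  by rewrite /expsum big_nil; exact: is_derive_cst.
have -> : expsum (i :: s) c q =
    (fun y => c i * expR (q i * y)) \+ expsum s c q.
  by apply/funext => y; rewrite /expsum big_cons.
rewrite {2}/expsum big_cons -/(expsum s _ q x).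
apply: is_deriveD.
have -> : (fun y => c i * expR (q i * y)) = c i *: (expR \o ( *%R (q i))) by [].
have Hid : is_derive x 1 ( *%R (q i)) (q i).
  have -> : ( *%R (q i)) = q i *: (@id R) by [].
  by apply: is_derive_eq; rewrite /GRing.scale/= mulr1.
apply: is_derive_eq; rewrite /GRing.scale/=; ring.
Qed.

Lemma continuous_expsum s c q : continuous (expsum s c q).
Proof.
move=> x; apply: differentiable_continuous; apply/derivable1_diffP.
exact: (@ex_derive _ _ _ _ _ _ _ (is_derive_expsum s c q x)).
Qed.

Lemma expsum_shift s c q a x :
  expsum s c (fun i => q i - a) x = expR (- (a * x)) * expsum s c q x.
Proof.
rewrite /expsum mulr_sumr; apply: eq_bigr => i _.
by rewrite mulrBl expRD; ring.
Qed.

(** The derivative of a sum of exponentials divided by exp (q_j x): one term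
    fewer, which is what the inductions on the number of terms rest on. *)
Definition dshift s c q j := expsum (rem j s) (fun i => c i * (q i - q j)) (fun i => q i - q j).

Lemma is_derive_dshift s c q j x : uniq s -> j \in s ->
  is_derive x 1 (expsum s c (fun i => q i - q j)) (dshift s c q j x).
Proof.
move=> us js; apply: is_derive_eq; first exact: is_derive_expsum.
rewrite /dshift /expsum (perm_big _ (perm_to_rem js))/= big_cons subrr.
by rewrite mulr0 !mul0r add0r.
Qed.

End ExpSum.

Section RolleSeq.
Variable R : realType.
Implicit Types (F D : R -> R) (x y : R) (xs ys : seq R).

(** The derivative vanishes strictly between consecutive zeros, hence at points
    which are not among the given zeros.  This last fact is what later shows that
    the zeros are simple. *)
Lemma Rolle_path F D x xs : (forall z : R, is_derive z (1 : R) F (D z)) ->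
  path <%R x xs -> F x = 0 -> (forall z, z \in xs -> F z = 0) ->
  exists ys, [/\ size ys = size xs, path <%R x ys, all (<= last x xs) ys,
    (forall y, y \in ys -> D y = 0) & (forall y, y \in ys -> y \notin x :: xs)].
Proof.
move=> dF; elim: xs x => [|z xs IH] x /=; first by exists [::].
move=> /andP[xz pz] Fx0 Fxs.
have Fz : F z = 0 by apply: Fxs; rewrite inE eqxx.
have [ys [sz pys lys Dys Nys]] := IH z pz Fz (fun w w1 => Fxs w (@mem_behead _ (z :: xs) w w1)).
have [||c cxz dc] := @Rolle _ F x z xz _ _ (etrans Fx0 (esym Fz)).
- by move=> w _; exact: (@ex_derive _ _ _ _ _ _ _ (dF w)).
- apply: derivable_within_continuous => w _.
  exact: (@ex_derive _ _ _ _ _ _ _ (dF w)).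
have zlast : z <= last z xs.
  have [->|] := altP (last z xs =P z); first exact: lexx.
  move=> lne; apply: ltW.
  move: pz; rewrite lt_path_pairwise => /andP[/allP+ _]; apply.
  by have := mem_last z xs; rewrite inE (negbTE lne).
have [xc cz] : x < c /\ c < z by move: cxz; rewrite in_itv/= => /andP.
exists (c :: ys); split => /=.
- by rewrite sz.
- rewrite xc/=.
  by case: ys pys {sz lys Dys Nys} => //= y ys /andP[zy ->]; rewrite (lt_trans cz zy).
- by rewrite lys andbT (le_trans (ltW cz)).
- move=> y; rewrite inE => /orP[/eqP->|/Dys//].
  have := dF c => /(@derive_val _ _ _ _ _ _ _) <-.
  exact: (@derive_val _ _ _ _ _ _ _ dc).
- have zltxs w : w \in xs -> z < w.
    by move: pz; rewrite lt_path_pairwise => /andP[/allP+ _]; apply.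
  have zltys w : w \in ys -> z < w.
    by move: pys; rewrite lt_path_pairwise => /andP[/allP+ _]; apply.
  move=> y; rewrite inE => /orP[/eqP->|yys].
    rewrite !inE !negb_or gt_eqF//= lt_eqF//=.
    by apply/negP => /zltxs; rewrite ltNge (ltW cz).
  by rewrite inE negb_or Nys// andbT gt_eqF// (lt_trans xz)// zltys.
Qed.

Lemma Rolle_seq F D xs : (forall z : R, is_derive z (1 : R) F (D z)) -> uniq xs ->
  (forall z, z \in xs -> F z = 0) ->
  exists ys, [/\ uniq ys, size ys = (size xs).-1,
    (forall y, y \in ys -> D y = 0), (forall y, y \in ys -> y \notin xs) &
    (forall u, all (<= u) xs -> all (<= u) ys)].
Proof.
move=> dF uxs Fxs.
have [->|xs0] := eqVneq xs [::].
  by exists [::].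
have pm : perm_eq (sort <=%R xs) xs by rewrite perm_sort.
have ss : sorted <%R (sort <=%R xs) by rewrite sort_lt_sorted.
case E : (sort <=%R xs) pm ss => [|z zs] pm /= ss.
  by move/perm_size: pm => /esym/size0nil; move/eqP: xs0.
have mE w : (w \in xs) = (w \in z :: zs) by rewrite (perm_mem pm).
have [||ys [sz pys lys Dys Nys]] := Rolle_path dF ss.
- by apply: Fxs; rewrite mE inE eqxx.
- by move=> w wz; apply: Fxs; rewrite mE inE wz orbT.
exists ys; split => //.
- by apply: (@sorted_uniq _ <%R) (path_sorted pys); [exact: lt_trans|exact: ltxx].
- by rewrite sz -(perm_size pm).
- by move=> y yys; rewrite mE; exact: Nys.
- move=> u /allP uxs'; apply/allP => y /(allP lys) /le_trans; apply.
  by apply: uxs'; rewrite mE mem_last.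
Qed.

End RolleSeq.

Section ExpSumRoots.
Variables (R : realType) (I : eqType).
Implicit Types (s : seq I) (c q : I -> R) (x y : R) (xs ys : seq R).

Lemma expsum_shift_eq0 s c q a x :
  (expsum s c (fun i => q i - a) x == 0) = (expsum s c q x == 0).
Proof. by rewrite expsum_shift mulf_eq0 expR_eq0. Qed.

Lemma inj_shift s q j : {in s &, injective q} ->
  {in rem j s &, injective (fun i => q i - q j)}.
Proof.
move=> qi i k /mem_rem iS /mem_rem kS /(congr1 (+%R^~ (q j))).
by rewrite !subrK; exact: qi.
Qed.

(** Divide by one exponential and differentiate: Rolle leaves one zero fewer and
    the sum one term fewer. *)
Lemma expsum_roots_eq0 s c q xs : uniq s -> {in s &, injective q} -> uniq xs ->
  (size s <= size xs)%N -> (forall z, z \in xs -> expsum s c q z = 0) ->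
  {in s, forall i, c i = 0}.
Proof.
elim: {s}(size s) {-2}s (erefl (size s)) c q xs => [|n IH] s sn c q xs us qi uxs ss rts.
  by move/size0nil: sn => ->.
case: s sn us qi ss rts => // j s [sn] us qi ss rts.
have js : j \in j :: s by rewrite inE eqxx.
have rE : rem j (j :: s) = s by rewrite /= eqxx.
have [ys [uys sys Dys _ _]] := Rolle_seq (fun z => is_derive_dshift c q z us js) uxs
  (fun z zx => eqP (etrans (expsum_shift_eq0 _ _ _ _ _) (introT eqP (rts z zx)))).
have c0 : {in s, forall i, c i = 0}.
  move=> i iS.
  have : c i * (q i - q j) = 0.
    move: i iS; rewrite -rE.
    apply: (IH _ _ _ (fun k => q k - q j) ys) => //.
    - by rewrite rE.
    - by rewrite rE; case/andP: us.
    - exact: inj_shift.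
    - by rewrite rE sys sn; case: (xs) ss; rewrite //= sn.
  move/eqP; rewrite mulf_eq0 => /orP[/eqP//|].
  rewrite subr_eq0 => /eqP /qi; rewrite js inE iS orbT => /(_ isT isT) ij.
  by move: us => /=; rewrite -ij iS.
move=> i; rewrite inE => /orP[/eqP->|]; last exact: c0.
case: xs ss uxs rts {ys uys sys Dys} => // x xs _ _ /(_ x); rewrite inE eqxx => /(_ isT).
rewrite /expsum big_cons big_seq big1 ?addr0; last by move=> k /c0 ->; rewrite mul0r.
by move/eqP; rewrite mulf_eq0 expR_eq0 orbF => /eqP.
Qed.

Variables (s : seq I) (c q : I -> R) (xs : seq R).
Hypotheses (us : uniq s) (qi : {in s &, injective q}) (uxs : uniq xs).
Hypothesis (sxs : size s = (size xs).+1).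
Hypothesis rts : forall z, z \in xs -> expsum s c q z = 0.
Hypothesis cN0 : exists2 i, i \in s & c i != 0.

Lemma expsum_root_mem x : expsum s c q x = 0 -> x \in xs.
Proof.
move=> Ex; apply/negPn/negP => xxs; case: cN0 => i iS /eqP; apply.
apply: (@expsum_roots_eq0 s c q (x :: xs)) => //=.
- by rewrite xxs.
- by rewrite sxs.
- by move=> z; rewrite inE => /orP[/eqP->|/rts].
Qed.

(** If the derivative vanished at one of the zeros, this point would come in
    addition to the zeros given by Rolle, and the derivative would have as many
    zeros as terms. *)
Lemma dshift_root_simple j x : j \in s -> x \in xs -> dshift s c q j x != 0.
Proof.
move=> js xxs; apply/negP => /eqP Dx.
have [ys [uys sys Dys Nys _]] := Rolle_seq (fun z => is_derive_dshift c q z us js) uxs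
  (fun z zx => eqP (etrans (expsum_shift_eq0 _ _ _ _ _) (introT eqP (rts zx)))).
have c0 : {in rem j s, forall i, c i * (q i - q j) = 0}.
  apply: (@expsum_roots_eq0 _ _ (fun k => q k - q j) (x :: ys)).
  - exact: rem_uniq.
  - exact: inj_shift.
  - by rewrite /= uys andbT; apply/negP => /Nys; rewrite xxs.
  - by rewrite size_rem// sxs /= sys; case: (xs) xxs.
  - by move=> z; rewrite inE => /orP[/eqP->|/Dys].
case: cN0 => i iS /eqP; apply.
have {c0}c0 : {in rem j s, forall i, c i = 0}.
  move=> k ks; have /eqP := c0 k ks; rewrite mulf_eq0 => /orP[/eqP//|].
  rewrite subr_eq0 => /eqP /qi; rewrite js (mem_rem ks) => /(_ isT isT) kj.
  by move: ks; rewrite kj mem_rem_uniqF.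
have [->|ij] := eqVneq i j; last first.
  by apply: c0; rewrite mem_rem_uniq// inE ij.
have := rts xxs; rewrite /expsum (perm_big _ (perm_to_rem js)) big_cons.
rewrite big_seq big1 /=; last by move=> k /c0 ->; rewrite mul0r.
by rewrite addr0 => /eqP; rewrite mulf_eq0 expR_eq0 orbF => /eqP.
Qed.

End ExpSumRoots.

Section ExpSumSign.
Variables (R : realType) (I : eqType).
Implicit Types (s : seq I) (c q : I -> R) (x y : R) (xs ys : seq R).

(** To the right of all zeros the sum has the sign of its leading coefficient;
    the other coefficients follow by induction.  Dividing by the exponential of
    index [j] and differentiating multiplies the coefficient [c i] by
    [q i - q j], whose sign accounts for the change of the count when [j] is
    removed. *)
Lemma expsum_coef_sign s c q xs x i : uniq s -> {in s &, injective q} ->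
  uniq xs -> size s = (size xs).+1 -> (forall z, z \in xs -> expsum s c q z = 0) ->
  all (< x) xs -> 0 < expsum s c q x -> i \in s ->
  0 < (-1) ^+ count (fun j => q i < q j) s * c i.
Proof.
elim: {s}(size s) {-2}s (erefl (size s)) c q xs x i => [|n IH] s sn c q xs x i
  us qi uxs sxs rts ax Ex iS.
  by move/size0nil: sn sxs => ->.
have cN0 : exists2 k, k \in s & c k != 0.
  apply: contrapT => H; move: Ex; rewrite /expsum big_seq big1 ?ltxx// => k ks.
  by have [->|ck] := eqVneq (c k) 0; [rewrite mul0r|case: H; exists k].
have [[j js ji]|H] := pselect (exists2 j, j \in s & j != i); last first.
  have sE : s = [:: i].
    case: s sn us qi iS sxs H {Ex cN0 rts} => // a [|b s] sn us qi iS sxs H.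
      by move: iS; rewrite inE => /eqP ->.
    exfalso; apply: H; have [ai|ai] := eqVneq a i.
      exists b; first by rewrite !inE eqxx orbT.
      by apply/negP => /eqP bi; move: us; rewrite /= inE ai bi eqxx.
    by exists a => //; rewrite inE eqxx.
  move: Ex; rewrite sE /expsum big_seq1 /= ltxx expr0 mul1r.
  by rewrite pmulr_lgt0// expR_gt0.
have srj : size (rem j s) = n by rewrite size_rem// sn.
have [ys [uys sys Dys Nys leys]] := Rolle_seq (fun z => is_derive_dshift c q z us js) uxs
  (fun z zx => eqP (etrans (expsum_shift_eq0 _ _ _ _ _) (introT eqP (rts z zx)))).
have xs_gt0 : (0 < size xs)%N.
  move: sxs; case: s js iS ji {sn us qi rts Ex cN0 IH srj Dys} => // a [|b s] //=.
    by rewrite !inE => /eqP-> /eqP->; rewrite eqxx.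
  by move=> _ _ _ [<-].
have [u uxs' lu] : exists2 u, u \in xs & all (<= u) xs.
  case: xs xs_gt0 {uxs sxs rts ax ys uys sys Dys Nys leys} => // a xs _.
  elim: xs a => [|b xs IHx] a; first by exists a; rewrite ?inE ?eqxx //= lexx.
  have [u uin /= /andP[bu xsu]] := IHx b.
  have [au|ua] := leP a u.
    by exists u; rewrite ?inE in uin *; rewrite ?uin ?orbT//= au bu xsu.
  exists a; first by rewrite inE eqxx.
  rewrite /= lexx (le_trans bu (ltW ua))/=.
  by apply/allP => w /(allP xsu) /le_trans; apply; exact: ltW.
have ux : u < x by exact: (allP ax).
pose F := expsum s c (fun i => q i - q j).
have [xi xiI FE] := @MVT _ F (dshift s c q j) u x ux
  (fun z _ => is_derive_dshift c q z us js)
  (continuous_subspaceT (@continuous_expsum _ _ _ _ _)).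
have [uxi xix] : u < xi /\ xi < x by move: xiI; rewrite in_itv/= => /andP.
have Dxi : 0 < dshift s c q j xi.
  move: FE; have -> : F u = 0.
    by apply/eqP; rewrite /F expsum_shift_eq0; apply/eqP/rts.
  rewrite subr0 => FE.
  have : 0 < F x by rewrite /F expsum_shift mulr_gt0// expR_gt0.
  by rewrite FE pmulr_lgt0// subr_gt0.
have iSj : i \in rem j s by rewrite mem_rem_uniq// inE eq_sym ji.
have := IH _ srj (fun i => c i * (q i - q j)) (fun i => q i - q j) ys xi i
  (rem_uniq _ us) (inj_shift qi) uys _ Dys _ Dxi iSj.
rewrite srj sys; have -> : n = (size xs).-1.+1.
  by rewrite prednK//; move: sxs; rewrite sn => -[].
move=> /(_ erefl); have -> : all (< xi) ys.
  by apply/allP => y /(allP (leys _ lu)) /le_lt_trans; apply.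
move=> /(_ isT).
have qij : q i != q j by apply/negP => /eqP /qi; rewrite iS js => /(_ isT isT) ij; rewrite ij eqxx in ji.
rewrite (eq_count (a2 := fun k => q i < q k)); last by move=> k; rewrite ltrD2r.
have /seq.permP/(_ (fun k => q i < q k)) -> /= := perm_to_rem js.
have [qlt|qge] := boolP (q i < q j).
  rewrite add1n exprS mulN1r mulNr -mulrN => H.
  suff : 0 < ((-1) ^+ count (fun k => q i < q k) (rem j s) * - c i) * (q j - q i).
    by rewrite pmulr_lgt0// subr_gt0.
  by move: H; congr (_ < _); ring.
rewrite add0n mulrA pmulr_lgt0// subr_gt0 lt_neqAle eq_sym qij/=.
by rewrite leNgt.
Qed.

End ExpSumSign.

Section SignConst.
Variable R : realType.
Implicit Types (F D : R -> R) (x y : R) (xs ys : seq R).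

Lemma sgr_near F x : {for x, continuous F} -> F x != 0 ->
  \forall y \near x, Num.sg (F y) = Num.sg (F x).
Proof.
move=> cF; rewrite neq_lt => /orP[Fx|Fx].
  rewrite (ltr0_sg Fx); near=> y; apply: ltr0_sg.
  by near: y; exact: (cvgr_lt _ cF).
rewrite (gtr0_sg Fx); near=> y; apply: gtr0_sg.
by near: y; exact: (cvgr_gt _ cF).
Unshelve. all: by end_near. Qed.

(** The model of a function changing sign exactly at the points of [xs]. *)
Definition rootprod xs x := \prod_(r <- xs) (x - r).

Lemma continuous_rootprod xs : continuous (rootprod xs).
Proof.
elim: xs => [|r xs IH] x.
  have -> : rootprod [::] = cst 1 by apply/funext => y; rewrite /rootprod big_nil.
  exact: cvg_cst.
have -> : rootprod (r :: xs) = (fun y => (y - r) * rootprod xs y).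
  by apply/funext => y; rewrite /rootprod big_cons.
apply: (@cvgM _ _ (nbhs x) _ (fun y => y - r) (rootprod xs)); last exact: IH.
by apply: cvgB; [exact: cvg_id|exact: cvg_cst].
Qed.

Lemma rootprod_eq0 xs x : (rootprod xs x == 0) = (x \in xs).
Proof.
rewrite /rootprod prodf_seq_eq0; apply/hasP/idP => [[r rxs]|xxs].
  by rewrite /= subr_eq0 => /eqP ->.
by exists x => //=; rewrite subrr.
Qed.

Lemma rootprod_gt0 xs x : all (< x) xs -> 0 < rootprod xs x.
Proof.
move=> /allP h; rewrite /rootprod big_seq; apply: prodr_gt0 => r /h.
by rewrite subr_gt0.
Qed.

(** Divided by [rootprod], the function extends to its zeros by a nonzero value
    proportional to the derivative there, so the sign of the quotient is locally
    constant. *)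
Lemma simple_zeros_sign F D xs : (forall z : R, is_derive z (1 : R) F (D z)) ->
  continuous D -> uniq xs -> (forall z, (F z == 0) = (z \in xs)) ->
  (forall z, z \in xs -> D z != 0) -> forall x y, x \notin xs -> y \notin xs ->
  0 < F x * rootprod xs x -> 0 < F y * rootprod xs y.
Proof.
move=> dF cD uxs F0 D0.
have cF : continuous F.
  move=> z; apply: differentiable_continuous; apply/derivable1_diffP.
  exact: (@ex_derive _ _ _ _ _ _ _ (dF z)).
pose W z := if z \in xs then D z * rootprod (rem z xs) z else F z * rootprod xs z.
have W0 z : W z != 0.
  rewrite /W; case: ifP => [zxs|/negbT zxs]; rewrite mulf_neq0 ?D0 ?rootprod_eq0 ?F0//.
  by rewrite mem_rem_uniqF.
pose u z : R := Num.sg (W z).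
have cu : continuous u.
  move=> z; apply: cvg_near_cst; rewrite /u.
  have [zxs|zxs] := boolP (z \in xs).
    have /nbhs_ballP[e e0 he] := sgr_near (@cD z) (D0 z zxs).
    have n0 : rootprod (rem z xs) z != 0 by rewrite rootprod_eq0 mem_rem_uniqF.
    have n1 := sgr_near (@continuous_rootprod (rem z xs) z) n0.
    near=> t.
    have ht : Num.sg (rootprod (rem z xs) t) = Num.sg (rootprod (rem z xs) z).
      by near: t; exact: n1.
    have bt : ball z e t by near: t; exact: (nbhsx_ballx z e e0).
    rewrite /W zxs; have [->|tz] := eqVneq t z; first by rewrite zxs.
    have pt : rootprod xs t = (t - z) * rootprod (rem z xs) t.
      by rewrite /rootprod (perm_big _ (perm_to_rem zxs))/= big_cons.
    have Fz : F z = 0 by apply/eqP; rewrite F0.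
    have [c bc Fc] : exists2 c, ball z e c & F t = D c * (t - z).
      have [tz'|zt|/eqP] := ltrgtP t z; last by rewrite (negbTE tz).
        have [|c cI] := @MVT _ F D t z tz'.
          exact: continuous_subspaceT.
        rewrite Fz sub0r => /(congr1 -%R); rewrite opprK -mulrN opprB => ->.
        exists c => //; move: cI; rewrite in_itv/= => /andP[tc cz].
        move: bt; rewrite /ball/= !gtr0_norm ?subr_gt0//.
        by apply: le_lt_trans; rewrite lerD2l lerN2 ltW.
      have [|c cI] := @MVT _ F D z t zt.
        exact: continuous_subspaceT.
      rewrite Fz subr0 => ->.
      exists c => //; move: cI; rewrite in_itv/= => /andP[zc ct].
      move: bt; rewrite /ball/= !ltr0_norm ?subr_lt0// !opprB.
      by apply: le_lt_trans; rewrite lerD2r ltW.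
    have tF : F t != 0.
      rewrite Fc mulf_neq0 ?subr_eq0//.
      by rewrite -sgr_eq0 (he _ bc) sgr_eq0 D0.
    have -> : (t \in xs) = false by apply/negbTE; rewrite -F0.
    rewrite pt Fc mulrA sgrM ht [RHS]sgrM; congr (_ * _).
    by rewrite -mulrA -expr2 sgrM (he _ bc) sgrX expr2 -sgrM mulrC -expr2 gtr0_sg
      ?mul1r// exprn_even_gt0// subr_eq0.
  have cW : {for z, continuous (fun t => F t * rootprod xs t)}.
    by apply: (@cvgM _ _ (nbhs z) _ F (rootprod xs)); [exact: cF|exact: continuous_rootprod].
  have n0 : F z * rootprod xs z != 0 by rewrite mulf_neq0 ?rootprod_eq0 ?F0.
  have n1 := sgr_near cW n0.
  near=> t.
  have ht : Num.sg (F t * rootprod xs t) = Num.sg (F z * rootprod xs z).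
    by near: t; exact: n1.
  rewrite /W (negbTE zxs); suff -> : (t \in xs) = false by [].
  apply/negbTE/negP => txs; move: ht; have /eqP -> : F t == 0 by rewrite F0.
  by move/eqP; rewrite mul0r sgr0 eq_sym sgr_eq0 (negbTE n0).
have uconst a b : a <= b -> u a = u b.
  move=> ab; apply: contrapT => uab.
  have [||c _] := @IVT _ u a b 0 ab.
  - exact: continuous_subspaceT.
  - move: uab; rewrite /u.
    have [Wa|Wa|/eqP] := ltrgtP (W a) 0; last by rewrite (negbTE (W0 a)).
      rewrite (ltr0_sg Wa); have [Wb|Wb|/eqP] := ltrgtP (W b) 0;
        last by rewrite (negbTE (W0 b)).
        by rewrite (ltr0_sg Wb).
      by rewrite (gtr0_sg Wb) ge_min le_max ?lerN10 ?ler01 ?orbT.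
    rewrite (gtr0_sg Wa); have [Wb|Wb|/eqP] := ltrgtP (W b) 0;
      last by rewrite (negbTE (W0 b)).
      by rewrite (ltr0_sg Wb) ge_min le_max ?lerN10 ?ler01 ?orbT.
    by rewrite (gtr0_sg Wb).
  by move/eqP; rewrite /u sgr_eq0 (negbTE (W0 c)).
move=> x y xxs yxs; rewrite -!sgr_cp0.
have -> : F x * rootprod xs x = W x by rewrite /W (negbTE xxs).
have -> : F y * rootprod xs y = W y by rewrite /W (negbTE yxs).
move/eqP => <-; apply/eqP; rewrite -!/(u _).
by have [/uconst|/ltW/uconst] := leP x y.
Unshelve. all: by end_near. Qed.

End SignConst.

Section ExpSumExists.
Variables (R : realType) (I : eqType).
Implicit Types (s : seq I) (c q : I -> R) (x y : R) (xs ys : seq R).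

(** A matrix with more rows than columns has a nonzero left kernel. *)
Lemma expsum_vanish s q xs : uniq s -> size s = (size xs).+1 ->
  exists2 c, (exists2 i, i \in s & c i != 0) &
    forall z, z \in xs -> expsum s c q z = 0.
Proof.
move=> us sxs; have [i0 _] : exists i0, i0 \in s.
  by case: s us sxs => // i0 s _ _; exists i0; rewrite inE eqxx.
pose m := size xs; pose A := \matrix_(i < m.+1, j < m)
  expR (q (nth i0 s i) * nth 0 xs j).
have : kermx A != 0.
  by rewrite kermx_eq0 -row_leq_rank -ltnNge ltnS rank_leq_col.
case/rowV0Pn => v /sub_kermxP vA v0.
pose c i := v 0 (inord (index i s)).
have sE f : \sum_(i <- s) f i = \sum_(k < m.+1) f (nth i0 s k) :> R.
  by rewrite (big_nth i0) sxs big_mkord.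
have cE (k : 'I_m.+1) : c (nth i0 s k) = v 0 k.
  by rewrite /c index_uniq// ?inord_val// sxs.
exists c.
  apply: contrapT => H; move/eqP: v0; apply; apply/rowP => k; rewrite mxE -cE.
  apply: contrapT => /eqP ck; apply: H; exists (nth i0 s k) => //.
  by rewrite mem_nth// sxs.
move=> z zxs; have jm : (index z xs < m)%N by rewrite index_mem.
have /matrixP/(_ 0 (Ordinal jm)) := vA; rewrite !mxE => <-.
rewrite /expsum sE; apply: eq_bigr => k _.
by rewrite cE mxE /= nth_index.
Qed.

End ExpSumExists.

Section Descartes.
Variables (R : realType) (I : eqType).
Implicit Types (s : seq I) (c q : I -> R) (x y : R) (xs ys : seq R).

(** A nonzero combination vanishing at the points has no other zero and simple
    zeros only, so after a normalisation it has the sign of [rootprod]; the signs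
    of its coefficients follow. *)
Lemma descartes_combination s q xs : uniq s -> {in s &, injective q} -> uniq xs ->
  size s = (size xs).+1 ->
  exists c, (forall x, x \notin xs -> 0 < expsum s c q x * rootprod xs x) /\
    {in s, forall i, 0 < (-1) ^+ count (fun j => q i < q j) s * c i}.
Proof.
move=> us qi uxs sxs.
have [c0 cN0 rts] := expsum_vanish q us sxs.
have [x0 ax] : exists x0, all (< x0) xs.
  elim: (xs) => [|r rs [x0 h]]; first by exists 0.
  exists (Num.max x0 (r + 1)); apply/allP => z; rewrite inE => /orP[/eqP->|/(allP h) /= zx] /=.
    by rewrite lt_max ltrDl ltr01 orbT.
  by rewrite lt_max zx.
have x0xs : x0 \notin xs by apply/negP => /(allP ax) /=; rewrite ltxx.
have Ex0 : expsum s c0 q x0 != 0.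
  by apply/negP => /eqP /(expsum_root_mem us qi uxs sxs rts cN0); rewrite (negbTE x0xs).
pose k := Num.sg (expsum s c0 q x0).
pose c i := k * c0 i.
have k0 : k != 0 by rewrite sgr_eq0.
have cE x : expsum s c q x = k * expsum s c0 q x.
  by rewrite /expsum mulr_sumr; apply: eq_bigr => i _; rewrite /c mulrA.
have {}cN0 : exists2 i, i \in s & c i != 0.
  by case: cN0 => i iS ci; exists i => //; rewrite /c mulf_neq0.
have {}rts z : z \in xs -> expsum s c q z = 0 by move=> /rts; rewrite cE => ->; rewrite mulr0.
have {}Ex0 : 0 < expsum s c q x0.
  by rewrite cE /k -normrEsg normr_gt0.
exists c; split; last first.
  by move=> i iS; apply: (expsum_coef_sign us qi uxs sxs rts ax).
have [j js _] := cN0.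
have H := @simple_zeros_sign _ _ _ xs (fun z => is_derive_dshift c q z us js)
  (@continuous_expsum _ _ _ _ _) uxs _ _ x0.
move=> x xxs.
have /H : forall z, (expsum s c (fun i => q i - q j) z == 0) = (z \in xs).
  move=> z; rewrite expsum_shift_eq0; apply/eqP/idP; last exact: rts.
  exact: (expsum_root_mem us qi uxs sxs rts cN0).
move=> {}H.
have /H : forall z, z \in xs -> dshift s c q j z != 0.
  by move=> z; exact: (dshift_root_simple us qi uxs sxs rts cN0).
move=> /(_ x x0xs xxs); rewrite !expsum_shift.
rewrite -!mulrA !(pmulr_rgt0 _ (expR_gt0 _)); apply.
by rewrite mulr_gt0// rootprod_gt0.
Qed.

End Descartes.

(** * Sign changes of an arbitrary function *)
Section SignChanges.
Variable R : realType.
Implicit Types (h : R -> R) (x y : R) (xs ys : seq R).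

(** [n] changes of sign along increasing points, the last of which is [x], with
    sign [sg]; read from right to left, since the last sign is what matters. *)
Fixpoint alternates h (n : nat) (sg : bool) x : Prop :=
  (if sg then 0 < h x else h x < 0) /\
  (if n is n'.+1 then exists2 y, y < x & alternates h n' (~~ sg) y else True).

Lemma alternates_opp h n sg x : alternates (- h) n sg x -> alternates h n (~~ sg) x.
Proof.
elim: n sg x => [|n IH] sg x /= [hx H]; split.
- by case: sg hx => /=; rewrite ?oppr_gt0 ?oppr_lt0.
- by [].
- by case: sg hx {H} => /=; rewrite ?oppr_gt0 ?oppr_lt0.
- by case: H => y yx /IH; exists y.
Qed.

Lemma alternates_trunc h X n sg x :
  alternates (fun x => if x < X then - h x else 0) n sg x ->
  x < X /\ alternates h n (~~ sg) x.
Proof.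
elim: n sg x => [|n IH] sg x /= [hx H].
  have [xX|xX] := ltP x X; move: hx.
    by rewrite xX; case: sg => /=; rewrite ?oppr_gt0 ?oppr_lt0.
  by rewrite (le_gtF xX); case: sg => /=; rewrite ltxx.
have xX : x < X.
  by rewrite ltNge; apply/negP => xX; move: hx; rewrite (le_gtF xX); case: sg H => _ /=; rewrite ltxx.
split => //; split.
  by move: hx; rewrite xX; case: sg H => _ /=; rewrite ?oppr_gt0 ?oppr_lt0.
by case: H => y yx /IH[_ ?]; exists y.
Qed.

Lemma alternates_extend h n x y : alternates h n true x -> x < y -> h y < 0 ->
  alternates h n.+1 false y.
Proof. by move=> H xy hy; split => //; exists x. Qed.

(** Let [X] be the supremum of the points where [h] is negative.  Beyond [X] the
    function is nonnegative, so up to sign the induction applies to its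
    restriction to the left of [X].  The points [zs] where nothing is claimed form
    a finite set, which is negligible. *)
Lemma sign_change_weak h n : (forall x, ~ alternates h n false x) ->
  exists (xs zs : seq R) (e : R), [/\ (size xs <= n)%N, e = 1 \/ e = -1,
    (size xs = n -> e = 1),
    (forall u, (forall x, u < x -> h x = 0) -> all (<= u) xs) &
    forall x, x \notin zs -> 0 <= e * h x * rootprod xs x].
Proof.
elim: n h => [|n IH] h Hh.
  exists [::], [::], 1; split => //; first by left.
  move=> x _; rewrite /rootprod big_nil mulr1 mul1r leNgt; apply/negP => hx.
  by apply: (Hh x).
have [[x0 hx0]|Hpos] := pselect (exists x, h x < 0); last first.
  exists [::], [::], 1; split => //; first by left.
  move=> x _; rewrite /rootprod big_nil mulr1 mul1r leNgt; apply/negP => hx.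
  by apply: Hpos; exists x.
have [ub|nub] := pselect (exists u, forall x, h x < 0 -> x <= u); last first.
  have [|xs [zs [e [sxs e1 en eu He]]]] := IH (- h).
    move=> x /alternates_opp /= Hx; apply: nub; exists x => y hy.
    rewrite leNgt; apply/negP => xy.
    exact: (Hh y (alternates_extend Hx xy hy)).
  exists xs, zs, (- e); split.
  - exact: leqW.
  - by case: e1 => ->; [right|left; rewrite opprK].
  - by move=> E; move: sxs; rewrite E ltnn.
  - by move=> u hu; apply: eu => x /hu; rewrite fctE => ->; rewrite oppr0.
  - by move=> x /He; rewrite fctE; congr (_ <= _); ring.
pose N := [set x | h x < 0]; pose X := sup N.
have hN : has_sup N by split; [exists x0|case: ub => u hu; exists u].
have XN x : X < x -> 0 <= h x.
  move=> Xx; rewrite leNgt; apply/negP => hx; move: Xx; rewrite ltNge => /negP; apply.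
  exact: (ub_le_sup hN.2).
have [|xs [zs [e [sxs e1 en eu He]]]] := IH (fun x => if x < X then - h x else 0).
  move=> x /alternates_trunc[xX Hx].
  have [|y /= hy xy] := sup_gt _ xX; first by exists x0.
  exact: (Hh y (alternates_extend Hx xy hy)).
have xsX : all (<= X) xs.
  by apply: eu => x Xx; rewrite ltNge (ltW Xx).
have p0 x : X < x -> 0 < rootprod xs x.
  move=> Xx; apply: rootprod_gt0; apply/allP => z /(allP xsX) /= zX.
  exact: le_lt_trans Xx.
have XU u : (forall x, u < x -> h x = 0) -> X <= u.
  move=> hu; apply: ge_sup; first by exists x0.
  by move=> x; rewrite /N /= => hx; rewrite leNgt; apply/negP => /hu hx00; rewrite hx00 ltxx in hx.
have lexs u : (forall x, u < x -> h x = 0) -> all (<= u) xs.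
  by move=> /XU Xu; apply/allP => z /(allP xsX) /= /le_trans; apply.
have [e_1|e_N1] : e = 1 \/ e = -1 by [].
  exists (X :: xs), (X :: zs), 1; split => //.
  - by left.
  - by move=> u hu; rewrite /= lexs// XU.
  move=> x; rewrite inE negb_or => /andP[xX xxs].
  rewrite /rootprod big_cons -/(rootprod xs x).
  have := He x xxs; rewrite e_1; case: (ltP x X) => [Xx He'|].
    have : 0 <= 1 * - h x * rootprod xs x * (X - x).
      by rewrite mulr_ge0// subr_ge0 ltW.
    by congr (_ <= _); ring.
  rewrite le_eqVlt eq_sym (negbTE xX)/= => Xx _.
  by rewrite mul1r mulr_ge0 ?XN// mulr_ge0 ?subr_ge0 ?ltW ?p0.
exists xs, (X :: zs), 1; split => //.
- exact: leqW.
- by left.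
move=> x; rewrite inE negb_or => /andP[xX xxs].
have := He x xxs; rewrite e_N1; case: (ltP x X) => [Xx|]; first by congr (_ <= _); ring.
rewrite le_eqVlt eq_sym (negbTE xX)/= => Xx _.
by rewrite mul1r mulr_ge0 ?XN// ltW ?p0.
Qed.

(** A point occurring twice marks no change of sign: cancel such pairs. *)
Lemma rootprod_uniq xs : exists ys, [/\ uniq ys, {subset ys <= xs},
  (size ys <= size xs)%N, (size ys = size xs -> ys = xs) &
  forall x, x \notin xs -> 0 < rootprod xs x * rootprod ys x].
Proof.
elim: xs => [|r xs [ys [uys sub le_s eq_s H]]].
  by exists [::]; split => // x _; rewrite /rootprod big_nil mulr1.
have [ry|ry] := boolP (r \in ys); last first.
  exists (r :: ys); split => //=.
  - by rewrite ry.
  - move=> z; rewrite !inE => /orP[->//|/sub->]; exact: orbT.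
  - by move=> [/eq_s ->].
  - move=> x; rewrite inE negb_or => /andP[xr /H].
    rewrite /rootprod !big_cons -!/(rootprod _ x) => P.
    rewrite mulrACA -expr2 mulr_gt0// exprn_even_gt0//.
    by rewrite subr_eq0.
exists (rem r ys); split.
- exact: rem_uniq.
- by move=> z /mem_rem /sub zxs; rewrite inE zxs orbT.
- by rewrite size_rem//= (leq_trans (leq_pred _))// leqW.
- rewrite size_rem//= => E; have := leq_pred (size ys).
  by rewrite E => /leq_trans /(_ le_s); rewrite ltnn.
move=> x; rewrite inE negb_or => /andP[xr /H].
have -> : rootprod ys x = (x - r) * rootprod (rem r ys) x.
  by rewrite /rootprod (perm_big _ (perm_to_rem ry)) big_cons.
by rewrite [rootprod (r :: xs) x]/rootprod big_cons -/(rootprod _ x); congr (_ < _); ring.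
Qed.

(** [h] has the sign of [e * rootprod xs] for at most [n] distinct points; with
    exactly [n] of them the final sign is positive. *)
Lemma sign_change_points h n : (forall x, ~ alternates h n false x) ->
  exists (xs zs : seq R) (e : R), [/\ uniq xs, (size xs <= n)%N, e = 1 \/ e = -1,
    (size xs = n -> e = 1) &
    forall x, x \notin zs -> 0 <= e * h x * rootprod xs x].
Proof.
move=> /sign_change_weak[xs [zs [e [sxs e1 en _ He]]]].
have [ys [uys _ sys eys Hys]] := rootprod_uniq xs.
exists ys, (xs ++ zs), e; split => //.
- exact: leq_trans sxs.
- move=> sn; apply: en; apply/eqP; rewrite eqn_leq sxs -sn sys//.
move=> x; rewrite mem_cat negb_or => /andP[/Hys P /He].
move=> Q; have P' : 0 < rootprod xs x ^+ 2.
  rewrite lt_def sqr_ge0 andbT expf_neq0//.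
  by apply/negP => /eqP E; rewrite E mul0r ltxx in P.
have : 0 <= (e * h x * rootprod xs x) * (rootprod xs x * rootprod ys x).
  by rewrite mulr_ge0// ltW.
have -> : (e * h x * rootprod xs x) * (rootprod xs x * rootprod ys x) =
  rootprod xs x ^+ 2 * (e * h x * rootprod ys x) by ring.
by rewrite pmulr_rge0.
Qed.

End SignChanges.

(** * Log-concave functions and simple functions *)
Section LogConcave.
Variable R : realType.
Implicit Types (f g : R -> R) (a b : \bar R) (s t x y z l : R).

(** Log-concavity on the half-line, in a multiplicative form that allows the
    value [0].  A product of rescaled functions is then handled factor by
    factor. *)
Definition halfLC f : Prop :=
  [/\ f 0 = 1, forall t, 0 <= t -> 0 <= f t,
      forall s t, 0 <= s -> s <= t -> f t <= f s &
      forall x y l, 0 <= x -> 0 <= y -> 0 < l < 1 ->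
        f x `^ l * f y `^ (1 - l) <= f (l * x + (1 - l) * y)].

Lemma halfLC_ge0 f t : halfLC f -> 0 <= t -> 0 <= f t.
Proof. by case=> _ + _ _; apply. Qed.

Lemma halfLC_anti f s t : halfLC f -> 0 <= s -> s <= t -> f t <= f s.
Proof. by case=> _ _ + _; apply. Qed.

Lemma halfLC_le1 f t : halfLC f -> 0 <= t -> f t <= 1.
Proof. by case=> <- _ + _ t0; apply. Qed.

Lemma halfLC1 : halfLC (fun=> 1).
Proof. by split => // x y l _ _ _; rewrite !powR1 mulr1. Qed.

Lemma halfLCM f g : halfLC f -> halfLC g -> halfLC (fun t => f t * g t).
Proof.
move=> F G; have [f0 fp fa fl] := F; have [g0 gp ga gl] := G; split.
- by rewrite f0 g0 mulr1.
- by move=> t t0; rewrite mulr_ge0 ?fp ?gp.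
- move=> s t s0 st; have t0 := le_trans s0 st.
  by apply: ler_pM; [exact: fp|exact: gp|exact: fa|exact: ga].
- move=> x y l x0 y0 l01; rewrite !powRM ?fp ?gp//.
  rewrite mulrACA; apply: ler_pM; rewrite ?mulr_ge0 ?powR_ge0//.
    exact: fl.
  exact: gl.
Qed.

Lemma halfLC_scale f s : 0 <= s -> halfLC f -> halfLC (fun t => f (s * t)).
Proof.
move=> s0 [f0 fp fa fl]; split.
- by rewrite mulr0.
- by move=> t t0; apply: fp; rewrite mulr_ge0.
- by move=> u t u0 ut; apply: fa; rewrite ?mulr_ge0// ler_wpM2l.
- move=> x y l x0 y0 l01.
  have -> : s * (l * x + (1 - l) * y) = l * (s * x) + (1 - l) * (s * y) by ring.
  by apply: fl; rewrite ?mulr_ge0.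
Qed.

Lemma halfLC_gauss s : 0 <= s -> halfLC (fun t => expR (- (s * t ^+ 2))).
Proof.
move=> s0; split.
- by rewrite expr0n/= mulr0 oppr0 expR0.
- by move=> t _; exact: expR_ge0.
- move=> u t u0 ut; rewrite ler_expR lerN2 ler_wpM2l//.
  by rewrite ler_sqr ?nnegrE// (le_trans u0).
- move=> x y l x0 y0 /andP[l0 l1].
  rewrite -!expRM -expRD ler_expR -subr_ge0.
  have -> : - (s * (l * x + (1 - l) * y) ^+ 2) -
    (- (s * x ^+ 2) * l + - (s * y ^+ 2) * (1 - l)) =
    s * (l * (1 - l) * (x - y) ^+ 2) by ring.
  by rewrite mulr_ge0// mulr_ge0 ?sqr_ge0// mulr_ge0// ?subr_ge0 ltW.
Qed.

(** Monotonicity comes from evenness: s in [0, t[ is a convex combination of t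
    and -t. *)
Lemma calL_halfLC f : calL f -> halfLC f.
Proof.
case=> -[V [VN cV fV]] fe f0.
have fp t : 0 <= f t by rewrite -lee_fin fV expeR_ge0.
have lc x y l : 0 < l < 1 ->
    f x `^ l * f y `^ (1 - l) <= f (l * x + (1 - l) * y).
  move=> /andP[l0 l1]; have l1' : 0 < 1 - l by rewrite subr_gt0.
  have [fx0|fx0] := eqVneq (f x) 0.
    by rewrite fx0 powR0 ?gt_eqF// mul0r.
  have [fy0|fy0] := eqVneq (f y) 0.
    by rewrite fy0 (@powR0 _ (1 - l)) ?gt_eqF// mulr0.
  have Vfin z : f z != 0 -> exists2 v, V z = v%:E & f z = expR (- v).
    move=> fz; have := fV z; have := VN z; case: (V z) => [v||] //= _.
      by move=> [->]; exists v.
    by move=> [] E; rewrite E eqxx in fz.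
  have [v Vx ->] := Vfin x fx0; have [w Vy ->] := Vfin y fy0.
  have l01 : 0 <= l <= 1 by rewrite !ltW.
  have := cV x y l l01; rewrite Vx Vy => H.
  rewrite -!expRM -expRD -lee_fin fV.
  have -> : (expR (- v * l + - w * (1 - l)))%:E =
    expeR (- (l%:E * v%:E + (1 - l)%:E * w%:E))%E.
    rewrite -!EFinM -EFinD -EFinN/=; congr (expR _)%:E; ring.
  by rewrite lee_expeR leeN2.
split => //; last by move=> x y l _ _; exact: lc.
move=> s t s0 st; have [->//|ts] := eqVneq s t.
have {ts}st : s < t by rewrite lt_neqAle ts.
have t0 : 0 < t by exact: le_lt_trans st.
have t2 : 0 < 2 * t by lra.
pose l := (s + t) / (2 * t).
have l01 : 0 < l < 1.
  apply/andP; split; first by rewrite divr_gt0//; lra.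
  by rewrite ltr_pdivrMr//; lra.
have := lc t (- t) l l01.
rewrite fe -powRD; last by apply/implyP => /eqP; lra.
have -> : l * t + (1 - l) * - t = s.
  rewrite /l; have : t != 0 by rewrite gt_eqF.
  by move=> ?; field.
have -> : l + (1 - l) = 1 by ring.
by rewrite powRr1.
Qed.

End LogConcave.

Section Kernel.
Variable R : realType.
Implicit Types (f g : R -> R) (a b : \bar R) (s t x y z l r : R).

(** For [0 <= a] the exponential is at most [1], so [fine] loses nothing.
    Infinite parameters are the degenerate kinks: a cut-off at [b] for [a = +oo], the constant [1]
    for [b = +oo]. *)
Definition kink a b t : R := fine (expeR (- (a * hinge b t))).

Lemma hinge_fin s t : hinge s%:E t = (Num.max (`|t| - s) 0)%:E.
Proof. by rewrite /hinge -EFinB -EFin_max. Qed.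

Lemma hinge_pinfty t : hinge +oo t = 0%E.
Proof. by rewrite /hinge /= /maxe ltNyr. Qed.

Lemma kink_fin r s t : kink r%:E s%:E t = expR (- (r * Num.max (`|t| - s) 0)).
Proof. by rewrite /kink hinge_fin. Qed.

Lemma kink_cut s t : kink +oo s%:E t = (`|t| <= s)%R%:R.
Proof.
rewrite /kink hinge_fin; have [ts|ts] := leP `|t| s.
  by rewrite max_r ?subr_le0// mule0 oppe0 expeR0.
by rewrite max_l ?subr_ge0 ?ltW// gt0_mulye ?lte_fin ?subr_gt0//= .
Qed.

Lemma kink_pinfty a t : kink a +oo t = 1.
Proof. by rewrite /kink hinge_pinfty mule0 oppe0 expeR0. Qed.

Lemma kink0 b t : kink 0 b t = 1.
Proof. by rewrite /kink mul0e oppe0 expeR0. Qed.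

Lemma kinkN a b t : kink a b (- t) = kink a b t.
Proof. by rewrite /kink /hinge normrN. Qed.

Lemma maxr0_convex x y l s : 0 < l < 1 ->
  Num.max (l * x + (1 - l) * y - s) 0 <=
  l * Num.max (x - s) 0 + (1 - l) * Num.max (y - s) 0.
Proof.
move=> /andP[l0 l1]; rewrite ge_max; apply/andP; split.
  have -> : l * x + (1 - l) * y - s = l * (x - s) + (1 - l) * (y - s) by ring.
  by apply: lerD; apply: ler_wpM2l; rewrite ?le_max ?lexx ?subr_ge0// ltW.
by rewrite addr_ge0// mulr_ge0 ?le_max ?lexx ?orbT ?subr_ge0// ltW.
Qed.

Lemma kink_halfLC a b : (0 <= a)%E -> (0 <= b)%E -> halfLC (kink a b).
Proof.
case: b => [s| |]; last by rewrite leeNy_eq.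
  rewrite lee_fin; case: a => [r| |]; last by rewrite leeNy_eq.
    rewrite lee_fin => r0 s0; split.
    - by rewrite kink_fin normr0 sub0r max_r ?oppr_le0// mulr0 oppr0 expR0.
    - by move=> t _; rewrite kink_fin expR_ge0.
    - move=> u t u0 ut; rewrite !kink_fin ler_expR lerN2 ler_wpM2l//.
      rewrite !ger0_norm//; last exact: le_trans ut.
      by rewrite ge_max !le_max lerD2r ut lexx !orbT.
    - move=> x y l x0 y0 l01; have /andP[l0 l1] := l01.
      have xy0 : 0 <= l * x + (1 - l) * y.
        by rewrite addr_ge0// mulr_ge0// ?subr_ge0 ltW.
      rewrite !kink_fin !ger0_norm// -!expRM -expRD ler_expR.
      have := ler_wpM2l r0 (maxr0_convex x y s l01); lra.
  move=> _ s0; split.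
  - by rewrite kink_cut normr0 s0.
  - by move=> t _; rewrite kink_cut.
  - move=> u t u0 ut; rewrite !kink_cut ler_nat.
    rewrite !ger0_norm//; last exact: le_trans ut.
    by case: (leP t s) => // ts; rewrite (le_trans ut ts).
  - move=> x y l x0 y0 /andP[l0 l1].
    have l1' : 0 < 1 - l by rewrite subr_gt0.
    have xy0 : 0 <= l * x + (1 - l) * y by rewrite addr_ge0// mulr_ge0// ltW.
    rewrite !kink_cut !ger0_norm//.
    have [xs|xs] := leP x s; last by rewrite powR0 ?gt_eqF// mul0r.
    have [ys|ys] := leP y s; last by rewrite (@powR0 _ (1 - l)) ?gt_eqF// mulr0.
    rewrite !powR1 mulr1.
    suff -> : l * x + (1 - l) * y <= s by [].
    have := ler_wpM2l (ltW l0) xs; have := ler_wpM2l (ltW l1') ys; lra.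
move=> a0 _; rewrite (_ : kink a +oo = fun=> 1); first exact: halfLC1.
by apply/funext => t; rewrite kink_pinfty.
Qed.

(** Beyond its node a kink is log-affine, or [0] if it is a cut-off; before its
    node it is [1].  The interval may start at the node, and a cut-off there is
    dealt with separately, as its values are [1] and then [0]. *)
Lemma kink_logconvex a b x z l : (0 <= a)%E -> (0 <= b)%E ->
  0 <= x -> x <= z -> 0 < l < 1 ->
  ~ [/\ (0 < a)%E, (x%:E < b)%E & (b < z%:E)%E] ->
  kink a b (l * x + (1 - l) * z) <= kink a b x `^ l * kink a b z `^ (1 - l).
Proof.
move=> a0 b0 x0 xz l01 H; have /andP[l0 l1] := l01.
have l1' : 0 < 1 - l by rewrite subr_gt0.
have z0 := le_trans x0 xz.
have y0 : 0 <= l * x + (1 - l) * z by rewrite addr_ge0// mulr_ge0// ltW.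
have yx : x <= l * x + (1 - l) * z.
  have := ler_wpM2l (ltW l1') xz; lra.
have yz : l * x + (1 - l) * z <= z.
  have := ler_wpM2l (ltW l0) xz; lra.
have [[t0 kp ka _]] := kink_halfLC a0 b0.
have k1 u : 0 <= u -> kink a b u <= 1 by move=> u0; rewrite -t0; exact: ka.
have [->|an0] := eqVneq a 0%E; first by rewrite !kink0 !powR1 mulr1.
have {}a0 : (0 < a)%E by rewrite lt_def an0.
case: b b0 H t0 kp ka k1 => [s| |]; last by rewrite leeNy_eq.
  rewrite lee_fin => s0; rewrite !lte_fin => H t0 kp ka k1.
  have [sx|xs] := leP s x.
    case: a a0 an0 H t0 kp ka k1 => [r| |] a0 an0 H t0 kp ka k1 //.
      rewrite !kink_fin -!expRM -expRD ler_expR !ger0_norm//.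
      rewrite !max_l ?subr_ge0//; [|exact: le_trans xz|exact: le_trans yx].
      lra.
    have [xs|xs] := eqVneq x s; last first.
      rewrite [X in X <= _]kink_cut ger0_norm//.
      suff /lt_geF -> : s < l * x + (1 - l) * z by rewrite mulr_ge0 ?powR_ge0.
      by rewrite (lt_le_trans _ yx)// lt_neqAle eq_sym xs.
    rewrite [X in X <= _]kink_cut ger0_norm// -xs.
    have [xz'|xz'] := eqVneq x z.
      rewrite -xz' -powRD; last by apply/implyP => /eqP; lra.
      have -> : l + (1 - l) = 1 by ring.
      rewrite powRr1 ?kp// kink_cut ger0_norm// xs lexx.
      by rewrite lern1 leq_b1.
    have /lt_geF -> : x < l * x + (1 - l) * z.
      have xz'' : x < z by rewrite lt_neqAle xz'.
      by have := ltr_pM2l l1' x z; rewrite xz''; lra.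
    by rewrite mulr_ge0 ?powR_ge0.
  have zs : z <= s by rewrite leNgt; apply/negP => sz; apply: H.
  have k_1 u : 0 <= u -> u <= z -> kink a s%:E u = 1.
    move=> u0 uz; rewrite /kink hinge_fin ger0_norm// max_r ?mule0 ?oppe0 ?expeR0//.
    by rewrite subr_le0 (le_trans uz).
  by rewrite !k_1// !powR1 mulr1.
by move=> *; rewrite !kink_pinfty !powR1 mulr1.
Qed.

End Kernel.

Section Simple.
Variable R : realType.
Implicit Types (f g : R -> R) (a b : nat -> \bar R) (s t x y z l r : R).

Definition simple K a b t : R := \prod_(i < K) kink (a i) (b i) t.

Lemma simple_halfLC K a b : admissible a b -> halfLC (simple K a b).
Proof.
case=> a0 b0 _; elim: K => [|K IH].
  rewrite (_ : simple 0 a b = fun=> 1); first exact: halfLC1.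
  by apply/funext => t; rewrite /simple big_ord0.
rewrite (_ : simple K.+1 a b = fun t => simple K a b t * kink (a K) (b K) t).
  by apply: halfLCM => //; exact: kink_halfLC.
by apply/funext => t; rewrite /simple big_ord_recr.
Qed.

Lemma simpleN K a b t : simple K a b (- t) = simple K a b t.
Proof. by apply: eq_bigr => i _; rewrite kinkN. Qed.

Lemma kink_ge0 (u v : \bar R) t : 0 <= kink u v t.
Proof. by rewrite /kink fine_ge0// expeR_ge0. Qed.

Lemma simple_ge0 K a b t : 0 <= simple K a b t.
Proof. by apply: prodr_ge0 => i _; exact: kink_ge0. Qed.

Lemma powR_prod n (F : 'I_n -> R) l : (forall i, 0 <= F i) ->
  (\prod_(i < n) F i) `^ l = \prod_(i < n) F i `^ l.
Proof.
elim: n F => [|n IH] F F0; first by rewrite !big_ord0 powR1.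
rewrite !big_ord_recr/= powRM//; last by apply: prodr_ge0 => i _.
by rewrite IH.
Qed.

Definition kink_in K a b x z :=
  exists i, [/\ (i < K)%N, (0 < a i)%E, (x%:E < b i)%E & (b i < z%:E)%E].

(** The interior of the interval contains no effective node. *)
Lemma simple_logconvex K a b x z l : admissible a b -> 0 <= x -> x <= z ->
  0 < l < 1 -> ~ kink_in K a b x z ->
  simple K a b (l * x + (1 - l) * z) <=
  simple K a b x `^ l * simple K a b z `^ (1 - l).
Proof.
move=> [a0 b0 _] x0 xz l01 H; rewrite /simple.
rewrite !powR_prod -?big_split/=; try by move=> i; exact: kink_ge0.
apply: ler_prod => i _; rewrite kink_ge0/=.
apply: kink_logconvex => // -[ai xb bz].
by apply: H; exists i; split.
Qed.

(** Otherwise [g] is log-convex between [x] and [z], hence below the log-concave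
    [f] at [y]. *)
Lemma kink_between K a b f x y z : admissible a b -> halfLC f ->
  0 <= x -> x < y -> y < z -> simple K a b x <= f x -> f y < simple K a b y ->
  simple K a b z <= f z -> kink_in K a b x z.
Proof.
move=> ab F x0 xy yz gfx fgy gfz; apply: contrapT => H.
have xz : x < z by exact: lt_trans yz.
have zx0 : 0 < z - x by rewrite subr_gt0.
pose l := (z - y) / (z - x).
have l01 : 0 < l < 1.
  rewrite divr_gt0 ?subr_gt0//= ltr_pdivrMr// mul1r; lra.
have yE : l * x + (1 - l) * z = y.
  by rewrite /l; have := lt0r_neq0 zx0 => ?; field.
have z0 : 0 <= z by rewrite (le_trans x0)// ltW.
have := simple_logconvex ab x0 (ltW xz) l01 H; rewrite yE => gy.
have [_ _ _ /(_ x z l x0 z0 l01)] := F; rewrite yE => fy.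
move: fgy; rewrite ltNge => /negP; apply.
apply: (le_trans gy); apply: le_trans fy.
have /andP[l0 l1] := l01.
apply: ler_pM; rewrite ?powR_ge0//; apply: ge0_ler_powR;
  rewrite ?nnegrE ?simple_ge0 ?subr_ge0 ?(ltW l0) ?(ltW l1)//.
- exact: halfLC_ge0.
- exact: halfLC_ge0.
Qed.

Lemma simple_lt1 K a b t : admissible a b -> 0 <= t -> simple K a b t < 1 ->
  exists i, [/\ (i < K)%N, (0 < a i)%E & (b i < t%:E)%E].
Proof.
move=> [a0 b0 _] t0 gt1; apply: contrapT => H.
suff E : simple K a b t = 1 by rewrite E ltxx in gt1.
rewrite /simple big1// => i _; rewrite /kink /hinge ger0_norm//.
have [ai|ai] := eqVneq (a i) 0%E; first by rewrite ai mul0e oppe0 expeR0.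
suff -> : maxe (t%:E - b i)%E 0%E = 0%E by rewrite mule0 oppe0 expeR0.
apply/max_idPr; rewrite leNgt; apply/negP => bt.
apply: H; exists i; split => //; first by rewrite lt_def ai a0.
case: (b i) (b0 i) bt => [s| |] //= _.
by rewrite -EFinB lte_fin subr_gt0.
Qed.

Lemma simple_gt0_slope K a b t i : admissible a b -> 0 <= t ->
  0 < simple K a b t -> (i < K)%N -> (b i < t%:E)%E -> (a i < +oo)%E.
Proof.
move=> [a0 b0 _] t0 gt iK bt; rewrite ltey; apply/negP => /eqP ai.
move: gt; rewrite /simple (bigD1 (Ordinal iK))//= ai.
case: (b i) bt (b0 i) => [s| |] //=; rewrite ?leeNy_eq//.
rewrite lte_fin => st _; rewrite kink_cut ger0_norm// lt_geF//.
by rewrite mul0r ltxx.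
Qed.

Section Alternation.
Variables (K : nat) (pin0 pinC : bool) (a b : nat -> \bar R) (f : R -> R).
Hypotheses (ab : admissible a b) (hf : halfLC f).
Hypotheses (hpin0 : pin0 -> b 0%N = 0%E) (hpinC : pinC -> a K.-1 = +oo%E).
Let n := (K.*2 - pin0 - pinC)%N.
Hypotheses (K0 : (0 < K)%N) (n0 : (0 < n)%N).

(** Each of the [n] parameters can be moved in both directions. *)
Definition generic_nodes := [/\ forall j, (j < K)%N -> (0 < a j)%E,
  forall j, (j < K)%N -> ~~ (pinC && (j == K.-1)) -> (a j < +oo)%E,
  forall j, (j.+1 < K)%N -> (b j < b j.+1)%E,
  (~~ pin0 -> (0 < b 0%N)%E) & forall j, (j < K)%N -> (b j < +oo)%E].

(** The part of [generic_nodes] which is known once the nodes up to [i] have been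
    found by counting. *)
Let tight i := [/\ forall j, (j <= i)%N -> (0 < a j)%E,
  forall j, (j < i)%N -> (b j < b j.+1)%E & (~~ pin0 -> (0 < b 0%N)%E)].

Let h := fun x => simple K a b (expR x) - f (expR x).

Let b_mono i j : (b i < b j)%E -> (i < j)%N.
Proof.
move=> bij; rewrite ltnNge; apply/negP => /(let: And3 _ _ m := ab in m j i).
by rewrite leNgt bij.
Qed.

(** Each pair of sign changes ending with [g < f] uses up a node, which is larger
    than the nodes used before.  An extra change at the beginning costs one more
    when the node of index [0] lies at the origin, where both functions are [1].
    If no index is skipped, all the nodes met are effective and distinct. *)
Lemma alternation_kinks m x : alternates h m false x ->
  exists i, [/\ (i < K)%N, (0 < a i)%E, (b i < (expR x)%:E)%E,
    (m./2 + (odd m && pin0) <= i)%N &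
    odd m = ~~ pin0 -> i = m./2 -> tight i].
Proof.
have [a0 b0 bm] := ab.
(* induction by pairs of sign changes, [o] recording an unpaired first one *)
suff : forall k x (o : bool), alternates h (k.*2 + o) false x ->
  exists i, [/\ (i < K)%N, (0 < a i)%E, (b i < (expR x)%:E)%E,
    (k + (o && pin0) <= i)%N & o = ~~ pin0 -> i = k -> tight i].
  move=> H; have := H m./2 x (odd m); rewrite addnC odd_double_half => {}H.
  by move=> /H.
move=> k; elim: k => [|k IH] {}x o.
  rewrite add0n; case: o => /=; last first.
    move=> [hx _]; have [|i [iK ai bi]] := simple_lt1 ab (expR_ge0 x) (_ : simple K a b (expR x) < 1).
      move: hx; rewrite /h subr_lt0 => /lt_le_trans; apply.
      by rewrite halfLC_le1// expR_ge0.
    exists i; split => // pin i0; split.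
    - by move=> j; rewrite i0 leqn0 => /eqP ->; rewrite -i0.
    - by move=> j; rewrite i0.
    - by case: (pin0) pin.
  move=> [hx [y yx [hy _]]].
  have [||||||i [iK ai bi0 bi]] := @kink_between K a b f 0 (expR y) (expR x) ab hf.
  - exact: lexx.
  - exact: expR_gt0.
  - by rewrite ltr_expR.
  - have [-> _ _ _] := hf; have [-> _ _ _] := simple_halfLC K ab; exact: lexx.
  - by rewrite -subr_gt0.
  - by rewrite ltW// -subr_lt0.
  exists i; split => //.
    case p0 : pin0 => //; rewrite lt0n; apply/negP => /eqP i0.
    by move: bi0; rewrite i0 hpin0 ?p0// ltxx.
  move=> pin i0; split.
  - by move=> j; rewrite i0 leqn0 => /eqP ->; rewrite -i0.
  - by move=> j; rewrite i0.
  - by rewrite -i0.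
rewrite doubleS !addSn => -[hx [y yx [hy [z zy /= Hz]]]].
have {}Hz : alternates h (k.*2 + o) false z by [].
have hz : h z < 0 by case: (k.*2 + o)%N Hz => [|?] [].
have [i0 [i0K ai0 bi0 ki0 ti0]] := IH z o Hz.
have [||||||i [iK ai bzi bi]] := @kink_between K a b f (expR z) (expR y) (expR x) ab hf.
- exact: expR_ge0.
- by rewrite ltr_expR.
- by rewrite ltr_expR.
- by rewrite ltW// -subr_lt0.
- by rewrite -subr_gt0.
- by rewrite ltW// -subr_lt0.
have i0i : (i0 < i)%N by apply: b_mono; exact: lt_trans bzi.
exists i; split => //; first exact: (leq_ltn_trans ki0 i0i).
move=> pin iE; have i0E : i0 = k.
  by apply/eqP; rewrite eqn_leq (leq_trans _ ki0) ?leq_addr// andbT -ltnS -iE.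
have [t1 t2 t3] := ti0 pin i0E; split => //.
- move=> j; rewrite leq_eqVlt => /orP[/eqP->//|].
  by rewrite iE ltnS -i0E; exact: t1.
- move=> j; rewrite iE ltnS leq_eqVlt => /orP[/eqP->|]; last by rewrite -i0E; exact: t2.
  by rewrite -iE -i0E; exact: lt_trans bzi.
Qed.

Let slope_fin x j : 0 < h x -> (j < K)%N -> (b j < (expR x)%:E)%E -> (a j < +oo)%E.
Proof.
move=> hx jK bj; apply: (simple_gt0_slope ab (expR_ge0 x) _ jK bj).
by move: hx; rewrite /h subr_gt0; apply: le_lt_trans; apply: halfLC_ge0.
Qed.

Lemma no_alternation_neg x : ~~ pinC -> ~ alternates h n false x.
Proof.
move=> pC /alternation_kinks[i [iK _ _ + _]].
by move: K0 n0 pC iK; rewrite /n; case: (pin0); case: (pinC) => //=; lia.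
Qed.

(** [g > f] at the last point implies [g > 0], so the cut-off lies farther to the
    right and is not one of the nodes counted so far. *)
Lemma no_alternation_pos x : pinC -> ~ alternates h n true x.
Proof.
move=> pC; case E : n n0 => [//|m] _ /= [hx [y yx /alternation_kinks[i]]].
move=> [iK _ bi im _].
have aK := hpinC pC.
have : i != K.-1.
  apply/negP => /eqP iE; have := @slope_fin x i hx iK.
  rewrite iE aK ltxx => H; suff : false by [].
  apply: H; rewrite -iE; apply: (lt_trans bi).
  by rewrite lte_fin ltr_expR.
by move: E im iK pC K0; rewrite /n; case: (pin0); case: (pinC) => //=; lia.
Qed.

(** With [n] sign changes the count of nodes is exact. *)
Lemma alternation_generic_nodes sg x : alternates h n sg x -> generic_nodes.
Proof.
have [a0 b0 bm] := ab.
have finish i y : (i < K)%N -> (b i < y%:E)%E -> i = K.-1 -> tight i ->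
    (forall j, (j < K)%N -> ~~ (pinC && (j == K.-1)) -> (a j < +oo)%E) -> generic_nodes.
  move=> iK bi iE [t1 t2 t3] af; split => //.
  - by move=> j jK; apply: t1; rewrite iE; lia.
  - by move=> j jK; apply: t2; rewrite iE; lia.
  - move=> j jK; apply: (@le_lt_trans _ _ (b i)); first by apply: bm; lia.
    by rewrite (lt_le_trans bi)// leey.
case pC : pinC; case: sg => Hx.
- by exfalso; exact: (no_alternation_pos pC Hx).
- have [i [iK ai bi im ti]] := alternation_kinks Hx.
  have E : odd n = ~~ pin0 /\ n./2 = K.-1.
    by move: pC K0 n0; rewrite /n; case: (pin0); case: (pinC) => //= _; lia.
  have iE : i = K.-1 by rewrite E.2 in im; lia.
  apply: (finish i _ iK bi iE); first by apply: ti; rewrite ?E.1// E.2.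
  move=> j jK; rewrite pC/= => jK1.
  case En : n n0 Hx => [//|[|m]] _ /=.
    by exfalso; move: pC En K0 jK jK1; rewrite /n; case: (pin0); case: (pinC) => //= _; lia.
  move=> [_ [y yx [hy [z zy /alternation_kinks[i' [i'K ai' bi' im' _]]]]]].
  apply: (@slope_fin y j hy jK); apply: (@le_lt_trans _ _ (b i')).
    apply: bm; move: pC En im' K0 jK jK1; rewrite /n.
    by case: (pin0); case: (pinC) => //= _; lia.
  by rewrite (lt_trans bi')// lte_fin ltr_expR.
- case E : n n0 Hx => [//|m] _ /= [hx [y yx Hy]].
  have [i [iK ai bi im ti]] := alternation_kinks Hy.
  have Em : odd m = ~~ pin0 /\ m./2 = K.-1.
    by move: E pC K0; rewrite /n; case: (pin0); case: (pinC) => //= E _; lia.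
  have iE : i = K.-1 by rewrite Em.2 in im; lia.
  apply: (finish i _ iK bi iE); first by apply: ti; rewrite ?Em.1// Em.2.
  move=> j jK _; apply: (@slope_fin x j hx jK); apply: (@le_lt_trans _ _ (b i)).
    by apply: bm; lia.
  by rewrite (lt_trans bi)// lte_fin ltr_expR.
- by exfalso; apply: (@no_alternation_neg x) => //; rewrite pC.
Qed.

End Alternation.
End Simple.

(** * Moments *)
Section Integrability.
Variable R : realType.
Implicit Types (f g : R -> R) (s t x y z l r p c : R).

Local Notation mu := (@lebesgue_measure R).
Local Notation Rp := (`]0%R, +oo[%classic : set R).

(** t^u / (1 + t)^v; for [u = v = p + 1] it is bounded by [1], and its derivative
    is (p + 1) t^p / (1 + t)^(p + 2). *)
Let G (u v t : R) : R := expR (u * ln t - v * ln (1 + t)).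

Let dG u v t : 0 < t -> is_derive t (1 : R) (G u v) (G u v t * (u / t - v / (1 + t))).
Proof.
move=> t0; have t1 : 0 < 1 + t by rewrite addr_gt0.
have d1 := is_derive1_ln t0.
have d2 : is_derive t (1 : R) (fun t : R => ln (1 + t)) (1 + t)^-1.
  have -> : (fun t : R => ln (1 + t)) = @ln R \o (cst 1 \+ id) by [].
  have := is_derive1_ln t1 => ?.
  have H : is_derive t (1 : R) (cst 1 \+ @id R) 1.
    by apply: is_derive_eq; rewrite add0r.
  by apply: is_derive_eq; rewrite /GRing.scale/= mulr1.
have -> : G u v = expR \o (u *: @ln R - v *: (fun t : R => ln (1 + t))) by [].
have H : is_derive t (1 : R) (u *: @ln R - v *: (fun t : R => ln (1 + t))) (u / t - v / (1 + t)).
  by apply: is_derive_eq; rewrite /GRing.scale/=.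
apply: is_derive_eq; rewrite /GRing.scale/=; first by rewrite mulrC.
Qed.

Let G_continuous u v t : 0 < t -> {for t, continuous (G u v)}.
Proof.
move=> t0; apply: differentiable_continuous; apply/derivable1_diffP.
exact: (@ex_derive _ _ _ _ _ _ _ (dG u v t0)).
Qed.

Let G_measurable u v : measurable_fun setT (G u v).
Proof.
apply: measurableT_comp => //; apply: measurable_funB; apply: measurable_funM => //.
by apply: measurableT_comp => //; exact: measurable_funD.
Qed.

Let dGq p t : 0 < t -> G (p + 1) (p + 1) t * ((p + 1) / t - (p + 1) / (1 + t)) =
  (p + 1) * G p (p + 2) t.
Proof.
move=> t0; have t1 : 0 < 1 + t by rewrite addr_gt0.
rewrite /G; have -> : (p + 1) * ln t - (p + 1) * ln (1 + t) =
  (p * ln t - (p + 2) * ln (1 + t)) + (ln t + ln (1 + t)) by ring.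
rewrite expRD (expRD (ln t)) !lnK ?posrE//.
move: (expR _) => X.
have nt := lt0r_neq0 t0; have nt1 := lt0r_neq0 t1.
by rewrite -mulrBr; field; rewrite nt1 nt.
Qed.

Let int_G p : -1 < p -> (\int[mu]_(t in Rp) ((p + 1) * G p (p + 2) t)%:E <= 1%:E)%E.
Proof.
move=> p1; have q0 : 0 < p + 1 by lra.
pose F (n : nat) := (`[n.+1%:R^-1, n.+2%:R]%classic : set R).
have n0 (n : nat) : 0 < n.+1%:R^-1 :> R by rewrite invr_gt0.
have FE : Rp = \bigcup_n F n.
  apply/seteqP; split => [t /=|t [n _] /=].
    rewrite in_itv/= andbT => t0.
    exists (Num.Def.truncn (t + t^-1)) => //; rewrite /F/= in_itv/=.
    have := truncnS_gt (t + t^-1); set k := Num.Def.truncn _ => kt.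
    have k1 : 0 < k.+1%:R :> R by [].
    have tp : 0 < t^-1 by rewrite invr_gt0.
    apply/andP; split; last first.
      by rewrite (@le_trans _ _ k.+1%:R)// ?ler_nat//; lra.
    by rewrite invf_ple ?posrE//; lra.
  rewrite /F/= !in_itv/= andbT => /andP[+ _]; exact: lt_le_trans.
have nd : nondecreasing_seq F.
  move=> m n mn; rewrite subsetEset => t; rewrite /F/= !in_itv/= => /andP[t1 t2].
  rewrite (le_trans _ t1) ?lef_pV2 ?posrE ?ler_nat//=.
  by rewrite (le_trans t2)// ler_nat.
have mf n : measurable_fun (F n) (fun t => ((p + 1) * G p (p + 2) t)%:E).
  apply/measurable_EFinP; apply: measurable_funM => //.
  exact: measurable_funTS.
have f0 n t : F n t -> (0 <= ((p + 1) * G p (p + 2) t)%:E)%E.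
  by move=> _; rewrite lee_fin mulr_ge0 ?expR_ge0// ltW.
have H := ge0_nondecreasing_set_cvg_integral (mu := mu) nd (fun n => measurable_itv _) mf f0.
rewrite FE -(cvg_lim _ H)//.
apply: lime_le; first by apply/cvg_ex; eexists; exact: H.
apply: nearW => n.
have lt12 : n.+1%:R^-1 < n.+2%:R :> R.
  by rewrite (@le_lt_trans _ _ 1) ?invf_le1 ?ler1n ?ltr1n.
have pos t : n.+1%:R^-1 <= t -> 0 < t by exact: lt_le_trans.
rewrite /F (@continuous_FTC2 _ _ (G (p + 1) (p + 1)) _ _ lt12); last 3 first.
- apply: continuous_in_subspaceT => t; rewrite inE/= in_itv/= => /andP[/pos t0 _].
  by apply: (@cvgM _ _ (nbhs t) _ (cst (p + 1)) (G p (p + 2))); [exact: cvg_cst|exact: G_continuous].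
- split.
  + move=> t; rewrite in_itv/= => /andP[/ltW/pos t0 _].
    exact: (@ex_derive _ _ _ _ _ _ _ (dG (p + 1) (p + 1) t0)).
  + by apply: cvg_at_right_filter; exact: G_continuous.
  + by apply: cvg_at_left_filter; apply: G_continuous; exact: pos (ltW lt12).
- move=> t; rewrite in_itv/= => /andP[/ltW/pos t0 _].
  by rewrite derive1E (@derive_val _ _ _ _ _ _ _ (dG (p + 1) (p + 1) t0)) dGq.
rewrite -EFinB lee_fin lerBlDr.
rewrite (@le_trans _ _ 1) ?lerDl ?expR_ge0//.
rewrite expR_le1 -mulrBr mulr_ge0_le0 ?(ltW q0)// subr_le0 ler_ln ?posrE//.
by rewrite lerDr.
Qed.

(** exp (- c t) is dominated by a constant times (1 + t)^(- p - 2), and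
    t^p / (1 + t)^(p + 2) has a bounded primitive. *)
Lemma integrable_powR_expR p c : -1 < p -> 0 < c ->
  mu.-integrable Rp (fun t => (t `^ p * expR (- (c * t)))%:E).
Proof.
move=> p1 c0; have q0 : 0 < p + 1 by lra.
have p20 : 0 < p + 2 by lra.
pose e := c / (p + 2); have e0 : 0 < e by rewrite divr_gt0.
pose C := c - (p + 2) * ln e.
apply: (@le_integrable _ _ _ mu Rp _ _
  (fun t => (expR C / (p + 1))%:E * ((p + 1) * G p (p + 2) t)%:E)%E).
- by [].
- apply/measurable_EFinP; apply: measurable_funTS; apply: measurable_funM.
    exact: measurable_powR.
  apply: measurableT_comp => //; apply: measurable_funN; exact: measurable_funM.
- move=> t /=; rewrite in_itv/= andbT => t0.
  have t1 : 0 < 1 + t by rewrite addr_gt0.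
  rewrite ?abse_EFin lee_fin !ger0_norm; last 2 first.
    by rewrite !mulr_ge0 ?expR_ge0 ?invr_ge0// ltW.
    by rewrite mulr_ge0 ?powR_ge0 ?expR_ge0.
  have -> : expR C / (p + 1) * ((p + 1) * G p (p + 2) t) = expR C * G p (p + 2) t.
    by field; rewrite gt_eqF.
  rewrite /powR gt_eqF// -expRD /G -expRD ler_expR.
  have := ln_sublinear (mulr_gt0 e0 t1); rewrite lnM ?posrE// => H.
  have := ler_wpM2l (ltW p20) (ltW H).
  have -> : (p + 2) * (e * (1 + t)) = c * (1 + t) by rewrite /e; field; rewrite gt_eqF.
  rewrite /C; lra.
- apply: integrableZl => //; apply/integrableP; split.
    apply/measurable_EFinP; apply: measurable_funM => //.
    by apply: measurable_funTS; exact: G_measurable.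
  apply: (@le_lt_trans _ _ 1%E); last by rewrite ltry.
  apply: le_trans (int_G p1); rewrite le_eqVlt; apply/orP; left; apply/eqP.
  by apply: eq_integral => t _ /=; rewrite ger0_norm// mulr_ge0 ?expR_ge0// ltW.
Qed.

End Integrability.

Section Moments.
Variable R : realType.
Implicit Types (f g u v : R -> R) (s t x y z l r p c B : R).

Local Notation mu := (@lebesgue_measure R).
Local Notation Rp := (`]0%R, +oo[%classic : set R).

(** The domain on which moments of every order are finite and depend linearly on
    the function. *)
Definition expdecay u := measurable_fun Rp u /\
  exists B c, 0 < c /\ forall t, 0 < t -> `|u t| <= B * expR (- (c * t)).

Definition mom p u : R := \int[mu]_(t in Rp) (t `^ p * u t).

Lemma measurable_powRM p u : measurable_fun Rp u ->
  measurable_fun Rp (fun t => t `^ p * u t).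
Proof.
by move=> mu_; apply: measurable_funM => //; apply: measurable_funTS; exact: measurable_powR.
Qed.

Lemma expdecay_integrable p u : -1 < p -> expdecay u ->
  mu.-integrable Rp (fun t => (t `^ p * u t)%:E).
Proof.
move=> p1 [mu_ [B [c [c0 Bc]]]].
apply: (@le_integrable _ _ _ mu Rp _ _ (fun t => B%:E * (t `^ p * expR (- (c * t)))%:E)%E).
- by [].
- by apply/measurable_EFinP; exact: measurable_powRM.
- move=> t /=; rewrite in_itv/= andbT => t0; rewrite lee_fin.
  have B0 : 0 <= B.
    have := Bc t t0; rewrite -(pmulr_lge0 _ (expR_gt0 (- (c * t)))).
    exact: le_trans.
  rewrite !normrM (ger0_norm (powR_ge0 _ _)) (ger0_norm B0) (ger0_norm (expR_ge0 _)).
  by rewrite mulrCA ler_wpM2l ?powR_ge0// Bc.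
- by apply: integrableZl => //; exact: integrable_powR_expR.
Qed.

Lemma momE p u : -1 < p -> expdecay u -> moment p u = (mom p u)%:E.
Proof.
move=> p1 du; rewrite /mom /Rintegral fineK//.
exact: (integrable_fin_num _ (expdecay_integrable p1 du)).
Qed.

Lemma expdecayD u v : expdecay u -> expdecay v -> expdecay (u \+ v).
Proof.
move=> [mu_ [B [c [c0 Bc]]]] [mv [B' [c' [c'0 Bc']]]].
split; first exact: measurable_funD.
exists (`|B| + `|B'|), (Num.min c c'); split; first by rewrite lt_min c0.
move=> t t0; rewrite (le_trans (ler_normD _ _))// mulrDl lerD//.
- rewrite (le_trans (Bc t t0))// (le_trans (ler_norm _))// normrM.
  rewrite ler_wpM2l// ger0_norm ?expR_ge0// ler_expR lerN2 ler_wpM2r ?(ltW t0)//.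
  by rewrite ge_min lexx.
- rewrite (le_trans (Bc' t t0))// (le_trans (ler_norm _))// normrM.
  rewrite ler_wpM2l// ger0_norm ?expR_ge0// ler_expR lerN2 ler_wpM2r ?(ltW t0)//.
  by rewrite ge_min lexx orbT.
Qed.

Lemma expdecayN u : expdecay u -> expdecay (\- u).
Proof.
move=> [mu_ [B [c [c0 Bc]]]]; split; first exact: measurable_funN.
by exists B, c; split => // t t0; rewrite normrN Bc.
Qed.

Lemma expdecayB u v : expdecay u -> expdecay v -> expdecay (u \- v).
Proof. by move=> du dv; apply: expdecayD => //; exact: expdecayN. Qed.

Lemma integrable_powsum (I : eqType) (s : seq I) (k q : I -> R) u :
  (forall i, i \in s -> -1 < q i) -> expdecay u ->
  mu.-integrable Rp (fun t => ((\sum_(i <- s) k i * t `^ q i) * u t)%:E) /\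
  \int[mu]_(t in Rp) ((\sum_(i <- s) k i * t `^ q i) * u t) =
  \sum_(i <- s) k i * mom (q i) u.
Proof.
move=> + du; elim: s => [|i s IH] hq.
  rewrite big_nil; have E : (fun t => ((\sum_(i <- [::]) k i * t `^ q i) * u t)) = cst 0.
    by apply/funext => t; rewrite big_nil mul0r.
  split; last by rewrite E /Rintegral integral0.
  rewrite (_ : (fun t => _) = cst 0%E); first exact: integrable0.
  by apply/funext => t; rewrite big_nil mul0r.
have [Is Es] := IH (fun j js => hq j (@mem_behead _ (i :: s) j js)).
have qi : -1 < q i by apply: hq; rewrite inE eqxx.
have I1 : mu.-integrable Rp (EFin \o (fun t => k i * (t `^ q i * u t))).
  have := integrableZl _ (k i) (expdecay_integrable qi du).
  by apply.
have E : (fun t => (\sum_(i <- i :: s) k i * t `^ q i) * u t) =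
    (fun t => k i * (t `^ q i * u t) + (\sum_(i <- s) k i * t `^ q i) * u t).
  by apply/funext => t; rewrite big_cons mulrDl mulrA.
split.
  apply: (@eq_integrable _ _ _ mu Rp _ _ _ _ (integrableD _ I1 Is)) => // t _.
  by rewrite /= big_cons mulrDl mulrA EFinD.
rewrite big_cons E RintegralD// Es; congr (_ + _).
by rewrite RintegralZl//; exact: expdecay_integrable.
Qed.

Lemma momB p u v : -1 < p -> expdecay u -> expdecay v ->
  mom p (u \- v) = mom p u - mom p v.
Proof.
move=> p1 du dv; rewrite /mom -RintegralB//; [|exact: expdecay_integrable|exact: expdecay_integrable].
by apply: eq_Rintegral => t _; rewrite /= mulrBr.
Qed.

(** Finite exceptional sets, such as the nodes of a simple function, are
    negligible. *)
Lemma ae_off (zs : seq R) (P : R -> Prop) :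
  (forall t, 0 < t -> t \notin zs -> P t) -> {ae mu, forall t, Rp t -> P t}.
Proof.
move=> H; exists [set` zs]; split.
- by apply: countable_measurable; [exact: measurable_set1|apply: finite_set_countable; exact: finite_seq].
- by apply: countable_lebesgue_measure0; apply: finite_set_countable; exact: finite_seq.
- move=> t /= nP; apply: contrapT => /negP tz; apply: nP.
  by rewrite in_itv/= andbT => t0; exact: H.
Qed.

Lemma Rintegral_off_ge0 (zs : seq R) v :
  mu.-integrable Rp (EFin \o v) ->
  (forall t, 0 < t -> t \notin zs -> 0 <= v t) ->
  0 <= \int[mu]_(t in Rp) v t /\
  (\int[mu]_(t in Rp) v t = 0 -> {ae mu, forall t, Rp t -> v t = 0}).
Proof.
move=> iv v0; have mv : measurable_fun Rp (EFin \o v) by case/integrableP: iv.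
have E : (\int[mu]_(t in Rp) (v t)%:E = \int[mu]_(t in Rp) `|(v t)%:E|)%E.
  apply: ae_eq_integral => //; first exact: measurableT_comp.
  by apply: ae_off => t t0 tz; have vt := v0 t t0 tz; rewrite gee0_abs ?lee_fin.
have ge0 : (0 <= \int[mu]_(t in Rp) `|(v t)%:E|)%E by exact: integral_ge0.
rewrite /Rintegral E; split; first exact: fine_ge0.
move=> /eqP; rewrite fine_eq0; last by rewrite -E; exact: (integrable_fin_num _ iv).
move=> /eqP H0; have [+ _] := @ae_eq_integral_abs _ _ _ mu Rp (measurable_itv _) _ mv.
by move=> /(_ H0); apply: filterS => t H /H /= [].
Qed.

End Moments.

Section MomentsLC.
Variable R : realType.
Implicit Types (f g u v : R -> R) (s t x y z l r p c B : R).

Local Notation mu := (@lebesgue_measure R).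
Local Notation Rp := (`]0%R, +oo[%classic : set R).

Lemma halfLC_measurable f : halfLC f -> measurable_fun Rp f.
Proof.
move=> F; apply: (@eq_measurable_fun _ _ _ _ Rp (fun t => f (Num.max t 0))).
  by move=> t; rewrite inE/= in_itv/= andbT => t0; rewrite max_l// ltW.
apply: nonincreasing_measurable => // s t st; apply: (halfLC_anti F).
  by rewrite le_max lexx orbT.
by rewrite ge_max !le_max st lexx orbT.
Qed.

(** Interpolate between [0], where [f] is [1], and [t > A]: f(t)^(A / t) is at
    most f(A). *)
Lemma halfLC_decay f A d t : halfLC f -> 0 < A -> 0 < d -> f A <= 1 - d ->
  0 <= t -> f t <= expR d * expR (- (d / A * t)).
Proof.
move=> F A0 d0 fA t0; rewrite -expRD.
have [tA|At] := leP t A.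
  rewrite (le_trans (halfLC_le1 F t0))// -expR0 ler_expR subr_ge0.
  by rewrite mulrAC ler_pdivrMr// ler_wpM2l// ltW.
have t_gt0 : 0 < t by exact: lt_trans At.
pose l := A / t; have l0 : 0 < l by rewrite divr_gt0.
have l1 : l < 1 by rewrite ltr_pdivrMr// mul1r.
have [f0 fp fa fl] := F.
have := fl t 0 l t0 (lexx _); rewrite l0 l1 f0 powR1 mulr1 mulr0 addr0 => /(_ isT).
have -> : l * t = A by rewrite /l divfK// gt_eqF.
move=> H; have H1 : f t `^ l <= expR (- d).
  by rewrite (le_trans H)// (le_trans fA)//; exact: expR_ge1Dx.
have : (f t `^ l) `^ l^-1 <= expR (- d) `^ l^-1.
  by apply: ge0_ler_powR; rewrite ?nnegrE ?powR_ge0 ?expR_ge0// invr_ge0 ltW.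
rewrite -powRrM divff ?gt_eqF// powRr1 ?fp// -expRM => /le_trans; apply.
rewrite ler_expR /l invf_div.
suff -> : - d * (t / A) = - (d / A * t) by rewrite lerDr ltW.
by field; rewrite gt_eqF.
Qed.

Lemma halfLC_expdecay f A : halfLC f -> 0 < A -> f A < 1 -> expdecay f.
Proof.
move=> F A0 fA; split; first exact: halfLC_measurable.
have d0 : 0 < 1 - f A by rewrite subr_gt0.
exists (expR (1 - f A)), ((1 - f A) / A); split; first by rewrite divr_gt0.
move=> t t0; rewrite ger0_norm; last exact: halfLC_ge0 F (ltW t0).
by apply: halfLC_decay => //; [lra|exact: ltW].
Qed.

(** [f >= f A] on the interval from A / 2 to [A]. *)
Lemma moment_lower p f A : -1 < p -> halfLC f -> 0 < A ->
  ((f A * ((A / 2) `^ (p + 1) / 2))%:E <= moment p f)%E.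
Proof.
move=> p1 F A0; pose J := (`[A / 2, A]%classic : set R).
have A20 : 0 < A / 2 by rewrite divr_gt0.
have mf : measurable_fun Rp (fun t => (t `^ p * f t)%:E).
  by apply/measurable_EFinP; apply: measurable_powRM; exact: halfLC_measurable.
have JR : J `<=` Rp.
  by move=> t; rewrite /J/= !in_itv/= andbT => /andP[+ _]; exact: lt_le_trans.
have fp t : Rp t -> (0 <= (t `^ p * f t)%:E)%E.
  rewrite /= in_itv/= andbT => t0.
  by rewrite lee_fin mulr_ge0 ?powR_ge0// (halfLC_ge0 F)// ltW.
apply: (@le_trans _ _ (\int[mu]_(t in J) (t `^ p * f t)%:E)%E); last first.
  by apply: ge0_subset_integral => //; exact: measurable_itv.
have fA0 : 0 <= f A by rewrite (halfLC_ge0 F)// ltW.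
pose k := f A * ((A / 2) `^ p / 2).
have k0 : 0 <= k by rewrite /k mulr_ge0// divr_ge0// powR_ge0.
apply: (@le_trans _ _ (\int[mu]_(t in J) k%:E)%E).
  rewrite integral_cst/=; last exact: measurable_itv.
  rewrite /J lebesgue_measure_itv/= lte_fin ltr_pdivrMr//.
  rewrite (_ : A < A * 2); last lra.
  rewrite -EFinB -EFinM lee_fin /k powRD; last by apply/implyP => _; rewrite gt_eqF.
  rewrite (powRr1 (ltW A20)); set X := _ `^ p.
  by rewrite le_eqVlt; apply/orP; left; apply/eqP; field.
apply: ge0_le_integral => //.
- exact: measurable_itv.
- by apply: measurable_funS mf.
move=> t; rewrite /J/= in_itv/= => /andP[t1 t2].
have t0 : 0 < t by exact: lt_le_trans t1.
rewrite lee_fin /k mulrC; apply: ler_pM => //.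
- by rewrite divr_ge0// powR_ge0.
- set B := (A / 2) `^ p.
  have B0 : 0 <= B by exact: powR_ge0.
  have [p0|p0] := leP 0 p.
    apply: (@le_trans _ _ B); first lra.
    by apply: ge0_ler_powR; rewrite ?nnegrE ?(ltW A20) ?(ltW t0).
  have : A `^ p <= t `^ p.
    rewrite -[p]opprK !(powRN _ (- p)) lef_pV2 ?posrE ?powR_gt0//.
    by apply: ge0_ler_powR; rewrite ?nnegrE ?oppr_ge0 ?(ltW p0) ?(ltW A0) ?(ltW t0).
  apply: le_trans; have -> : A = (A / 2) * 2 by field.
  rewrite (powRM _ (ltW A20))// -/B ler_wpM2l//.
  have -> : (2^-1 : R) = 2 `^ (-1) by rewrite powR_inv1.
  by apply: ler_powR; rewrite ?ler1n// (ltW p1).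
- by apply: (halfLC_anti F) => //; exact: ltW.
Qed.

Lemma mom_cvg p (u_ : nat -> R -> R) u B c (zs : seq R) : -1 < p -> 0 < c ->
  (forall n, measurable_fun Rp (u_ n)) -> measurable_fun Rp u ->
  (forall n t, 0 < t -> `|u_ n t| <= B * expR (- (c * t))) ->
  (forall t, 0 < t -> t \notin zs -> u_ n t @[n --> \oo] --> u t) ->
  mom p (u_ n) @[n --> \oo] --> mom p u.
Proof.
move=> p1 c0 mu_ mu0 Bu cu.
have du n : expdecay (u_ n) by split => //; exists B, c; split => // t; exact: Bu.
have [|||||iu _ H] := @dominated_convergence _ _ _ mu Rp (measurable_itv _)
  (fun n t => (t `^ p * u_ n t)%:E) (fun t => (t `^ p * u t)%:E)
  (fun t => B%:E * (t `^ p * expR (- (c * t)))%:E)%E.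
- by move=> n; apply/measurable_EFinP; exact: measurable_powRM.
- by apply/measurable_EFinP; exact: measurable_powRM.
- apply: (ae_off (zs := zs)) => t t0 tz; apply: cvg_EFin; first exact: nearW.
  by apply: cvgM; [exact: cvg_cst|exact: cu].
- by apply: integrableZl => //; exact: integrable_powR_expR.
- apply: aeW => t n; rewrite /= in_itv/= andbT => t0.
  rewrite -EFinM ?abse_EFin lee_fin normrM (ger0_norm (powR_ge0 _ _)) mulrCA.
  by rewrite ler_wpM2l ?powR_ge0// Bu.
have fi := integrable_fin_num _ iu.
by rewrite /mom /Rintegral; apply/fine_cvg; rewrite fineK// fi//.
Qed.
End MomentsLC.

(** * Comparing moments *)
Section Compare.
Variable R : realType.
Implicit Types (f g u v : R -> R) (s t x y z l r c B : R).

Local Notation mu := (@lebesgue_measure R).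
Local Notation Rp := (`]0%R, +oo[%classic : set R).

Lemma ae_imply (P Q : R -> Prop) : (forall t, P t -> Q t) ->
  {ae mu, forall t, P t} -> {ae mu, forall t, Q t}.
Proof. by move=> PQ; apply: filterS; [exact: (ae_filter_ringOfSetsType mu)|exact: PQ]. Qed.

Lemma ae_and (P Q : R -> Prop) :
  {ae mu, forall t, P t} -> {ae mu, forall t, Q t} -> {ae mu, forall t, P t /\ Q t}.
Proof. by move=> A1 A2; apply: filterI; [exact: (ae_filter_ringOfSetsType mu)|exact: A1|exact: A2]. Qed.

Lemma powsum_expsum (I : eqType) (s : seq I) (k q : I -> R) t : 0 < t ->
  \sum_(i <- s) k i * t `^ q i = expsum s k q (ln t).
Proof. by move=> t0; apply: eq_bigr => i _; rewrite /powR gt_eqF. Qed.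

(** The combination of powers changing sign with [u], in the logarithmic scale,
    makes the integrand of a constant sign. *)
Lemma sign_pattern_moments (I : eqType) (s : seq I) (q : I -> R) (xs zs : seq R) e u :
  uniq s -> {in s &, injective q} -> (forall i, i \in s -> -1 < q i) ->
  uniq xs -> size s = (size xs).+1 -> expdecay u -> e = 1 \/ e = -1 ->
  (forall x, x \notin zs -> 0 <= e * u (expR x) * rootprod xs x) ->
  exists k, [/\ {in s, forall i, 0 < (-1) ^+ count (fun j => q i < q j) s * k i},
    0 <= e * \sum_(i <- s) k i * mom (q i) u &
    \sum_(i <- s) k i * mom (q i) u = 0 -> {ae mu, forall t, Rp t -> u t = 0}].
Proof.
move=> us qi q1 uxs sxs du e1 sgn.
have [k [kP ks]] := descartes_combination us qi uxs sxs.
have [iv vE] := integrable_powsum k q1 du.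
pose P t := \sum_(i <- s) k i * t `^ q i.
have e0 : e != 0 by case: e1 => ->; rewrite ?oner_eq0 ?oppr_eq0 ?oner_eq0.
have i2 : mu.-integrable Rp (EFin \o (fun t => e * (P t * u t))).
  by have := integrableZl _ e iv; apply.
have PE t : 0 < t -> ln t \notin xs -> 0 < P t * rootprod xs (ln t).
  by move=> t0 txs; rewrite /P powsum_expsum//; exact: kP.
pose ws := [seq expR z | z <- xs ++ zs].
have wsP t : 0 < t -> t \notin ws -> ln t \notin xs /\ ln t \notin zs.
  move=> t0; rewrite /ws map_cat mem_cat negb_or => /andP[tx tz].
  by split; apply/negP => H; [move/negP: tx|move/negP: tz]; apply;
    apply/mapP; exists (ln t) => //; rewrite lnK.
have v0 t : 0 < t -> t \notin ws -> 0 <= e * (P t * u t).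
  move=> t0 /(wsP t t0)[tx tz].
  have := sgn _ tz; rewrite lnK// => H; have H1 := PE t t0 tx.
  have : 0 <= (e * u t * rootprod xs (ln t)) * (P t * rootprod xs (ln t)).
    by rewrite mulr_ge0// ltW.
  have -> : (e * u t * rootprod xs (ln t)) * (P t * rootprod xs (ln t)) =
     (rootprod xs (ln t)) ^+ 2 * (e * (P t * u t)) by ring.
  rewrite pmulr_rge0// exprn_even_gt0//= rootprod_eq0//.
have [I0 Iae] := Rintegral_off_ge0 i2 v0.
have IE : \int[mu]_(t in Rp) (e * (P t * u t)) = e * \sum_(i <- s) k i * mom (q i) u.
  by rewrite -vE RintegralZl.
exists k; split => //; first by rewrite -IE.
move=> S0; have : {ae mu, forall t, Rp t -> t \notin ws}.
  exact: (ae_off (zs := ws)).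
have : {ae mu, forall t, Rp t -> e * (P t * u t) = 0}.
  by apply: Iae; rewrite IE S0 mulr0.
move=> A1 A2; apply: ae_imply (ae_and A1 A2) => t [H1 H2] Rt.
have := H1 Rt; have := H2 Rt.
move: Rt; rewrite /= in_itv/= andbT => t0 tw /eqP.
have [tx _] := wsP t t0 tw.
rewrite !mulf_eq0 (negbTE e0)/= => /orP[/eqP P0|/eqP//].
by have := PE t t0 tx; rewrite P0 mul0r ltxx.
Qed.

Section SimpleCompare.
Variables (K : nat) (pin0 pinC : bool) (a b : nat -> \bar R) (f : R -> R).
Hypotheses (ab : admissible a b) (hf : halfLC f).
Hypotheses (hpin0 : pin0 -> b 0%N = 0%E) (hpinC : pinC -> a K.-1 = +oo%E).
Variables (n : nat) (p : 'I_n.+1 -> R).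
Hypotheses (nE : n = (K.*2 - pin0 - pinC)%N) (K0 : (0 < K)%N) (n0 : (0 < n)%N).
Hypotheses (p1 : forall i, -1 < p i) (pinj : injective p).
Let g := simple K a b.
Hypotheses (df : expdecay f) (dg : expdecay g).
Hypothesis eqm : forall i : 'I_n.+1, (i < n)%N -> mom (p i) f = mom (p i) g.

Let h x := g (expR x) - f (expR x).
(** Oriented so that the last sign of [u] is positive if it changes sign [n]
    times. *)
Let u := if pinC then f \- g else g \- f.

Let du : expdecay u.
Proof. by rewrite /u; case: ifP => _; exact: expdecayB. Qed.

Let uE t : u t = 0 -> f t = g t.
Proof. by rewrite /u; case: ifP => _ /eqP; rewrite subr_eq0 => /eqP. Qed.

Let momu i : mom (p i) u = (-1) ^+ pinC * (mom (p i) g - mom (p i) f).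
Proof.
by rewrite /u; case: (pinC); rewrite momB// ?expr0 ?expr1 ?mul1r// mulN1r opprB.
Qed.

Let momu0 (i : 'I_n.+1) : (i < n)%N -> mom (p i) u = 0.
Proof. by move=> /eqm E; rewrite momu E subrr mulr0. Qed.

Let small : seq 'I_n.+1 := seq.filter (fun i : 'I_n.+1 => (i < n)%N) (enum 'I_n.+1).

Let perm_small : perm_eq (enum 'I_n.+1) (ord_max :: small).
Proof.
apply: uniq_perm; first exact: enum_uniq.
  by rewrite /= filter_uniq ?enum_uniq// andbT mem_filter ltnn.
move=> i; rewrite mem_enum in_cons mem_filter mem_enum andbT.
have [->|im] := eqVneq i ord_max; first by [].
rewrite /= ltn_neqAle -ltnS ltn_ord andbT; apply/esym/eqP => E.
by move/eqP: im; apply; apply/val_inj.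
Qed.

Let size_small : size small = n.
Proof.
by have /perm_size := perm_small; rewrite size_enum_ord /= => -[].
Qed.

(** With at most [n - 1] sign changes, powers among the first [n] suffice, and all
    their moments agree. *)
Let few_changes (xs zs : seq R) e : uniq xs -> (size xs < n)%N -> e = 1 \/ e = -1 ->
  (forall x, x \notin zs -> 0 <= e * u (expR x) * rootprod xs x) ->
  {ae mu, forall t, Rp t -> f t = g t}.
Proof.
move=> uxs sxs e1 sgn; pose s := take (size xs).+1 small.
have us : uniq s by rewrite take_uniq// filter_uniq// enum_uniq.
have sm i : i \in s -> (i < n)%N by move=> /mem_take; rewrite mem_filter => /andP[].
have [|k [_ _ +]] := @sign_pattern_moments _ s p xs zs e u us (in2W pinj)
  (fun i _ => p1 i) uxs _ du e1 sgn.
  by rewrite size_take size_small; case: ifP => // H; apply/eqP; rewrite eqn_leq sxs andbT leqNgt H.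
rewrite big_seq big1 ?/= => [/(_ erefl)|i /sm /momu0->]; last by rewrite mulr0.
by apply: ae_imply => t H /H /uE.
Qed.

(** By the count of nodes [g - f] does not change sign [n] times.  If it had [n - 1]
    changes with both last signs, the two patterns would combine into one with
    [n]; so one of the last signs is missing, and there are in effect fewer than
    [n] changes. *)
Lemma degenerate_ae : ~ generic_nodes K pin0 pinC a b -> {ae mu, forall t, Rp t -> f t = g t}.
Proof.
move=> nint; have noalt sg x : ~ alternates h n sg x.
  rewrite nE => /(alternation_generic_nodes ab hf hpin0 hpinC K0) H.
  by apply: nint; apply: H; rewrite -nE.
have fin (v : R -> R) (e0 : R) : e0 = 1 \/ e0 = -1 -> (forall x, v x = e0 * u (expR x)) ->
    (forall x, ~ alternates v n.-1 false x) -> {ae mu, forall t, Rp t -> f t = g t}.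
  move=> e01 vE /sign_change_points[xs [zs [e [uxs sxs e1 _ sgn]]]].
  apply: (@few_changes xs zs (e0 * e)) => //.
  - by rewrite -(prednK n0).
  - by case: e01 => ->; case: e1 => ->; rewrite ?mulr1 ?mul1r ?mulrN1 ?opprK; [left|right|right|left].
  - by move=> x /sgn; rewrite vE; congr (_ <= _); ring.
have uh : (forall x, u (expR x) = h x) \/ (forall x, u (expR x) = - h x).
  by rewrite /u /h; case: (pinC); [right|left] => x //=; rewrite opprB.
have [|Hpos] := pselect (forall x, ~ alternates h n.-1 false x).
  case: uh => uE'.
    by apply: (fin _ 1); [left|move=> x; rewrite mul1r uE'].
  by apply: (fin _ (-1)); [right|move=> x; rewrite mulN1r uE' opprK].
have [Hneg|Hneg] := pselect (forall x, ~ alternates h n.-1 true x).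
  have H : forall x, ~ alternates (- h) n.-1 false x.
    by move=> x /alternates_opp; exact: Hneg.
  case: uh => uE'.
    by apply: (fin _ (-1) _ _ H); [right|move=> x; rewrite mulN1r uE'].
  by apply: (fin _ 1 _ _ H); [left|move=> x; rewrite mul1r uE'].
exfalso; apply: Hpos => x Hx; apply: Hneg => y Hy.
have [xy|yx|xy] := ltrgtP x y.
- by apply: (noalt true y); rewrite -(prednK n0); split; [case: (n.-1) Hy => [|?] []|exists x].
- by apply: (noalt false x); rewrite -(prednK n0); split; [case: (n.-1) Hx => [|?] []|exists y].
- have hy : 0 < h y by case: (n.-1) Hy => [|?] [].
  have hx : h x < 0 by case: (n.-1) Hx => [|?] [].
  by move: hx; rewrite xy ltNge ltW.
Qed.

(** Only the last moment differs, and the sign of the coefficient of the last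
    power is given by the number of larger exponents. *)
Lemma last_moment_sign :
  let D := mom (p ord_max) g - mom (p ord_max) f in
  0 <= (-1) ^+ pinC * (-1) ^+ count (fun j => p ord_max < p j) (enum 'I_n.+1) * D /\
  (D = 0 -> {ae mu, forall t, Rp t -> f t = g t}).
Proof.
move=> D.
have noalt x : ~ alternates (u \o expR) n false x.
  rewrite /u; case pC : pinC.
    have -> : (f \- g) \o expR = - h by apply/funext => z; rewrite /= fctE /h opprB.
    move=> /alternates_opp/=; rewrite nE.
    by apply: (no_alternation_pos ab hf hpin0 hpinC) => //; rewrite -nE.
  have -> : (g \- f) \o expR = h by [].
  rewrite nE; apply: no_alternation_neg => //; rewrite -?nE ?pC //.
have [xs [zs [e [uxs sxs e1 en sgn]]]] := sign_change_points noalt.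
have [sn|sn] := ltnP (size xs) n.
  have H := few_changes uxs sn e1 sgn.
  suff -> : D = 0 by rewrite mulr0.
  have : mom (p ord_max) f = mom (p ord_max) g.
    rewrite /mom /Rintegral; congr fine; apply: ae_eq_integral => //.
    - by apply/measurable_EFinP; apply: measurable_powRM; case: df.
    - by apply/measurable_EFinP; apply: measurable_powRM; case: dg.
    - by apply: ae_imply H => t Ht Rt; rewrite /= Ht.
  by rewrite /D => ->; rewrite subrr.
have {sn}sn : size xs = n by apply/eqP; rewrite eqn_leq sxs.
have {}en := en sn; subst e.
have [|k [kP S0 Sae]] := @sign_pattern_moments _ (enum 'I_n.+1) p xs zs 1 u
  (enum_uniq _) (in2W pinj) (fun i _ => p1 i) uxs _ du e1 sgn.
  by rewrite size_enum_ord sn.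
have SE : \sum_(i <- enum 'I_n.+1) k i * mom (p i) u = k ord_max * mom (p ord_max) u.
  rewrite (perm_big _ perm_small) big_cons /=.
  rewrite [X in _ + X]big_seq big1 ?addr0// => i.
  by rewrite mem_filter => /andP[/momu0 -> _]; rewrite mulr0.
rewrite SE mul1r in S0; rewrite SE in Sae.
have kM : 0 < (-1) ^+ count (fun j => p ord_max < p j) (enum 'I_n.+1) * k ord_max.
  by apply: kP; rewrite mem_enum.
rewrite momu -/D in S0 Sae.
split; last first.
  by move=> D0; have := Sae; rewrite D0 !mulr0 => /(_ erefl); apply: ae_imply => t H /H /uE.
set c := (-1) ^+ count _ _ in kM *.
have c2 : c * c = 1 by rewrite -expr2 sqrr_sign.
rewrite -(pmulr_rge0 _ kM).
have -> : c * k ord_max * ((-1) ^+ pinC * c * D) = (c * c) * (k ord_max * ((-1) ^+ pinC * D)) by ring.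
by rewrite c2 mul1r.
Qed.

End SimpleCompare.
End Compare.

(** * From equality almost everywhere to equality *)
Section AeEqual.
Variable R : realType.
Implicit Types (f g : R -> R) (a b : nat -> \bar R) (s t x y z l r e : R).

Local Notation mu := (@lebesgue_measure R).
Local Notation Rp := (`]0%R, +oo[%classic : set R).

Lemma ae_dense (P : R -> Prop) x y : {ae mu, forall t, Rp t -> P t} ->
  0 <= x -> x < y -> exists t, [/\ x < t, t < y & P t].
Proof.
move=> [N [mN N0 NP]] x0 xy; apply: contrapT => H.
have sub : `]x, y[%classic `<=` N.
  move=> t; rewrite /= in_itv/= => /andP[xt ty]; apply: NP => /= Pt.
  apply: H; exists t; split => //; apply: Pt.
  by rewrite in_itv/= andbT (le_lt_trans x0).
have : (mu `]x, y[%classic <= 0)%E.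
  by rewrite -N0; apply: le_measure => //; rewrite inE//; exact: measurable_itv.
rewrite lebesgue_measure_itv/= lte_fin xy leNgt => /negP; apply.
by rewrite -EFinB lte_fin subr_gt0.
Qed.

Lemma cvg_maxr0 (T : Type) (F : set_system T) {FF : Filter F} (f : T -> R) l :
  f x @[x --> F] --> l -> Num.max (f x) 0 @[x --> F] --> Num.max l 0.
Proof.
move=> fl; have E x : Num.max x 0 = (x + `|x|) / 2 :> R.
  by rewrite maxr_absE subr0 addr0.
rewrite E (_ : (fun x : T => Num.max (f x) 0) = (fun x : T => (f x + `|f x|) / 2)).
  by apply: cvgM; [apply: cvgD => //; exact: cvg_norm|exact: cvg_cst].
by apply/funext => x; rewrite E.
Qed.

Lemma kink_continuous (u v : \bar R) t : (0 <= u)%E -> (0 <= v)%E -> 0 < t ->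
  v <> t%:E -> {for t, continuous (kink u v)}.
Proof.
move=> u0 v0 t0 vt; case: v v0 vt => [s| |]; rewrite ?leeNy_eq//; last first.
  move=> _ _; rewrite (_ : kink u +oo = cst 1); first exact: cvg_cst.
  by apply/funext => x; rewrite kink_pinfty.
rewrite lee_fin => s0 st; case: u u0 => [r| |]; rewrite ?leeNy_eq//.
  move=> _; rewrite (_ : kink r%:E s%:E = (fun x => expR (- (r * Num.max (`|x| - s) 0)))).
    apply: (@continuous_comp _ _ _ (fun x => - (r * Num.max (`|x| - s) 0)) expR);
      last exact: continuous_expR.
    apply: cvgN; apply: cvgM; first exact: cvg_cst.
    apply: cvg_maxr0.
    by apply: cvgB; [exact: norm_continuous|exact: cvg_cst].
  by apply/funext => x; rewrite kink_fin.
move=> _; apply: cvg_near_cst.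
have [ts|ts|E] := ltrgtP t s; last by exfalso; apply: st; rewrite E.
  near=> x; rewrite !kink_cut (ger0_norm (ltW t0)) (ltW ts).
  have x0 : 0 < x by near: x; exact: lt_nbhsr.
  by rewrite ger0_norm ?(ltW x0)// ltW//; near: x; exact: lt_nbhsl.
near=> x; rewrite !kink_cut (ger0_norm (ltW t0)) (lt_geF ts).
have x0 : 0 < x by near: x; exact: lt_nbhsr.
by rewrite ger0_norm ?(ltW x0)// lt_geF//; near: x; exact: lt_nbhsr.
Unshelve. all: by end_near. Qed.

Lemma kink_cvg_left (u v : \bar R) t : (0 <= u)%E -> (0 <= v)%E -> 0 < t ->
  kink u v x @[x --> t^'-] --> kink u v t.
Proof.
move=> u0 v0 t0; have [vt|/eqP vt] := eqVneq v t%:E; last first.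
  by apply: cvg_at_left_filter; exact: kink_continuous.
apply: cvg_near_cst; rewrite vt; near=> x.
have x0 : 0 < x by near: x; exact: nbhs_left_gt.
have xt : x < t by near: x; exact: nbhs_left_lt.
by rewrite /kink !hinge_fin !ger0_norm ?(ltW t0) ?(ltW x0)// !max_r// ?subr_le0 ?(ltW xt).
Unshelve. all: by end_near. Qed.

Lemma simple_cvg (F : set_system R) {FF : Filter F} K a b t :
  (forall i, (i < K)%N -> kink (a i) (b i) x @[x --> F] --> kink (a i) (b i) t) ->
  simple K a b x @[x --> F] --> simple K a b t.
Proof.
elim: K => [|K IH] H.
  rewrite (_ : simple 0 a b = cst (simple 0 a b t)); first exact: cvg_cst.
  by apply/funext => x; rewrite /simple/= !big_ord0.
rewrite (_ : simple K.+1 a b = fun x => simple K a b x * kink (a K) (b K) x).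
  apply: cvgM; last exact: H.
  by apply: IH => i iK; apply: H; exact: ltnW.
by apply/funext => x; rewrite /simple big_ord_recr.
Qed.

(** A monotone function that agrees almost everywhere with a function continuous
    at [t] agrees with it at [t]. *)
Lemma halfLC_simple_eq K a b f t : admissible a b -> halfLC f ->
  {ae mu, forall t, Rp t -> f t = simple K a b t} ->
  0 < t -> (forall i, (i < K)%N -> b i <> t%:E) -> f t = simple K a b t.
Proof.
move=> [a0 b0 bm] hf ae t0 bt.
have cg : {for t, continuous (simple K a b)}.
  by apply: simple_cvg => i iK; apply: kink_continuous => //; exact: bt.
have near_eq e : 0 < e -> exists2 d, 0 < d & forall x, `|t - x| < d ->
    `|simple K a b t - simple K a b x| < e.
  move=> e0; have /cvgrPdist_lt/(_ e e0) := cg.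
  move=> /nbhs_ballP[d /= d0 Hd]; by exists d.
apply/eqP; rewrite eq_le; apply/andP; split; apply/ler_addgt0Pr => e e0.
- have [d d0 Hd] := near_eq e e0.
  have [||x [x1 x2 x3]] := @ae_dense _ (Num.max 0 (t - d)) t ae.
  + by rewrite le_max lexx.
  + by rewrite gt_max t0 ltrBlDr ltrDl.
  move: x1; rewrite gt_max => /andP[x0 x1].
  rewrite (le_trans (halfLC_anti hf (ltW x0) (ltW x2)))// x3.
  have := Hd x; rewrite gtr0_norm ?subr_gt0// => /(_ _) H.
  have {}H := H ltac:(lra); move: H; rewrite distrC => /(le_lt_trans (ler_norm _)); lra.
- have [d d0 Hd] := near_eq e e0.
  have [||x [x1 x2 x3]] := @ae_dense _ t (t + d) ae.
  + exact: ltW.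
  + by rewrite ltrDl.
  rewrite -lerBlDr.
  apply: le_trans (halfLC_anti hf (ltW t0) (ltW x1)); rewrite x3.
  have := Hd x; rewrite distrC gtr0_norm ?subr_gt0// => /(_ _) H.
  have {}H := H ltac:(lra); move: H => /(le_lt_trans (ler_norm _)); lra.
Qed.

(** Simple functions are left continuous on the positive half-line. *)
Lemma simple_ae_eq K a b K' a' b' t : admissible a b -> admissible a' b' ->
  {ae mu, forall t, Rp t -> simple K a b t = simple K' a' b' t} ->
  simple K a b t = simple K' a' b' t.
Proof.
move=> ab ab' ae; wlog t0 : t / 0 <= t.
  move=> H; have [/H//|/ltW] := leP 0 t.
  by rewrite -oppr_ge0 => /H; rewrite !simpleN.
have [<-|tn0] := eqVneq 0 t.
  by have [-> _ _ _] := simple_halfLC K ab; have [-> _ _ _] := simple_halfLC K' ab'.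
have {tn0}t0' : 0 < t by rewrite lt_neqAle tn0.
have [a0 b0 _] := ab; have [a'0 b'0 _] := ab'.
have c1 : simple K a b x @[x --> t^'-] --> simple K a b t.
  by apply: simple_cvg => i _; exact: kink_cvg_left.
have c2 : simple K' a' b' x @[x --> t^'-] --> simple K' a' b' t.
  by apply: simple_cvg => i _; exact: kink_cvg_left.
apply/eqP; rewrite -subr_eq0 -normr_le0; apply/ler_addgt0Pr => e e0; rewrite add0r.
have e2 : 0 < e / 2 by rewrite divr_gt0.
have /cvgrPdist_lt/(_ _ e2) [d1 /= d10 H1] := c1.
have /cvgrPdist_lt/(_ _ e2) [d2 /= d20 H2] := c2.
have [||x [x1 x2 x3]] := @ae_dense _ (Num.max 0 (Num.max (t - d1) (t - d2))) t ae.
- by rewrite le_max lexx.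
- by rewrite !gt_max t0' !ltrBlDr !ltrDl d10.
move: x1; rewrite !gt_max => /and3P[x0 xd1 xd2].
have := H1 x; rewrite /ball/= gtr0_norm ?subr_gt0// => /(_ _ x2) {}H1.
have := H2 x; rewrite /ball/= gtr0_norm ?subr_gt0// => /(_ _ x2) {}H2.
have {}H1 := H1 ltac:(lra); have {}H2 := H2 ltac:(lra).
rewrite -x3 distrC in H2; move: H1 H2.
have := ler_distD (simple K a b x) (simple K a b t) (simple K' a' b' t); lra.
Qed.

End AeEqual.

(** * Compactness of simple functions *)
Section ExtendedSequences.
Variable R : realType.
Implicit Types (u v : nat -> \bar R) (l : \bar R) (x : R).

(** Convergence in the order topology, in the form used for slopes and nodes:
    finite strict bounds of the limit hold eventually. *)
Definition ecv u l := (forall x, (x%:E < l)%E -> \forall n \near \oo, (x%:E < u n)%E) /\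
  (forall x, (l < x%:E)%E -> \forall n \near \oo, (u n < x%:E)%E).

Lemma subsequence_choice (P : nat -> nat -> Prop) :
  (forall k N, exists2 n, (N <= n)%N & P k n) ->
  exists phi : nat -> nat, (forall k, (phi k < phi k.+1)%N) /\ forall k, P k (phi k).
Proof.
move=> H; have [h hP] := choice (fun kN : nat * nat =>
  let: ex_intro2 n a b := H kN.1 kN.2 in ex_intro (fun n => (kN.2 <= n)%N /\ P kN.1 n) n (conj a b)).
pose phi := fix phi k := if k is k'.+1 then h (k, (phi k').+1) else h (0%N, 0%N).
exists phi; split; first by move=> k; have [] := hP (k.+1, (phi k).+1).
by case=> [|k]; [have [] := hP (0%N, 0%N)|have [] := hP (k.+1, (phi k).+1)].
Qed.

Lemma increasing_ge_id (phi : nat -> nat) n : (forall k, (phi k < phi k.+1)%N) -> (n <= phi n)%N.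
Proof. by move=> H; elim: n => // n IH; exact: leq_ltn_trans IH (H n). Qed.

Lemma near_subsequence (phi : nat -> nat) (P : nat -> Prop) : (forall k, (phi k < phi k.+1)%N) ->
  (\forall n \near \oo, P n) -> \forall n \near \oo, P (phi n).
Proof.
move=> H [N _ HN]; exists N => // n /= Nn; apply: HN => /=.
by apply: (leq_trans Nn); exact: increasing_ge_id.
Qed.

Lemma ecv_subsequence (phi : nat -> nat) u l : (forall k, (phi k < phi k.+1)%N) ->
  ecv u l -> ecv (u \o phi) l.
Proof.
  move=> H [u1 u2]; split => x xl.
    by apply: (near_subsequence H (P := fun n => (x%:E < u n)%E)); exact: u1.
  by apply: (near_subsequence H (P := fun n => (u n < x%:E)%E)); exact: u2.
Qed.

(** The limit is the upper limit of the sequence. *)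
Lemma ecv_extract u : (forall n, (0 <= u n)%E) ->
  exists (phi : nat -> nat) l, [/\ (forall k, (phi k < phi k.+1)%N), (0 <= l)%E & ecv (u \o phi) l].
Proof.
move=> u0; pose S := [set y : \bar R | \forall n \near \oo, (u n <= y)%E].
pose l := ereal_inf S.
have l0 : (0 <= l)%E.
  apply: le_ereal_inf_tmp => y [N _ HN].
  by apply: (le_trans (u0 N)); apply: HN => /=.
have often y : (y < l)%E -> forall N, exists2 n, (N <= n)%N & (y < u n)%E.
  move=> yl N; apply: contrapT => H; move: yl; rewrite ltNge => /negP; apply.
  apply: ereal_inf_lbound; exists N => // n /= Nn.
  by rewrite leNgt; apply/negP => yu; apply: H; exists n.
have below y : (l < y)%E -> exists2 z, S z & (z < y)%E.
  move=> yl; apply: contrapT => H; move: yl; rewrite ltNge => /negP; apply.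
  apply: le_ereal_inf_tmp => z Sz; rewrite leNgt; apply/negP => zy; apply: H.
  by exists z.
clearbody l; pose x (k : nat) : R := if l is r%:E then r - k.+1%:R^-1 else k%:R.
have xl k : ((x k)%:E < l)%E.
  rewrite /x; case: l l0 {often below x} => [r| |] //; last by rewrite ltry.
  by rewrite lte_fin ltrBlDr ltrDl invr_gt0.
have [phi [phi_incr phiP]] := subsequence_choice (fun k => often _ (xl k)).
exists phi, l; split => //; split => y yl.
  suff [N HN] : exists N, forall k, (N <= k)%N -> y <= x k.
    by exists N => // k /= /HN yx; apply: le_lt_trans (phiP k); rewrite lee_fin.
  rewrite /x; case: l l0 yl {xl often phiP x below} => [r| |] // _.
    rewrite lte_fin => yr; have ry : 0 < r - y by rewrite subr_gt0.
    exists (Num.Def.truncn (r - y)^-1) => k Nk.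
    rewrite lerBrDr -lerBrDl invf_ple ?posrE//.
    rewrite (le_trans (ltW (truncnS_gt _)))// ler_nat ltnS//.
  move=> _; exists (Num.Def.truncn y).+1 => k Nk.
  by rewrite (le_trans (ltW (truncnS_gt _)))// ler_nat.
have [z [N _ HN] zy] := below _ yl.
apply: (near_subsequence phi_incr (P := fun n => (u n < y%:E)%E)).
by exists N => // n /HN /le_lt_trans; apply.
Qed.

Lemma ecv_extract_family (U : nat -> nat -> \bar R) m : (forall i n, (0 <= U i n)%E) ->
  exists (phi : nat -> nat) (L : nat -> \bar R), [/\ (forall k, (phi k < phi k.+1)%N),
    (forall i, (0 <= L i)%E) & forall i, (i < m)%N -> ecv (U i \o phi) (L i)].
Proof.
move=> U0; elim: m => [|m [phi [L [pi L0 HL]]]].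
  by exists id, (fun=> 0%E); split.
have [psi [l [psi_i l0 Hl]]] := @ecv_extract (U m \o phi) (fun n => U0 _ _).
have mono : forall k, (phi (psi k) < phi (psi k.+1))%N.
  move=> k; have : forall j k', (k' < j)%N -> (phi k' < phi j)%N.
    elim=> // j IH k'; rewrite ltnS leq_eqVlt => /orP[/eqP->//|/IH /ltn_trans]; apply.
    exact: pi.
  by apply; exact: psi_i.
exists (phi \o psi), (fun i => if i == m then l else L i); split => //.
  by move=> i; case: ifP.
move=> i; rewrite ltnS leq_eqVlt; case: eqP => [->|_ /= im] //.
exact: (ecv_subsequence psi_i (HL i im)).
Qed.

Lemma ecv_fin u (r : R) : ecv u r%:E ->
  (\forall n \near \oo, u n = (fine (u n))%:E) /\ fine (u n) @[n --> \oo] --> r.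
Proof.
move=> [u1 u2]; have H e : 0 < e -> \forall n \near \oo, u n = (fine (u n))%:E /\ `|r - fine (u n)| < e.
  move=> e0; have H1 := u1 (r - e); have H2 := u2 (r + e).
  have {}H1 := H1 ltac:(by rewrite lte_fin ltrBlDr ltrDl).
  have {}H2 := H2 ltac:(by rewrite lte_fin ltrDl).
  apply: filterS2 H1 H2 => n; case: (u n) => [s| |] //=; rewrite !lte_fin => h1 h2.
  by split => //; rewrite ltr_norml; apply/andP; split; lra.
split; first by apply: filterS (H 1 ltr01) => n [].
by apply/cvgrPdist_lt => e e0; apply: filterS (H e e0) => n [].
Qed.

Lemma ecv_unique_cst u l c : (forall n, u n = c) -> ecv u l -> l = c.
Proof.
move=> uc [u1 u2]; have [lc|cl|//] := ltgtP l c; exfalso.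
  have [x /= lx xc] : exists2 x : R, (l < x%:E)%E & (x%:E <= c)%E.
    case: l c lc {uc u1 u2} => [r| |] [s| |] //=.
    - by rewrite lte_fin => rs; exists s; rewrite ?lte_fin.
    - by move=> _; exists (r + 1); rewrite ?lte_fin ?ltrDl ?leey.
    - by move=> _; exists s; rewrite ?ltNyr.
    - by move=> _; exists 0; rewrite ?ltNyr ?leey.
  have [N _ /(_ N (leqnn _))] := u2 x lx.
  by rewrite uc ltNge xc.
have [x /= cx xl] : exists2 x : R, (c <= x%:E)%E & (x%:E < l)%E.
  case: l c cl {uc u1 u2} => [r| |] [s| |] //=.
  - by rewrite lte_fin => rs; exists s; rewrite ?lte_fin.
  - by move=> _; exists (r - 1); rewrite ?lte_fin ?ltrBlDr ?ltrDl ?leNye.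
  - by move=> _; exists s; rewrite ?ltry.
  - by move=> _; exists 0; rewrite ?ltry ?leNye.
have [N _ /(_ N (leqnn _))] := u1 x xl.
by rewrite uc ltNge cx.
Qed.

Lemma ecv_le u v l m : (forall n, (u n <= v n)%E) -> ecv u l -> ecv v m -> (l <= m)%E.
Proof.
move=> uv [u1 _] [_ v2]; rewrite leNgt; apply/negP => ml.
have [x [mx xl]] : exists x : R, (m < x%:E)%E /\ (x%:E < l)%E.
  case: l m ml {uv u1 v2} => [r| |] [s| |] //=.
  - rewrite lte_fin => sr; exists ((s + r) / 2); rewrite !lte_fin.
    by rewrite !midf_lt.
  - by move=> _; exists (r - 1); rewrite ltNyr lte_fin ltrBlDr ltrDl.
  - by move=> _; exists (s + 1); rewrite ltry lte_fin ltrDl.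
  - by move=> _; exists 0; rewrite ltry ltNyr.
have /= [N _ /(_ N (leqnn _)) [h1 h2]] := filterI (u1 x xl) (v2 x mx).
by have := lt_le_trans h1 (uv N); rewrite ltNge (ltW h2).
Qed.

Lemma near_forall_lt m (P : nat -> nat -> Prop) :
  (forall j, (j < m)%N -> \forall n \near \oo, P j n) ->
  \forall n \near \oo, forall j, (j < m)%N -> P j n.
Proof.
elim: m => [|m IH] H; first by near=> n.
have h1 := IH (fun j jm => H j (ltnW jm)); have h2 := H m (leqnn _).
apply: filterS2 h1 h2 => n h1 h2 j; rewrite ltnS leq_eqVlt => /orP[/eqP->//|].
exact: h1.
Unshelve. all: by end_near. Qed.

End ExtendedSequences.

Section Compactness.
Variable R : realType.
Implicit Types (f g : R -> R) (a b : nat -> \bar R) (s t x y z l r e p : R).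

Local Notation mu := (@lebesgue_measure R).
Local Notation Rp := (`]0%R, +oo[%classic : set R).

Lemma kink_left_eq1 (u v : \bar R) t : 0 < t -> (t%:E < v)%E -> kink u v t = 1.
Proof.
move=> t0 tv; rewrite /kink /hinge ger0_norm ?(ltW t0)//.
suff -> : maxe (t%:E - v)%E 0%E = 0%E by rewrite mule0 oppe0 expeR0.
apply/max_idPr; case: v tv => [s| |] //; last by rewrite leNye.
by rewrite lte_fin -EFinB lee_fin subr_le0 => /ltW.
Qed.

Lemma kink_le_slope (u : \bar R) (r s : R) t : (r%:E <= u)%E -> 0 <= r ->
  kink u s%:E t <= expR (- (r * Num.max (`|t| - s) 0)).
Proof.
move=> ru r0; rewrite /kink hinge_fin.
set m := Num.max _ _; have m0 : 0 <= m by rewrite le_max lexx orbT.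
case: u ru => [u| |] //; rewrite ?leeNy_eq//.
  by rewrite lee_fin => ru /=; rewrite ler_expR lerN2 ler_wpM2r.
move=> _; have [->|mn0] := eqVneq m 0; first by rewrite mulr0 mule0 oppe0 expeR0 oppr0 expR0.
rewrite gt0_mulye ?lte_fin ?lt_def ?mn0//=; exact: expR_ge0.
Qed.

(** The delicate case is [u n] growing to [+oo] with [b < t]: the kink is then at
    most exp (- M d) for every [M], where [d] is half the distance from [b] to
    [t]. *)
Lemma kink_ecv (u v : nat -> \bar R) (a b : \bar R) t :
  ecv u a -> ecv v b -> (0 <= a)%E -> (0 <= b)%E -> 0 < t -> b <> t%:E ->
  kink (u n) (v n) t @[n --> \oo] --> kink a b t.
Proof.
move=> ua vb a0 b0 t0 bt.
have [tb|bt'|E] := ltgtP t%:E b; last by rewrite E in bt.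
  rewrite (kink_left_eq1 _ t0 tb); apply: cvg_near_cst.
  by have [H _] := vb; apply: filterS (H t tb) => n; exact: kink_left_eq1.
case: b b0 vb bt bt' => [s| |] //; rewrite ?leeNy_eq// lee_fin lte_fin => s0 vb _ st.
have [vfin vs] := ecv_fin vb.
case: a a0 ua => [r| |] //; rewrite ?leeNy_eq//.
  rewrite lee_fin => r0 ua; have [ufin ur] := ecv_fin ua.
  rewrite kink_fin.
  have H : expR (- (fine (u n) * Num.max (`|t| - fine (v n)) 0)) @[n --> \oo] -->
      expR (- (r * Num.max (`|t| - s) 0)).
    apply: continuous_cvg; first exact: continuous_expR.
    apply: cvgN; apply: cvgM => //; apply: cvg_maxr0; apply: cvgB => //; exact: cvg_cst.
  apply: cvg_trans H; apply: near_eq_cvg.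
  by apply: filterS2 ufin vfin => n uE vE; rewrite -kink_fin -uE -vE.
move=> _ [ua _]; rewrite kink_cut ger0_norm ?(ltW t0)// (lt_geF st).
pose d := (t - s) / 2; have d0 : 0 < d by rewrite divr_gt0// subr_gt0.
apply/cvgrPdist_lt => e e0.
pose M := Num.max 0 (- ln e) / d + 1.
have M0 : 0 < M.
  by rewrite ltr_wpDl// divr_ge0 ?le_max ?lexx// ltW.
have h1 := ua M (ltry _); have [_ h2] := vb.
have {}h2 := h2 (s + d) ltac:(by rewrite lte_fin ltrDl).
apply: filterS2 (filterI h1 h2) vfin => n [Mu vsd] vE.
rewrite sub0r normrN ger0_norm ?kink_ge0// vE.
apply: le_lt_trans (kink_le_slope _ _ (ltW Mu) (ltW M0)) _.
rewrite -[X in _ < X]lnK ?posrE// ltr_expR ltrNl.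
rewrite vE lte_fin in vsd.
have dm : d <= Num.max (`|t| - fine (v n)) 0.
  rewrite le_max ger0_norm ?(ltW t0)//; apply/orP; left.
  by move: vsd; rewrite /d; lra.
apply: (@lt_le_trans _ _ (M * d)); last by rewrite ler_wpM2l// ltW.
rewrite /M mulrDl divfK ?gt_eqF// mul1r.
have : - ln e <= Num.max 0 (- ln e) by rewrite le_max lexx orbT.
lra.
Qed.

(** The closed parameter domain. *)
Definition pinned K (pin0 pinC : bool) a b : Prop :=
  [/\ admissible a b, pin0 -> b 0%N = 0%E & pinC -> a K.-1 = +oo%E].

Definition nodes K b : seq R := [seq fine (b i) | i <- iota 0 K].

Lemma nodesP K b t : (forall i, (0 <= b i)%E) -> t \notin nodes K b ->
  forall i, (i < K)%N -> b i <> t%:E.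
Proof.
move=> b0 tn i iK E; move/negP: tn; apply; apply/mapP; exists i; last by rewrite E.
by rewrite mem_iota.
Qed.

(** A bound on one moment gives a point where all the functions are at most 1/2,
    hence a common exponential bound; along a subsequence whose parameters
    converge, the moments converge by dominated convergence.  All conditions
    defining [generic_nodes] are strict, so they pass to nearby parameters. *)
Lemma simple_compact K pin0 pinC (A_ B_ : nat -> nat -> \bar R) p0 (C : R) :
  (0 < K)%N -> -1 < p0 -> (forall n, pinned K pin0 pinC (A_ n) (B_ n)) ->
  (forall n, (moment p0 (simple K (A_ n) (B_ n)) <= C%:E)%E) ->
  exists (phi : nat -> nat) a b, [/\ (forall k, (phi k < phi k.+1)%N),
    pinned K pin0 pinC a b, expdecay (simple K a b),
    (forall p, -1 < p -> mom p (simple K (A_ (phi n)) (B_ (phi n))) @[n --> \oo] -->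
        mom p (simple K a b)) &
    (generic_nodes K pin0 pinC a b ->
      \forall n \near \oo, generic_nodes K pin0 pinC (A_ (phi n)) (B_ (phi n)))].
Proof.
move=> K0 p01 pin mC.
pose U i n := if (i < K)%N then A_ n i else B_ n (i - K)%N.
have [phi [L [phi_i L0 HL]]] := @ecv_extract_family R U (K + K) (fun i n =>
  ltac:(rewrite /U; case: (pin n) => [[a0 b0 _] _ _]; case: ifP => _; [exact: a0|exact: b0])).
pose a i := if (i < K)%N then L i else 0%E.
pose b i := if (i < K)%N then L (K + i)%N else +oo%E.
have aE i : (i < K)%N -> ecv (fun n => A_ (phi n) i) (a i).
  move=> iK; rewrite /a iK; have := HL i (ltn_addr _ iK).
  by rewrite (_ : U i \o phi = fun n => A_ (phi n) i)//; apply/funext => n; rewrite /= /U iK.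
have bE i : (i < K)%N -> ecv (fun n => B_ (phi n) i) (b i).
  move=> iK; rewrite /b iK; have := HL (K + i)%N; rewrite ltn_add2l => /(_ iK).
  rewrite (_ : U _ \o phi = fun n => B_ (phi n) i)//; apply/funext => n.
  by rewrite /= /U ltnNge leq_addr/= addKn.
have a0 i : (0 <= a i)%E by rewrite /a; case: ifP.
have b0 i : (0 <= b i)%E by rewrite /b; case: ifP.
have bm i j : (i <= j)%N -> (b i <= b j)%E.
  move=> ij; have [jK|jK] := ltnP j K; last by rewrite {2}/b ltnNge jK leey.
  apply: ecv_le (bE i (leq_ltn_trans ij jK)) (bE j jK).
  by move=> n; have [[_ _ m] _ _] := pin (phi n); exact: m.
have pinab : pinned K pin0 pinC a b.
  split; first by split.
    move=> h; apply: (ecv_unique_cst _ (bE 0%N K0)) => n.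
    by have [_ + _] := pin (phi n); apply.
  move=> h; apply: (ecv_unique_cst _ (aE K.-1 _)); last by rewrite prednK.
  by move=> n; have [_ _] := pin (phi n); apply.
pose g n := simple K (A_ (phi n)) (B_ (phi n)).
have hg n : halfLC (g n) by apply: simple_halfLC; case: (pin (phi n)).
have hg' : halfLC (simple K a b) by apply: simple_halfLC; case: pinab.
have cg t : 0 < t -> t \notin nodes K b -> g n t @[n --> \oo] --> simple K a b t.
  move=> t0 tn; have bt := nodesP b0 tn.
  suff H k : (k <= K)%N -> simple k (A_ (phi n)) (B_ (phi n)) t @[n --> \oo] --> simple k a b t.
    exact: H.
  elim: k => [_|k IH kK].
    rewrite (_ : (fun n => _) = cst (simple 0 a b t)); first exact: cvg_cst.
    by apply/funext => n; rewrite /simple/= !big_ord0.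
  rewrite (_ : (fun n => _) = fun n => simple k (A_ (phi n)) (B_ (phi n)) t * kink (A_ (phi n) k) (B_ (phi n) k) t).
    rewrite (_ : simple k.+1 a b t = simple k a b t * kink (a k) (b k) t).
      apply: cvgM; first exact: IH (ltnW kK).
      by apply: kink_ecv; [exact: aE|exact: bE|exact: a0|exact: b0|by []|exact: bt].
    by rewrite /simple big_ord_recr.
  by apply/funext => n; rewrite /simple big_ord_recr.
(* a uniform point where all the functions have dropped below 1/2 *)
have [A [A0 hA]] : exists A, 0 < A /\ forall n, g n A <= 1 - 2^-1.
  have q0 : 0 < p0 + 1 by lra.
  (* with this [c], a value above 1/2 at [A] would give a moment above [C] *)
  pose c := 4 * (`|C| + 1).
  have c0 : 0 < c by rewrite /c mulr_gt0// ltr_wpDl.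
  exists (2 * c `^ (p0 + 1)^-1); split; first by rewrite mulr_gt0// powR_gt0.
  move=> n; set A := 2 * _; have A0 : 0 < A by rewrite mulr_gt0// powR_gt0.
  have := le_trans (moment_lower p01 (hg n) A0) (mC _); rewrite lee_fin.
  have -> : A / 2 = c `^ (p0 + 1)^-1 by rewrite /A; field.
  rewrite -powRrM mulVf ?gt_eqF// powRr1 ?(ltW c0)// => H.
  rewrite leNgt; apply/negP => gA.
  have : (1 - 2^-1) * (c / 2) < g n A * (c / 2) by rewrite ltr_pM2r// divr_gt0.
  have := ler_norm C; rewrite /c in H *; lra.
have d0 : 0 < 2^-1 :> R by rewrite invr_gt0.
have [A' AA' A'n] : exists2 A', A <= A' & A' \notin nodes K b.
  exists (Num.max A (\sum_(x <- nodes K b) `|x| + 1)); first by rewrite le_max lexx.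
  apply/negP => H; set m := Num.max _ _ in H.
  have : m <= \sum_(x <- nodes K b) `|x|.
    rewrite (perm_big _ (perm_to_rem H)) big_cons /=.
    by rewrite (le_trans (ler_norm m))// lerDl; apply: sumr_ge0 => x _.
  by rewrite leNgt /m lt_max ltrDl ltr01 orbT.
have A'0 : 0 < A' by exact: lt_le_trans AA'.
exists phi, a, b; split => //.
- apply: (halfLC_expdecay hg' A'0).
  apply: (@le_lt_trans _ _ (1 - 2^-1)); last by rewrite ltrBlDr ltrDl.
  apply: (cvgr_to_le (cg A' A'0 A'n)); apply: nearW => n.
  by apply: le_trans (hA n); exact: (halfLC_anti (hg n) (ltW A0) AA').
- move=> p p1; apply: (mom_cvg (B := expR 2^-1) (c := 2^-1 / A) (zs := nodes K b)) => //.
  + by rewrite divr_gt0.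
  + by move=> n; exact: halfLC_measurable (hg n).
  + exact: halfLC_measurable.
  + move=> n t t0; rewrite ger0_norm; last exact: simple_ge0.
    exact: (halfLC_decay (hg n) A0 d0 (hA n) (ltW t0)).
move=> [g1 g2 g3 g4 g5].
have n1 : \forall n \near \oo, forall j, (j < K)%N -> (0 < A_ (phi n) j)%E.
  by apply: near_forall_lt => j jK; have [H _] := aE j jK; apply: H; exact: g1.
have below_real (x : \bar R) : (0 <= x)%E -> (x < +oo)%E -> exists r : R, (x < r%:E)%E.
  by case: x => [r| |] // _ _; exists (r + 1); rewrite lte_fin ltrDl.
have n2 : \forall n \near \oo, forall j, (j < K)%N ->
    ~~ (pinC && (j == K.-1)) -> (A_ (phi n) j < +oo)%E.
  apply: near_forall_lt => j jK.
  have [H|H] := boolP (pinC && (j == K.-1)); first by apply: nearW.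
  have [r ar] := below_real _ (a0 j) (g2 j jK H).
  have [_ h] := aE j jK; apply: filterS (h r ar) => n hn _.
  by rewrite (lt_le_trans hn)// leey.
have n3 : \forall n \near \oo, forall j, (j < K)%N -> (j.+1 < K)%N ->
    (B_ (phi n) j < B_ (phi n) j.+1)%E.
  apply: near_forall_lt => j jK.
  have [jK1|jK1] := boolP (j.+1 < K)%N; last by apply: nearW.
  have [r [br rb]] : exists r : R, (b j < r%:E)%E /\ (r%:E < b j.+1)%E.
    have := g3 j jK1; have := g5 j jK; case: (b j) (b0 j) => [s| |] //; rewrite ?leeNy_eq// => _ _.
    case: (b j.+1) => [s'| |] //.
      rewrite lte_fin => ss; exists ((s + s') / 2); rewrite !lte_fin.
      by rewrite !midf_lt.
    by move=> _; exists (s + 1); rewrite ltry lte_fin ltrDl.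
  have [_ h] := bE j jK; have [h' _] := bE j.+1 jK1.
  apply: filterS2 (h r br) (h' r rb) => n h1 h2 _; exact: lt_trans h2.
have n4 : \forall n \near \oo, ~~ pin0 -> (0 < B_ (phi n) 0%N)%E.
  case: (pin0) g4 => g4; first by apply: nearW.
  have [h _] := bE 0%N K0; apply: filterS (h 0 (g4 isT)) => n hn _; exact: hn.
have n5 : \forall n \near \oo, forall j, (j < K)%N -> (B_ (phi n) j < +oo)%E.
  apply: near_forall_lt => j jK.
  have [r br] := below_real _ (b0 j) (g5 j jK).
  have [_ h] := bE j jK; apply: filterS (h r br) => n hn.
  by rewrite (lt_le_trans hn)// leey.
near=> n; split.
- by near: n; exact: n1.
- by near: n; exact: n2.
- move=> j jK; have h : forall j, (j < K)%N -> (j.+1 < K)%N ->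
    (B_ (phi n) j < B_ (phi n) j.+1)%E by near: n; exact: n3.
  exact: (h j (ltnW jK) jK).
- by near: n; exact: n4.
- by near: n; exact: n5.
Unshelve. all: by end_near. Qed.

End Compactness.

(** * First variation of the moments *)
Section FirstVariation.
Variable R : realType.
Implicit Types (f g u v w : R -> R) (a b : nat -> \bar R) (s t x y z l r e p c B C : R).

Local Notation mu := (@lebesgue_measure R).
Local Notation Rp := (`]0%R, +oo[%classic : set R).

Section Functional.
Variables (I : eqType) (s : seq I) (q m : I -> R).

Definition discrepancy f := \sum_(i <- s) (mom (q i) f - m i) ^+ 2.

(** Derivative of [discrepancy] at a minimiser, along a sequence. *)
Lemma first_variation g (g_ : nat -> R -> R) (e_ : nat -> R) (D : I -> R) :
  (forall n, discrepancy g <= discrepancy (g_ n)) -> (forall n, 0 < e_ n) ->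
  e_ n @[n --> \oo] --> 0 ->
  (forall i, i \in s -> (mom (q i) (g_ n) - mom (q i) g) / e_ n @[n --> \oo] --> D i) ->
  0 <= \sum_(i <- s) (mom (q i) g - m i) * D i.
Proof.
move=> le_d e0 ecv Dcv.
pose v i := mom (q i) g - m i; pose d i n := (mom (q i) (g_ n) - mom (q i) g) / e_ n.
have ge n : 0 <= \sum_(i <- s) (v i * d i n *+ 2 + e_ n * d i n ^+ 2).
  have -> : \sum_(i <- s) (v i * d i n *+ 2 + e_ n * d i n ^+ 2) =
      (discrepancy (g_ n) - discrepancy g) / e_ n.
    rewrite /discrepancy -sumrB mulr_suml; apply: eq_bigr => i _.
    by rewrite /v /d; field; rewrite gt_eqF.
  by rewrite divr_ge0 ?subr_ge0// ltW.
have : (\sum_(i <- s) (v i * d i n *+ 2 + e_ n * d i n ^+ 2)) @[n --> \oo] -->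
    \sum_(i <- s) (v i * D i *+ 2 + 0 * D i ^+ 2).
  elim: (s) Dcv {ge le_d} => [_|i s' IH Dcv].
    rewrite big_nil (_ : (fun n => _) = cst 0); first exact: cvg_cst.
    by apply/funext => n; rewrite big_nil.
  rewrite big_cons (_ : (fun n => _) = fun n => (v i * d i n *+ 2 + e_ n * d i n ^+ 2) +
     \sum_(i <- s') (v i * d i n *+ 2 + e_ n * d i n ^+ 2)); last first.
    by apply/funext => n; rewrite big_cons.
  have di : d i n @[n --> \oo] --> D i by apply: Dcv; rewrite inE eqxx.
  apply: cvgD; last by apply: IH => j js; apply: Dcv; rewrite inE js orbT.
  apply: cvgD.
    by apply: cvgMn; apply: cvgM => //; exact: cvg_cst.
  apply: cvgM => //; rewrite expr2 (_ : (fun n => _) = fun n => d i n * d i n).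
    exact: cvgM.
  by apply/funext => n; rewrite expr2.
move=> H; have {H} : 0 <= \sum_(i <- s) (v i * D i *+ 2 + 0 * D i ^+ 2).
  by apply: (cvgr_to_ge H); exact: nearW.
rewrite (eq_bigr (fun i => (v i * D i) *+ 2)); last by move=> i _; rewrite mul0r addr0.
by rewrite sumrMnl pmulrn_lge0.
Qed.

End Functional.

Lemma expR_sub1_bound x : `|expR x - 1| <= `|x| * expR `|x|.
Proof.
have h1 := expR_ge1Dx x; have h2 := expR_ge1Dx (- x).
have [x0|x0] := leP 0 x.
  rewrite !ger0_norm//; last by rewrite subr_ge0 -expR0 ler_expR.
  have : (1 - x) * expR x <= expR (- x) * expR x by rewrite ler_wpM2r// expR_ge0.
  by rewrite -expRD addNr expR0; lra.
rewrite ler0_norm; last by rewrite subr_le0 -expR0 ler_expR ltW.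
rewrite ltr0_norm// opprB.
have : 1 <= expR (- x) by rewrite -expR0 ler_expR oppr_ge0 ltW.
move=> h3; apply: (@le_trans _ _ (- x)); first lra.
by rewrite ler_pMr// oppr_gt0.
Qed.

Lemma expR_sub1_sub_bound x : `|expR x - 1 - x| <= `|x| * (`|x| * expR `|x|).
Proof.
have h0 : 0 <= expR x - 1 - x by have := expR_ge1Dx x; lra.
rewrite ger0_norm//; apply: (@le_trans _ _ (x * (expR x - 1))).
  have h2 := expR_ge1Dx (- x).
  have : (1 - x) * expR x <= expR (- x) * expR x by rewrite ler_wpM2r// expR_ge0.
  by rewrite -expRD addNr expR0; lra.
rewrite (le_trans (ler_norm _))// normrM ler_wpM2l//.
exact: expR_sub1_bound.
Qed.

(** For g_n = g exp (- w_n) with w_n / e_n tending to [w]: the difference quotients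
    tend to [- g w] pointwise, and the bound on w_n / e_n by an affine function
    keeps them below a common exponential. *)
Lemma moment_derivative p g (g_ w_ : nat -> R -> R) w (e_ : nat -> R) (zs : seq R) B c C :
  -1 < p -> measurable_fun Rp g -> 0 < c -> 0 < C ->
  (forall t, 0 < t -> 0 <= g t <= B * expR (- (c * t))) ->
  (forall n, measurable_fun Rp (g_ n)) -> measurable_fun Rp w ->
  (forall n t, 0 < t -> g_ n t = g t * expR (- w_ n t)) ->
  (forall n, 0 < e_ n) -> (forall n, e_ n * C <= c / 4) ->
  (forall n t, 0 < t -> `|w_ n t| <= e_ n * (C * (1 + t))) -> e_ n @[n --> \oo] --> 0 ->
  (forall t, 0 < t -> t \notin zs -> w_ n t / e_ n @[n --> \oo] --> w t) ->
  (mom p (g_ n) - mom p g) / e_ n @[n --> \oo] --> mom p (fun t => - (g t * w t)) /\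
  forall n, expdecay (g_ n).
Proof.
move=> p1 mg c0 C0 gB mg_ mw gE e0 eC wb ecv wcv.
have B0 : 0 <= B.
  have /andP[h1 h2] := gB 1 ltr01; have := le_trans h1 h2.
  by rewrite pmulr_lge0// expR_gt0.
have dg : expdecay g.
  split => //; exists B, c; split => // t t0; have /andP[h1 h2] := gB t t0.
  by rewrite ger0_norm.
pose u n t := (g_ n t - g t) / e_ n.
have mu_ n : measurable_fun Rp (u n).
  by apply: measurable_funM => //; apply: measurable_funB.
pose B' := B * C * (4 / c) * expR (c / 2).
have ub n t : 0 < t -> `|u n t| <= B' * expR (- (c / 2 * t)).
  move=> t0; have /andP[h1 h2] := gB t t0; have t1 : 0 < 1 + t by rewrite addr_gt0.
  rewrite /u gE// (_ : g t * _ - g t = g t * (expR (- w_ n t) - 1)); last by ring.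
  rewrite !normrM (ger0_norm h1) (gtr0_norm (_ : 0 < (e_ n)^-1)) ?invr_gt0//.
  rewrite ler_pdivrMr//.
  have hw := wb n t t0.
  have := expR_sub1_bound (- w_ n t); rewrite normrN => h3.
  have h4 : `|w_ n t| * expR `|w_ n t| <= e_ n * (C * (1 + t)) * expR (c / 4 * (1 + t)).
    apply: ler_pM => //; rewrite ?expR_ge0// ler_expR (le_trans hw)//.
    by rewrite mulrA ler_wpM2r// ltW.
  have h5 : 1 + t <= 4 / c * expR (c / 4 * (1 + t)).
    have := expR_ge1Dx (c / 4 * (1 + t)) => h.
    have c4 : 0 <= 4 / c by rewrite divr_ge0// ltW.
    have := ler_wpM2l c4 h; apply: le_trans.
    rewrite mulrDr mulr1 mulrA (_ : 4 / c * (c / 4) = 1); last by field; rewrite gt_eqF.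
    by rewrite mul1r lerDr.
  apply: (@le_trans _ _ (B * expR (- (c * t)) * (e_ n * (C * (4 / c * expR (c / 4 * (1 + t)))) * expR (c / 4 * (1 + t))))).
    apply: ler_pM => //; apply: (le_trans h3); apply: (le_trans h4).
    rewrite ler_wpM2r ?expR_ge0// ler_wpM2l ?(ltW (e0 n))// ler_wpM2l// ltW//.
  rewrite le_eqVlt; apply/orP; left; apply/eqP; rewrite /B'.
  have -> : expR (- (c / 2 * t)) = expR (- (c * t)) * expR (c / 4 * (1 + t)) * expR (c / 4 * (1 + t)) * expR (- (c / 2)).
    by rewrite -!expRD; congr expR; field.
  have : expR (c / 2) * expR (- (c / 2)) = 1 by rewrite expRxMexpNx_1.
  move: (expR (c / 2)) (expR (- (c / 2))) => X Y XY.
  rewrite -[LHS]mulr1 -XY; ring.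
have uE t : 0 < t -> t \notin zs -> u n t @[n --> \oo] --> - (g t * w t).
  move=> t0 tz; have wt := wcv t t0 tz.
  have w0 : w_ n t @[n --> \oo] --> 0.
    rewrite (_ : (fun n => w_ n t) = fun n => w_ n t / e_ n * e_ n).
      by rewrite -(mulr0 (w t)); exact: cvgM.
    by apply/funext => n; rewrite divfK// gt_eqF.
  (* exp(-w)-1+w is O(w^2) *)
  have h n : `|u n t + g t * (w_ n t / e_ n)| <= g t * (`|w_ n t / e_ n| * (`|w_ n t| * expR `|w_ n t|)).
    have /andP[g0 _] := gB t t0.
    rewrite /u gE// (_ : _ + _ = g t * ((expR (- w_ n t) - 1 + w_ n t) / e_ n)); last first.
      by field; rewrite gt_eqF.
    rewrite normrM (ger0_norm g0) ler_wpM2l// !normrM.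
    rewrite (mulrAC `|w_ n t|) ler_wpM2r//.
    have := expR_sub1_sub_bound (- w_ n t); rewrite opprK normrN.
    exact.
  have lim0 : g t * (`|w_ n t / e_ n| * (`|w_ n t| * expR `|w_ n t|)) @[n --> \oo] --> 0.
    rewrite -[X in _ --> X](_ : g t * (`|w t| * (`|0 : R| * expR `|0 : R|)) = 0); last first.
      by rewrite normr0 mul0r !mulr0.
    apply: cvgM; first exact: cvg_cst.
    apply: cvgM; first exact: cvg_norm.
    apply: cvgM; first exact: cvg_norm.
    apply: continuous_cvg; first exact: continuous_expR.
    exact: cvg_norm.
  have d0 : u n t + g t * (w_ n t / e_ n) @[n --> \oo] --> 0.
    apply/cvgrPdist_le => e egt0; move/cvgrPdist_le : lim0 => /(_ e egt0).
    apply: filterS => n; rewrite !sub0r !normrN => H; apply: le_trans (h n) _.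
    exact: le_trans (ler_norm _) H.
  have gw : g t * (w_ n t / e_ n) @[n --> \oo] --> g t * w t.
    by apply: cvgM => //; exact: cvg_cst.
  rewrite -[X in _ --> X]sub0r (_ : (fun n => _) = fun n => u n t + g t * (w_ n t / e_ n) - g t * (w_ n t / e_ n)).
    exact: cvgB.
  by apply/funext => n; rewrite addrK.
have du n : expdecay (u n).
  by split => //; exists B', (c / 2); split; [rewrite divr_gt0|move=> t; exact: ub].
have dg_ n : expdecay (g_ n).
  rewrite (_ : g_ n = g \+ (fun t => e_ n * u n t)).
    apply: expdecayD => //; have [m1 [B1 [c1 [c10 h1]]]] := du n; split.
      by apply: measurable_funM => //; exact: measurable_cst.
    exists (e_ n * B1), c1; split => // t t0.
    by rewrite normrM (gtr0_norm (e0 n)) -mulrA ler_wpM2l ?(ltW (e0 n))// h1.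
  by apply/funext => t /=; rewrite /u mulrC divfK ?gt_eqF// addrC subrK.
split => //.
have E n : (mom p (g_ n) - mom p g) / e_ n = mom p (u n).
  rewrite -momB// mulrC /mom -RintegralZl//; last exact: (expdecay_integrable p1 (expdecayB (dg_ n) dg)).
  by apply: eq_Rintegral => t _; rewrite /u /=; ring.
rewrite (_ : (fun n => _) = fun n => mom p (u n)); last by apply/funext => n; exact: E.
apply: (mom_cvg (B := B') (c := c / 2) (zs := zs)) => //.
- by rewrite divr_gt0.
- by apply: measurable_funN; exact: measurable_funM.
Qed.

Lemma interval_average (phi : R -> R) x y c d : 0 < x -> x <= y ->
  mu.-integrable `]x, y] (EFin \o phi) ->
  (forall t, x < t -> t <= y -> `|phi t - c| <= d) ->
  `|\int[mu]_(t in `]x, y]) phi t - c * (y - x)| <= d * (y - x).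
Proof.
move=> x0 xy iphi phid.
have muxy : (mu `]x, y]%classic = (y - x)%:E)%E.
  rewrite lebesgue_measure_itv/= lte_fin.
  by case: ltgtP xy => // E _; rewrite -?EFinB// E subrr.
have icst k : mu.-integrable `]x, y] (EFin \o cst k).
  apply/integrableP; split; first by apply/measurable_EFinP; exact: measurable_cst.
  rewrite /= integral_cst; last exact: measurable_itv.
  by rewrite [X in (_ * X)%E]muxy -EFinM ltry.
have Icst k : \int[mu]_(t in `]x, y]) k = k * (y - x).
  rewrite Rintegral_cst; last exact: measurable_itv.
  by rewrite [X in fine X]muxy.
have idiff : mu.-integrable `]x, y] (EFin \o (fun t => phi t - c)).
  by apply: (@eq_integrable _ _ _ mu `]x, y] _ _ _ _ (integrableB _ iphi (icst c))).
rewrite -Icst -RintegralB//; last exact: icst.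
apply: (@le_trans _ _ (\int[mu]_(t in `]x, y]) d)); last by rewrite Icst.
apply: le_trans (le_normr_Rintegral _ idiff) _ => //.
apply: le_Rintegral => //.
- exact: integrable_norm idiff.
- exact: icst.
- by move=> t /=; rewrite in_itv/= => /andP[xt ty]; exact: phid.
Qed.

(** Moving a cut-off is not a multiplicative perturbation; it is differentiated
    as an integral with a moving end. *)
Definition cutoff h y t : R := h t * (t <= y)%R%:R.

Lemma mom_cutoff_diff p h x y : -1 < p -> 0 < x -> x <= y ->
  expdecay (cutoff h x) -> expdecay (cutoff h y) ->
  mu.-integrable `]x, y] (EFin \o (fun t => t `^ p * h t)) /\
  mom p (cutoff h y) - mom p (cutoff h x) = \int[mu]_(t in `]x, y]) (t `^ p * h t).
Proof.
move=> p1 x0 xy dx dy; have y0 : 0 < y by exact: lt_le_trans xy.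
have sub : `]x, y]%classic `<=` Rp.
  by move=> t /=; rewrite !in_itv/= andbT => /andP[xt _]; exact: lt_trans xt.
split.
  have i1 : mu.-integrable `]x, y] (fun t => (t `^ p * cutoff h y t)%:E).
    by apply: (@integrableS _ _ _ mu Rp) => //; exact: expdecay_integrable.
  apply: (@eq_integrable _ _ _ mu `]x, y] _ _ _ _ i1) => // t; rewrite inE/= in_itv/= => /andP[_ ty].
  by rewrite /cutoff ty mulr1.
rewrite -momB// /mom.
rewrite (_ : `]x, y]%classic = Rp `&` `]x, y]%classic); last first.
  by rewrite setIC; apply/esym/setIidl.
rewrite Rintegral_mkcondr; apply: eq_Rintegral => t _.
rewrite /cutoff /patch /=; case: ifPn; rewrite ?inE ?notin_setE /= in_itv/=.
  by move=> /andP[xt ty]; rewrite ty (lt_geF xt) mulr1 mulr0 subr0.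
move=> /negP; rewrite negb_and -!ltNge -!leNgt => /orP[tx|yt].
  by rewrite tx (le_trans tx xy) mulr1 subrr mulr0.
by rewrite (lt_geF yt) (lt_geF (le_lt_trans xy yt)) mulr0 subrr mulr0.
Qed.

Lemma cutoff_derivative p h y (e_ : nat -> R) : -1 < p -> 0 < y ->
  (forall x, expdecay (cutoff h x)) -> {for y, continuous h} ->
  (forall n, 0 < e_ n) -> (forall n, e_ n < y) -> e_ n @[n --> \oo] --> 0 ->
  (mom p (cutoff h (y + e_ n)) - mom p (cutoff h y)) / e_ n @[n --> \oo] --> y `^ p * h y /\
  (mom p (cutoff h (y - e_ n)) - mom p (cutoff h y)) / e_ n @[n --> \oo] --> - (y `^ p * h y).
Proof.
move=> p1 y0 dh ch e0 ey ecv.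
pose phi t := t `^ p * h t.
have cphi : {for y, continuous phi}.
  have cp : {for y, continuous (fun t : R => t `^ p)}.
    apply: differentiable_continuous; apply/derivable1_diffP.
    by apply: derivable_powR; rewrite in_itv/= andbT.
  by apply: (@cvgM _ _ (nbhs y) _ (fun t : R => t `^ p) h).
have key d : 0 < d -> \forall n \near \oo, forall t, `|y - t| <= e_ n -> `|phi t - phi y| <= d.
  move=> d0; move/cvgrPdist_le : cphi => /(_ d d0) /nbhs_ballP[r /= r0 Hr].
  move/cvgrPdist_lt : ecv => /(_ r r0); apply: filterS => n.
  rewrite sub0r normrN gtr0_norm// => er t ty.
  by rewrite distrC; apply: Hr; rewrite /ball/=; exact: le_lt_trans er.
split; apply/cvgrPdist_le => d d0; have := key d d0; apply: filterS => n Hn.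
- have le1 : y <= y + e_ n by rewrite lerDl ltW.
  have [iphi ->] := mom_cutoff_diff p1 y0 le1 (dh _) (dh _).
  have := @interval_average phi y (y + e_ n) (phi y) d y0 le1 iphi.
  rewrite (_ : y + e_ n - y = e_ n); last by ring.
  move=> H; rewrite -(ler_pM2r (e0 n)); apply: (le_trans _ (H _)).
    by rewrite -[X in _ * X](gtr0_norm (e0 n)) -normrM distrC mulrBl divfK ?gt_eqF.
  by move=> t t1 t2; rewrite distrC; rewrite distrC; apply: Hn; rewrite ler0_norm ?subr_le0 ?(ltW t1)// opprB; lra.
- have ye : 0 < y - e_ n by rewrite subr_gt0.
  have le1 : y - e_ n <= y by rewrite gerBl ltW.
  have [iphi E] := mom_cutoff_diff p1 ye le1 (dh _) (dh _).
  have := @interval_average phi (y - e_ n) y (phi y) d ye le1 iphi.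
  rewrite (_ : y - (y - e_ n) = e_ n); last by ring.
  move=> H; rewrite -(ler_pM2r (e0 n)); apply: (le_trans _ (H _)).
    rewrite -[X in _ * X](gtr0_norm (e0 n)) -normrM mulrBl divfK ?gt_eqF//.
    rewrite -E le_eqVlt; apply/orP; left; apply/eqP; congr (`|_|).
    by rewrite /phi; ring.
  by move=> t t1 t2; apply: Hn; rewrite ger0_norm ?subr_ge0//; lra.
Qed.

End FirstVariation.

(** * Zeros of power sums orthogonal to functions supported on an interval *)
Section PowerSumZeros.
Variable R : realType.
Implicit Types (f g u : R -> R) (s t x y z l r e p c B C : R).

Local Notation mu := (@lebesgue_measure R).
Local Notation Rp := (`]0%R, +oo[%classic : set R).

Lemma expdecayZ (k : R) u : expdecay u -> expdecay (fun t => k * u t).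
Proof.
move=> [m1 [B [c [c0 h]]]]; split.
  by apply: measurable_funM => //; exact: measurable_cst.
exists (`|k| * B), c; split => // t t0.
by rewrite normrM -mulrA ler_wpM2l// h.
Qed.

Lemma momZ p (k : R) u : -1 < p -> expdecay u -> mom p (fun t => k * u t) = k * mom p u.
Proof.
move=> p1 du; rewrite /mom -RintegralZl//; last exact: expdecay_integrable.
by apply: eq_Rintegral => t _; ring.
Qed.

Lemma momD p u v : -1 < p -> expdecay u -> expdecay v -> mom p (u \+ v) = mom p u + mom p v.
Proof.
move=> p1 du dv; rewrite /mom -RintegralD//; [|exact: expdecay_integrable|exact: expdecay_integrable].
- by apply: eq_Rintegral => t _; rewrite /= mulrDr.
Qed.

Variables (I : eqType) (s : seq I) (q v : I -> R).
Hypothesis q1 : forall i, i \in s -> -1 < q i.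

Let P t := \sum_(i <- s) v i * t `^ q i.
Let L u := \sum_(i <- s) v i * mom (q i) u.

Lemma functionalD u w : expdecay u -> expdecay w -> L (u \+ w) = L u + L w.
Proof.
move=> du dw; rewrite /L -big_split/= big_seq [RHS]big_seq; apply: eq_bigr => i iS.
by rewrite momD ?q1// mulrDr.
Qed.

Lemma functionalZ k u : expdecay u -> L (fun t => k * u t) = k * L u.
Proof.
move=> du; rewrite /L mulr_sumr big_seq [RHS]big_seq; apply: eq_bigr => i iS.
by rewrite momZ ?q1//; ring.
Qed.

Lemma powsum_continuous t : 0 < t -> {for t, continuous P}.
Proof.
move=> t0; have H : {for t, continuous (expsum s v q \o @ln R)}.
  by apply: continuous_comp; [exact: continuous_ln|exact: continuous_expsum].
have PE : P t = (expsum s v q \o @ln R) t by exact: powsum_expsum.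
rewrite /prop_for /continuous_at PE; apply: cvg_trans H.
apply: near_eq_cvg; near=> y.
have y0 : 0 < y by near: y; exact: lt_nbhsr.
by rewrite /P powsum_expsum.
Unshelve. all: by end_near. Qed.

Lemma powsum_const_sign x (y : \bar R) : 0 <= x -> (x%:E < y)%E ->
  (forall t, x < t -> (t%:E < y)%E -> P t != 0) ->
  exists e, (e = 1 \/ e = -1) /\ forall t, x < t -> (t%:E < y)%E -> 0 < e * P t.
Proof.
move=> x0 xy P0.
have [t0 [xt0 t0y]] : exists t0, x < t0 /\ (t0%:E < y)%E.
  case: y xy {P0} => [y| |] //; last by move=> _; exists (x + 1); rewrite ltry ltrDl.
  by rewrite lte_fin => xy; exists ((x + y) / 2); rewrite lte_fin !midf_lt.
have key t t' : x < t -> t <= t' -> (t'%:E < y)%E -> 0 < P t * P t'.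
  move=> xt tt' t'y; have ty : (t%:E < y)%E by apply: le_lt_trans t'y; rewrite lee_fin.
  have xt' := lt_le_trans xt tt'.
  rewrite lt_def mulf_neq0 ?P0//= leNgt; apply/negP => neg.
  have [||c /andP[]] := @IVT _ P t t' 0 tt'.
  - apply: continuous_in_subspaceT => z; rewrite inE/= in_itv/= => /andP[tz _].
    by apply: powsum_continuous; apply: lt_le_trans tz; exact: le_lt_trans xt.
  - rewrite ge_min le_max; have := P0 t xt ty; rewrite neq_lt => /orP[h|h].
      have h' : 0 < P t' by rewrite -(nmulr_rlt0 _ h).
      by rewrite (ltW h) (ltW h') orbT.
    have h' : P t' < 0 by rewrite -(pmulr_rlt0 _ h).
    by rewrite (ltW h) (ltW h') orbT.
  rewrite !bnd_simp => tc ct' Pc; have /eqP := Pc; apply/negP/P0.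
    exact: lt_le_trans tc.
  by apply: le_lt_trans t'y; rewrite lee_fin.
have e1 : Num.sg (P t0) = 1 \/ Num.sg (P t0) = -1.
  by have := P0 t0 xt0 t0y; rewrite neq_lt => /orP[/ltr0_sg|/gtr0_sg] ->; [right|left].
exists (Num.sg (P t0)); split => // t xt ty.
have : 0 < P t0 * P t.
  by have [h|h] := leP t0 t; [exact: key|rewrite mulrC; apply: key => //; exact: ltW].
rewrite -[X in _ -> 0 < X * _]/(Num.sg (P t0)).
have [h|h|h] := ltrgtP (P t0) 0.
- by rewrite ltr0_sg// mulN1r oppr_gt0 nmulr_rgt0.
- by rewrite gtr0_sg// mul1r pmulr_rgt0.
- by rewrite h mul0r ltxx.
Qed.

(** A function of constant sign with integral [0] vanishes almost everywhere. *)
Lemma signed_integral_absurd u (zs : seq R) e x z : expdecay u -> L u = 0 ->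
  (forall t, 0 < t -> t \notin zs -> 0 <= e * (P t * u t)) ->
  0 <= x -> x < z ->
  (forall t, x < t -> t < z -> t \notin zs -> e * (P t * u t) != 0) -> False.
Proof.
move=> du Lu sgn x0 xz nz.
have [iv vE] := integrable_powsum v q1 du.
have i2 : mu.-integrable Rp (EFin \o (fun t => e * (P t * u t))).
  by have := integrableZl _ e iv; apply.
have [_ Iae] := Rintegral_off_ge0 i2 sgn.
have I0 : \int[mu]_(t in Rp) (e * (P t * u t)) = 0.
  by rewrite RintegralZl// /P vE -/(L u) Lu mulr0.
have ae2 : {ae mu, forall t, Rp t -> t \notin zs} by exact: (ae_off (zs := zs)).
have [t [xt tz [H1 H2]]] := ae_dense
  (P := fun t => e * (P t * u t) = 0 /\ t \notin zs)
  (ae_imply (fun t (h : (Rp t -> e * (P t * u t) = 0) /\ (Rp t -> t \notin zs)) =>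
     fun Rt => conj (h.1 Rt) (h.2 Rt)) (ae_and (Iae I0) ae2)) x0 xz.
by have := nz t xt tz H2; rewrite H1 eqxx.
Qed.

Section Piece.
Variables (u : R -> R) (x : R) (y : \bar R) (zs : seq R).
Hypotheses (x0 : 0 <= x) (xy : (x%:E < y)%E) (du : expdecay u) (Lu : L u = 0).
Hypothesis upos : forall t, 0 < t -> t \notin zs -> x < t -> (t%:E < y)%E -> 0 < u t.
Hypothesis uzero : forall t, 0 < t -> t \notin zs -> ~ (x < t /\ (t%:E < y)%E) -> u t = 0.

(** [L u] is the integral of [P u]; with [u > 0] on the interval only, [P] cannot
    keep a strict sign there. *)
Lemma zero_in_piece : exists z, [/\ x < z, (z%:E < y)%E & P z = 0].
Proof.
apply: contrapT => H.
have [|e [e1 He]] := powsum_const_sign x0 xy.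
  by move=> t xt ty; apply/negP => /eqP Pt; apply: H; exists t.
have [z xz zy] : exists2 z, x < z & (z%:E <= y)%E.
  case: y xy => [y'| |] //; last by move=> _; exists (x + 1); rewrite ?leey ?ltrDl.
  by rewrite lte_fin => xy'; exists y'.
have pos t : x < t -> (t%:E < y)%E -> t \notin zs -> 0 < e * (P t * u t).
  move=> xt ty tz; rewrite mulrA mulr_gt0 ?He//; apply: upos => //.
  exact: le_lt_trans xt.
apply: (@signed_integral_absurd u zs e x z du Lu _ x0 xz).
- move=> t t0 tz; have [[xt ty]|nJ] := pselect (x < t /\ (t%:E < y)%E).
    by rewrite ltW// pos.
  by rewrite uzero// !mulr0.
- move=> t xt tz tzs; rewrite gt_eqF// pos//.
  by apply: lt_le_trans zy; rewrite lte_fin.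
Qed.

Variable u1 : R -> R.
Hypotheses (du1 : expdecay u1) (Lu1 : L u1 = 0).
Hypothesis u1E : forall t, 0 < t -> t \notin zs -> u1 t = (t - x) * u t.

(** If [z1] were the only zero, [P] would have constant signs on both sides of it.
    Equal signs contradict [L u = 0]; opposite signs contradict the vanishing of
    [L] on (t - z1) u, which is a combination of [u1] and [u]. *)
Lemma two_zeros_in_piece : exists z1 z2,
  [/\ x < z1, z1 < z2, (z2%:E < y)%E, P z1 = 0 & P z2 = 0].
Proof.
have [z1 [xz1 z1y Pz1]] := zero_in_piece.
apply: contrapT => H.
have z10 : 0 <= z1 by exact: le_trans (ltW xz1).
have n1 t : x < t -> (t%:E < z1%:E)%E -> P t != 0.
  rewrite lte_fin => xt tz; apply/negP => /eqP Pt; apply: H.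
  by exists t, z1; split.
have n2 t : z1 < t -> (t%:E < y)%E -> P t != 0.
  by move=> z1t ty; apply/negP => /eqP Pt; apply: H; exists z1, t; split.
have xz1' : (x%:E < z1%:E)%E by rewrite lte_fin.
have [e1 [e1P s1]] := powsum_const_sign x0 xz1' n1.
have [e2 [e2P s2]] := powsum_const_sign z10 z1y n2.
have ut t : x < t -> t < z1 -> t \notin z1 :: zs -> 0 < u t.
  move=> xt tz; rewrite inE negb_or => /andP[_ tzs]; apply: upos => //.
    exact: le_lt_trans xt.
  by apply: lt_trans z1y; rewrite lte_fin.
have [E|E] : e2 = e1 \/ e2 = - e1.
  by case: e1P => ->; case: e2P => ->; rewrite ?opprK; [left|right|right|left].
- apply: (@signed_integral_absurd u (z1 :: zs) e1 x z1 du Lu _ x0 xz1).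
    move=> t t0; rewrite inE negb_or => /andP[tz1 tz].
    have [[xt ty]|nJ] := pselect (x < t /\ (t%:E < y)%E); last by rewrite uzero// !mulr0.
    rewrite mulrA mulr_ge0//; last by rewrite ltW// upos.
    have [tlt|tgt|/eqP] := ltrgtP t z1; last by rewrite (negbTE tz1).
      by rewrite ltW// s1.
    by rewrite -E ltW// s2.
  move=> t xt tz tzs; rewrite gt_eqF// mulrA mulr_gt0 ?ut//.
  by apply: s1.
pose w := u1 \+ (fun t => (x - z1) * u t).
have dw : expdecay w by apply: expdecayD => //; exact: expdecayZ.
have Lw : L w = 0.
  by rewrite /w functionalD//; [rewrite functionalZ// Lu Lu1 mulr0 addr0|exact: expdecayZ].
have wE t : 0 < t -> t \notin z1 :: zs -> w t = (t - z1) * u t.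
  move=> t0; rewrite inE negb_or => /andP[_ tzs].
  by rewrite /w /= u1E//; ring.
apply: (@signed_integral_absurd w (z1 :: zs) e2 x z1 dw Lw _ x0 xz1).
  move=> t t0 tzz; rewrite wE//; move: tzz; rewrite inE negb_or => /andP[tz1 tz].
  have [[xt ty]|nJ] := pselect (x < t /\ (t%:E < y)%E); last by rewrite uzero// !mulr0.
  have u0 : 0 <= u t by rewrite ltW// upos.
  have [tlt|tgt|/eqP] := ltrgtP t z1; last by rewrite (negbTE tz1).
    have := s1 t xt; rewrite lte_fin => /(_ tlt) h.
    have -> : e2 * (P t * ((t - z1) * u t)) = (e1 * P t) * ((z1 - t) * u t).
      by rewrite E; ring.
    by rewrite mulr_ge0 ?(ltW h)// mulr_ge0// subr_ge0 ltW.
  have h := s2 t tgt ty.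
  by rewrite mulrA mulr_ge0 ?(ltW h)// mulr_ge0// subr_ge0 ltW.
move=> t xt tz tzs; rewrite wE//; last exact: le_lt_trans xt.
have u0 := ut t xt tz tzs.
have := s1 t xt; rewrite lte_fin => /(_ tz) h.
have -> : e2 * (P t * ((t - z1) * u t)) = (e1 * P t) * ((z1 - t) * u t).
  by rewrite E; ring.
by rewrite gt_eqF// mulr_gt0// mulr_gt0// subr_gt0.
Qed.

End Piece.

(** Two zeros in each of the [k] pieces, with the exception of a first piece that
    starts at the origin. *)
Lemma collect_zeros (b : nat -> \bar R) (pin0 : bool) k :
  (forall i, (0 <= b i)%E) ->
  (forall i, (i < k)%N -> (b i < b i.+1)%E) ->
  ((0 < k)%N -> pin0 -> exists z, [/\ (b 0%N < z%:E)%E, (z%:E < b 1%N)%E & P z = 0]) ->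
  (forall i, (i < k)%N -> ~~ (pin0 && (i == 0%N)) -> exists z1 z2,
    [/\ (b i < z1%:E)%E, z1 < z2, (z2%:E < b i.+1)%E, P z1 = 0 & P z2 = 0]) ->
  exists zs : seq R, [/\ uniq zs, size zs = (k.*2 - (pin0 && (0 < k)%N))%N &
    forall z, z \in zs -> [/\ 0 < z, (z%:E < b k)%E & P z = 0]].
Proof.
move=> b0; elim: k => [|k IH] binc h0 h2.
  by exists [::]; split => //; rewrite andbF.
have [|||zs [uzs szs zsP]] := IH.
- by move=> i ik; apply: binc; exact: ltnW.
- by move=> k0; exact: h0.
- by move=> i ik; apply: h2; exact: ltnW.
have bk z : (b k < z%:E)%E -> 0 < z by move=> /(le_lt_trans (b0 k)); rewrite lte_fin.
have new z : (b k < z%:E)%E -> z \notin zs.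
  by move=> bz; apply/negP => /zsP[_ zb _]; move: bz; rewrite ltNge (ltW zb).
have old z : z \in zs -> [/\ 0 < z, (z%:E < b k.+1)%E & P z = 0].
  by move=> /zsP[z0 zb Pz]; split => //; apply: lt_trans zb _; exact: binc.
have [/andP[p0 /eqP k0]|np] := boolP (pin0 && (k == 0%N)).
  have [z [bz zb Pz]] := h0 isT p0; rewrite k0 in zsP szs new bk old *.
  exists [:: z]; split => //; first by rewrite p0.
  by move=> w; rewrite inE => /eqP ->; split => //; exact: bk.
have [z1 [z2 [bz1 z12 zb2 P1 P2]]] := h2 k (leqnn _) np.
have bz2 : (b k < z2%:E)%E by apply: lt_trans bz1 _; rewrite lte_fin.
exists (z1 :: z2 :: zs); split.
- by rewrite /= inE negb_or (new z1)// (new z2)// uzs (lt_eqF z12).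
- rewrite /= szs; move: np; case: (pin0) => //=; case: (k) => //= *; rewrite ?doubleS; lia.
- move=> z; rewrite !inE => /or3P[/eqP->|/eqP->|/old//]; split => //.
  + exact: bk.
  + by apply: lt_trans zb2; rewrite lte_fin.
  + exact: bk.
Qed.

Lemma many_zeros_eq0 (zs : seq R) : uniq s -> {in s &, injective q} -> uniq zs ->
  (size s <= size zs)%N -> (forall z, z \in zs -> 0 < z /\ P z = 0) ->
  forall i, i \in s -> v i = 0.
Proof.
move=> us qi uzs sz zsP.
apply: (@expsum_roots_eq0 _ _ s v q [seq ln z | z <- zs]) => //.
- rewrite map_inj_in_uniq// => z1 z2 /zsP[z10 _] /zsP[z20 _].
  by move/ln_inj; rewrite !posrE; apply.
- by rewrite size_map.
- by move=> _ /mapP[z /zsP[z0 Pz] ->]; rewrite -powsum_expsum.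
Qed.

End PowerSumZeros.

(** * Stationary simple functions have the prescribed moments *)
Section Stationary.
Variable R : realType.
Implicit Types (f g u : R -> R) (s t x y z l r e p c B C : R).

Local Notation mu := (@lebesgue_measure R).
Local Notation Rp := (`]0%R, +oo[%classic : set R).

Lemma expdecayM g (w : R -> R) C : expdecay g -> measurable_fun Rp w ->
  (forall t, 0 < t -> `|w t| <= C * (1 + t)) -> expdecay (fun t => g t * w t).
Proof.
move=> [mg [B [c [c0 gB]]]] mw wC; split; first exact: measurable_funM.
exists (B * (C * (2 / c) * expR (c / 2))), (c / 2); split; first by rewrite divr_gt0.
move=> t t0; have t1 : 0 < 1 + t by rewrite addr_gt0.
have C0 : 0 <= C.
  by have := le_trans (normr_ge0 _) (wC t t0); rewrite pmulr_lge0.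
have h5 : 1 + t <= 2 / c * expR (c / 2 * (1 + t)).
  have h := expR_ge1Dx (c / 2 * (1 + t)).
  have c4 : 0 <= 2 / c by rewrite divr_ge0// ltW.
  have := ler_wpM2l c4 h; apply: le_trans.
  rewrite mulrDr mulr1 mulrA (_ : 2 / c * (c / 2) = 1); last by field; rewrite gt_eqF.
  by rewrite mul1r lerDr.
rewrite normrM; apply: (@le_trans _ _ (B * expR (- (c * t)) * (C * (2 / c * expR (c / 2 * (1 + t)))))).
  apply: ler_pM => //; first exact: gB.
  by apply: le_trans (wC t t0) _; rewrite ler_wpM2l.
rewrite le_eqVlt; apply/orP; left; apply/eqP.
have -> : expR (- (c / 2 * t)) = expR (- (c * t)) * expR (c / 2 * (1 + t)) * expR (- (c / 2)).
  by rewrite -!expRD; congr expR; field.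
have : expR (c / 2) * expR (- (c / 2)) = 1 by rewrite expRxMexpNx_1.
move: (expR (c / 2)) (expR (- (c / 2))) => X Y XY.
rewrite -[LHS]mulr1 -XY; ring.
Qed.

Lemma eq_mom p u (w : R -> R) : (forall t, 0 < t -> u t = w t) -> mom p u = mom p w.
Proof.
move=> H; apply: eq_Rintegral => t; rewrite inE/= in_itv/= andbT => t0.
by rewrite H.
Qed.

Lemma eq_expdecay u (w : R -> R) : (forall t, 0 < t -> u t = w t) -> expdecay u -> expdecay w.
Proof.
move=> H [m1 [B [c [c0 h]]]]; split; last first.
  by exists B, c; split => // t t0; rewrite -H// h.
apply: eq_measurable_fun m1 => t; rewrite inE/= in_itv/= andbT => t0; exact: H.
Qed.

Lemma step_sequence (e0 : R) : 0 < e0 -> exists e_ : nat -> R,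
  [/\ forall n, 0 < e_ n, forall n, e_ n <= e0 & e_ n @[n --> \oo] --> 0].
Proof.
move=> h; exists (fun n => e0 * n.+1%:R^-1); split.
- by move=> n; rewrite mulr_gt0// invr_gt0.
- by move=> n; rewrite ler_piMr ?(ltW h)// invf_le1 ?ler1n.
- rewrite -(mulr0 e0); apply: cvgM; first exact: cvg_cst.
  exact: cvg_harmonic.
Qed.

Variables (K : nat) (pin0 pinC : bool) (a b : nat -> \bar R).
Hypotheses (pin : pinned K pin0 pinC a b) (gen : generic_nodes K pin0 pinC a b).
Hypothesis b_end : forall j, (K <= j)%N -> b j = +oo%E.
Variables (I : eqType) (s : seq I) (q m : I -> R).
Hypotheses (us : uniq s) (qi : {in s &, injective q}) (q1 : forall i, i \in s -> -1 < q i).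
Hypothesis n0 : (0 < K.*2 - pin0 - pinC)%N.
Let g := simple K a b.
Hypothesis dg : expdecay g.
Hypothesis gmin : forall a' b', pinned K pin0 pinC a' b' -> expdecay (simple K a' b') ->
  discrepancy s q m g <= discrepancy s q m (simple K a' b').

Let v i := mom (q i) g - m i.
Let L u := \sum_(i <- s) v i * mom (q i) u.

Let K0 : (0 < K)%N.
Proof. by move: n0; case: (K). Qed.

Let beta j := fine (b j).
Let rate j := fine (a j).

Let bE j : (j < K)%N -> b j = (beta j)%:E.
Proof.
have [[_ b0 _] _ _] := pin; have [_ _ _ _ bf] := gen => jK.
by rewrite fineK// ge0_fin_numE ?b0// bf.
Qed.

Let free j := (j < K)%N && ~~ (pinC && (j == K.-1)).

Let aE j : free j -> a j = (rate j)%:E.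
Proof.
have [[a0 _ _] _ _] := pin; have [_ af _ _ _] := gen => /andP[jK jf].
by rewrite fineK// ge0_fin_numE ?a0// af.
Qed.

Let rate_gt0 j : free j -> 0 < rate j.
Proof.
by move=> fj; have [ap _ _ _ _] := gen; rewrite -lte_fin -aE// ap//; case/andP: fj.
Qed.

Let beta_ge0 j : (j < K)%N -> 0 <= beta j.
Proof. by have [[_ b0 _] _ _] := pin => jK; rewrite -lee_fin -bE. Qed.

Let g_bound : exists B c, 0 < c /\ forall t, 0 < t -> 0 <= g t <= B * expR (- (c * t)).
Proof.
have [_ [B [c [c0 h]]]] := dg; exists B, c; split => // t t0.
have := h t t0; rewrite ger0_norm => [->|]; rewrite simple_ge0//.
Qed.

(** Perturbations g exp (- W sg e), with W sg e of order sg e w for both signs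
    [sg], stay in the parameter domain; minimality applied to both of them
    annihilates the linear form [L] at [g w]. *)
Let multiplier_variation (w : R -> R) (zs : seq R) C e0 (A' B' : R -> R -> nat -> \bar R)
    (W : R -> R -> R -> R) :
  measurable_fun Rp w -> 0 < C -> 0 < e0 ->
  (forall t, 0 < t -> `|w t| <= C * (1 + t)) ->
  (forall sg e, sg = 1 \/ sg = -1 -> 0 < e -> e <= e0 ->
     [/\ pinned K pin0 pinC (A' sg e) (B' sg e),
      (forall t, 0 < t -> simple K (A' sg e) (B' sg e) t = g t * expR (- W sg e t)) &
      forall t, 0 < t -> `|W sg e t| <= e * (C * (1 + t))]) ->
  (forall sg (e_ : nat -> R) t, sg = 1 \/ sg = -1 -> (forall n, 0 < e_ n) ->
     (forall n, e_ n <= e0) -> e_ n @[n --> \oo] --> 0 ->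
     0 < t -> t \notin zs -> W sg (e_ n) t / e_ n @[n --> \oo] --> sg * w t) ->
  L (fun t => g t * w t) = 0.
Proof.
move=> mw C0 e00 wC fam Wcv.
have [B [c [c0 gB]]] := g_bound.
have dgw : expdecay (fun t => g t * w t) by exact: expdecayM dg mw wC.
(* small enough for exp (- W) to cost at most a fraction of the decay of [g] *)
pose e1 := Num.min e0 (c / (4 * C)).
have e10 : 0 < e1 by rewrite lt_min e00 divr_gt0// mulr_gt0.
have [e_ [e_gt0 e_le e_cv]] := step_sequence e10.
have e_le0 n : e_ n <= e0 by rewrite (le_trans (e_le n))// ge_min lexx.
have half sg : sg = 1 \/ sg = -1 -> 0 <= - sg * L (fun t => g t * w t).
  move=> sgP; pose g_ n := simple K (A' sg (e_ n)) (B' sg (e_ n)).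
  have F n := fam sg (e_ n) sgP (e_gt0 n) (e_le0 n).
  have mg_ n : measurable_fun Rp (g_ n).
    by apply: halfLC_measurable; apply: simple_halfLC; have [[? _ _] _ _] := F n.
  have mg : measurable_fun Rp g by case: dg.
  have der p : -1 < p ->
     (mom p (g_ n) - mom p g) / e_ n @[n --> \oo] --> mom p (fun t => - (g t * (sg * w t))) /\
     forall n, expdecay (g_ n).
    move=> p1; apply: (moment_derivative (w_ := fun n => W sg (e_ n)) (zs := zs) (B := B) (c := c) (C := C)) => //.
    - by apply: measurable_funM => //; exact: measurable_cst.
    - by move=> n t t0; have [_ H _] := F n; exact: H.
    - move=> n; rewrite (@le_trans _ _ (c / (4 * C) * C))//.
        by rewrite ler_wpM2r ?(ltW C0)// (le_trans (e_le n))// ge_min lexx orbT.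
      by rewrite le_eqVlt; apply/orP; left; apply/eqP; field; rewrite gt_eqF.
    - by move=> n t t0; have [_ _ H] := F n; exact: H.
    - by move=> t t0 tz; exact: Wcv.
  have dg_ n : expdecay (g_ n).
    by have [_] := der 0 ltac:(lra); exact.
  have := first_variation (s := s) (q := q) (m := m) (g := g) (g_ := g_) (e_ := e_)
    (D := fun i => mom (q i) (fun t => - (g t * (sg * w t)))).
  move=> /(_ _ e_gt0 e_cv _); rewrite -functionalZ//.
  have EE : (fun t => - (g t * (sg * w t))) = (fun t => - sg * (g t * w t)).
    by apply/funext => t; ring.
  rewrite EE; apply; first by move=> n; have [h1 _ _] := F n; exact: (gmin h1 (dg_ n)).
  by move=> i iS; have [+ _] := der (q i) (q1 iS); rewrite EE.
have h1 := half 1 (or_introl erefl); have h2 := half (-1) (or_intror erefl).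
by apply/eqP; rewrite eq_le; apply/andP; split; lra.
Qed.

Let simple_upd k (A' B' : nat -> \bar R) i t :
  (i < k)%N -> (forall j, j <> i -> A' j = a j /\ B' j = b j) ->
  simple k A' B' t * kink (a i) (b i) t = simple k a b t * kink (A' i) (B' i) t.
Proof.
move=> ik H; rewrite /simple (bigD1 (Ordinal ik))//= [in RHS](bigD1 (Ordinal ik))//=.
rewrite (eq_bigr (fun j : 'I_k => kink (a j) (b j) t)); first by ring.
move=> j /eqP ji; have [|-> ->//] := H j.
by move=> E; apply: ji; apply/val_inj.
Qed.

(** Derivative with respect to the slope a_i. *)
Lemma slope_stationary i : free i -> L (fun t => g t * Num.max (t - beta i) 0) = 0.
Proof.
move=> fi; have /andP[iK nf] := fi; have [[a0 b0 bm] p0 pC] := pin.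
have mw : measurable_fun Rp (fun t => Num.max (t - beta i) 0).
  apply: measurable_maxr; last exact: measurable_cst.
  by apply: measurable_funB; [exact: measurable_id|exact: measurable_cst].
have wb t : 0 < t -> `|Num.max (t - beta i) 0| <= 1 * (1 + t).
  move=> t0; rewrite mul1r ger0_norm; last by rewrite le_max lexx orbT.
  by rewrite ge_max; have h := beta_ge0 iK; apply/andP; split; lra.
apply: (@multiplier_variation _ [::] 1 (rate i)
  (fun sg e j => if j == i then (rate i + sg * e)%:E else a j) (fun _ _ => b)
  (fun sg e t => sg * e * Num.max (t - beta i) 0)) => //.
- exact: rate_gt0.
- move=> sg e sgP e0 er; split.
  + split; [split => //| |].
    * move=> j; case: eqP => // _; rewrite lee_fin; case: sgP => ->; lra.
    * exact: p0.
    * move=> h; rewrite (_ : K.-1 == i = false) ?pC//.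
      by apply/negP => /eqP E; move: nf; rewrite h E eqxx.
  + move=> t t0; set A' := (X in simple K X _).
    have k0 : kink (a i) (b i) t != 0 by rewrite aE// bE// kink_fin gt_eqF// expR_gt0.
    apply: (mulIf k0); rewrite (@simple_upd K A' b i)//.
      rewrite /A' eqxx -(mulrA (g t)) aE// bE// !kink_fin; congr (_ * _).
      by rewrite -expRD ger0_norm ?(ltW t0)//; congr expR; ring.
    by move=> j /eqP/negbTE ji; rewrite /A' ji.
  + move=> t t0; rewrite normrM ler_pM//; last exact: wb.
    by case: sgP => ->; rewrite ?mulN1r ?mul1r ?normrN gtr0_norm.
- move=> sg e_ t sgP e_gt0 _ _ t0 _; apply: cvg_near_cst; apply: nearW => n.
  by field; rewrite gt_eqF.
Qed.

(** Room to move the node [i] without meeting its neighbours. *)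
Let gap i : (i < K)%N -> ~~ (pin0 && (i == 0%N)) -> exists e0, [/\ 0 < e0,
  0 <= beta i - e0, forall j, (j < i)%N -> (b j <= (beta i - e0)%:E)%E &
  forall j, (i < j)%N -> ((beta i + e0)%:E <= b j)%E].
Proof.
move=> iK np; have [[_ b0 bm] _ _] := pin; have [_ _ bi b00 _] := gen.
pose d1 := if i is i'.+1 then beta i - beta i' else beta i.
pose d2 := if (i.+1 < K)%N then beta i.+1 - beta i else 1.
have d10 : 0 < d1.
  rewrite /d1; case: (i) iK np => [|i'] iK np.
    by rewrite -lte_fin -bE// b00// -(andbT pin0).
  by rewrite subr_gt0 -lte_fin -!bE ?bi// ltnW.
have d20 : 0 < d2.
  rewrite /d2; case: ifP => // iK1.
  by rewrite subr_gt0 -lte_fin -!bE ?bi.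
have d1b : d1 <= beta i.
  rewrite /d1; case: (i) iK => [|i'] iK //.
  by rewrite gerBl beta_ge0// ltnW.
exists (Num.min d1 d2); split.
- by rewrite lt_min d10.
- by rewrite subr_ge0 (le_trans _ d1b)// ge_min lexx.
- move=> j ji; case: i iK np @d1 @d2 d10 d20 d1b ji => [//|i'] iK np d1 d2 d10 d20 d1b.
  rewrite ltnS => ji; apply: le_trans (bm _ _ ji) _; rewrite bE ?(ltnW iK)// lee_fin.
  by rewrite lerBrDr -lerBrDl ge_min /d1 lexx.
- move=> j ij; apply: le_trans (bm _ _ ij).
  have [iK1|iK1] := ltnP i.+1 K; last by rewrite b_end// leey.
  by rewrite bE// lee_fin -lerBrDl ge_min /d2 iK1 lexx orbT.
Qed.

(** Derivative with respect to the node b_i, divided by - a_i. *)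
Lemma node_stationary i : free i -> ~~ (pin0 && (i == 0%N)) ->
  L (fun t => g t * (beta i < t)%R%:R) = 0.
Proof.
move=> fi np; have /andP[iK nf] := fi; have [[a0 b0 bm] p0 pC] := pin.
have [e0 [e00 be0 lo hi]] := gap iK np.
have r0 := rate_gt0 fi.
have mw : measurable_fun Rp (fun t => (beta i < t)%R%:R : R).
  rewrite (_ : (fun t => _) = \1_(`]beta i, +oo[%classic)); first exact: measurable_indic.
  by apply/funext => t; rewrite indicE mem_setE in_itv/= andbT.
have dgc : expdecay (fun t => g t * (beta i < t)%R%:R).
  apply: (expdecayM (C := 1) dg mw) => t t0; rewrite mul1r.
  by case: (beta i < t); rewrite ?normr1 ?normr0; lra.
suff : L (fun t => g t * (- rate i * (beta i < t)%R%:R)) = 0.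
  have -> : (fun t => g t * (- rate i * (beta i < t)%R%:R)) =
     (fun t => - rate i * (g t * (beta i < t)%R%:R)) by apply/funext => t; ring.
  rewrite /L functionalZ// => /eqP; rewrite mulf_eq0 oppr_eq0 gt_eqF//= => /eqP.
  by [].
apply: (@multiplier_variation _ [:: beta i] (rate i) e0 (fun _ _ => a)
  (fun sg e j => if j == i then (beta i + sg * e)%:E else b j)
  (fun sg e t => rate i * (Num.max (t - (beta i + sg * e)) 0 - Num.max (t - beta i) 0))) => //.
- by apply: measurable_funM => //; exact: measurable_cst.
- move=> t t0; rewrite normrM normrN (gtr0_norm r0) ler_wpM2l ?(ltW r0)//.
  by case: (beta i < t); rewrite ?normr1 ?normr0; lra.
- move=> sg e sgP e_gt0 ee.
  have se : - e0 <= sg * e <= e0 by case: sgP => ->; apply/andP; split; lra.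
  have /andP[se1 se2] := se.
  split.
  + split; [split => //| |].
    * by move=> j; case: eqP => // _; rewrite lee_fin; lra.
    * move=> j k; rewrite leq_eqVlt => /orP[/eqP->//|jk].
      case: (j =P i) => [ji|ji]; case: (k =P i) => [ki|ki].
      - by rewrite ji ki ltnn in jk.
      - apply: le_trans (hi k _); last by rewrite -ji.
        by rewrite lee_fin; lra.
      - apply: le_trans (lo j _) _; first by rewrite -ki.
        by rewrite lee_fin; lra.
      - by apply: bm; exact: ltnW.
    * move=> h; rewrite (_ : 0%N == i = false) ?p0//.
      by apply/negP => /eqP E; move: np; rewrite h -E eqxx.
    * exact: pC.
  + move=> t t0; set B' := (X in simple K _ X).
    have k0 : kink (a i) (b i) t != 0 by rewrite aE// bE// kink_fin gt_eqF// expR_gt0.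
    apply: (mulIf k0); rewrite (@simple_upd K a B' i)//.
      rewrite /B' eqxx -(mulrA (g t)) aE// bE// !kink_fin; congr (_ * _).
      by rewrite -expRD ger0_norm ?(ltW t0)//; congr expR; ring.
    by move=> j /eqP/negbTE ji; rewrite /B' ji.
  + move=> t t0; rewrite normrM (gtr0_norm r0) mulrCA ler_wpM2l ?(ltW r0)//.
    apply: (@le_trans _ _ e); last by rewrite ler_pMr//; lra.
    have se' : `|sg * e| = e.
      by case: sgP => ->; rewrite ?mulN1r ?mul1r ?normrN gtr0_norm.
    rewrite -[X in _ <= X]se'; set x := sg * e.
    rewrite (_ : t - (beta i + x) = (t - beta i) - x); last by ring.
    have := ler_norm x; have := ler_norm (- x); rewrite normrN => h1 h2.
    rewrite ler_norml; apply/andP; split.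
      rewrite -subr_ge0; case: (lerP (t - beta i - x) 0) => h3; case: (lerP (t - beta i) 0) => h4; lra.
    rewrite -subr_ge0; case: (lerP (t - beta i - x) 0) => h3; case: (lerP (t - beta i) 0) => h4; lra.
- move=> sg e_ t sgP e_gt0 _ e_cv t0; rewrite inE => tb.
  apply: cvg_near_cst.
  have d0 : 0 < `|t - beta i| by rewrite normr_gt0 subr_eq0.
  move/cvgrPdist_lt : e_cv => /(_ _ d0); apply: filterS => n.
  rewrite sub0r normrN gtr0_norm// => en; have := e_gt0 n => en0.
  have [h|h|/eqP] := ltrgtP t (beta i); last by rewrite (negbTE tb).
    have nn : `|t - beta i| = beta i - t by rewrite ltr0_norm ?subr_lt0// opprB.
    rewrite nn in en; rewrite !max_r; [by rewrite subrr !mulr0 mul0r| |].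
      by lra.
    by case: sgP => ->; lra.
  have nn : `|t - beta i| = t - beta i by rewrite gtr0_norm ?subr_gt0.
  rewrite nn in en; rewrite !max_l; [by rewrite ?mulr1; field; rewrite gt_eqF| |].
    by lra.
  by case: sgP => ->; lra.
Qed.

Let P t := \sum_(i <- s) v i * t `^ q i.

Lemma cutoff_expdecay (h : R -> R) x : halfLC h -> expdecay (cutoff h x).
Proof.
move=> hh; split.
  apply: measurable_funM; first exact: halfLC_measurable.
  rewrite (_ : (fun t : R => (t <= x)%R%:R : R) = \1_(`]-oo, x]%classic)); first exact: measurable_indic.
  by apply/funext => t; rewrite indicE mem_setE in_itv.
exists (expR x), 1; split => // t t0; rewrite /cutoff normrM mul1r -expRD.
have h0 := halfLC_ge0 hh (ltW t0); have h1 := halfLC_le1 hh (ltW t0).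
rewrite (ger0_norm h0); have [tx|tx] := leP t x; last by rewrite normr0 mulr0 expR_ge0.
by rewrite normr1 mulr1 (le_trans h1)// -expR0 ler_expR subr_ge0.
Qed.

(** Moving the cut-off [y] changes the moment of order [q] at the rate
    y^q h(y), where [h > 0] is the product of the other kinks. *)
Lemma cutoff_stationary : pinC -> P (beta K.-1) = 0.
Proof.
move=> hC; have [[a0 b0 bm] p0 pC] := pin; have [ap af bi b00 bf] := gen.
have KE : K = K.-1.+1 by rewrite prednK.
have K1 : (K.-1 < K)%N by rewrite {2}KE.
pose h := simple K.-1 a b; pose y := beta K.-1.
have y0 : 0 < y.
  rewrite -lte_fin -bE//; have [k0|k0] := posnP K.-1.
    rewrite k0 b00//; apply/negP => hp; move: n0; rewrite hp hC KE k0; lia.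
  have E : K.-1 = K.-1.-1.+1 by rewrite prednK.
  by rewrite E; apply: le_lt_trans (b0 _) (bi _ _); rewrite -E.
have hh : halfLC h by apply: simple_halfLC; split.
have b_lt j : (j < K.-1)%N -> (b j < y%:E)%E.
  move=> jK; have E : K.-1 = K.-1.-1.+1 by rewrite prednK//; case: (K.-1) jK.
  rewrite -bE// [X in (_ < b X)%E]E; apply: (@le_lt_trans _ _ (b K.-1.-1)).
    by apply: bm; rewrite -ltnS -E.
  by apply: bi; rewrite -E.
have ch : {for y, continuous h}.
  apply: simple_cvg => j jK; apply: kink_continuous => // E.
  by have := b_lt j jK; rewrite E ltxx.
have hy : 0 < h y.
  rewrite /h /simple; apply: prodr_gt0 => j _.
  have jK : (j < K)%N by apply: leq_trans (ltn_ord j) _; exact: leq_pred.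
  rewrite aE ?bE// ?kink_fin ?expR_gt0//.
  by rewrite /free jK hC/= neq_ltn ltn_ord.
have gE x t : 0 < t -> simple K a (fun j => if j == K.-1 then x%:E else b j) t = cutoff h x t.
  move=> t0; rewrite /simple KE big_ord_recr/= eqxx pC// kink_cut ger0_norm ?(ltW t0)//.
  rewrite /cutoff /h /simple; congr (_ * _); apply: eq_bigr => j _.
  by rewrite (ltn_eqF (ltn_ord j)).
have np : ~~ (pin0 && (K.-1 == 0%N)).
  by apply/negP => /andP[hp /eqP k0]; move: n0; rewrite hp hC KE k0; lia.
have [e0 [e00 be0 lo hi]] := gap K1 np.
pose e1 := Num.min e0 (y / 2).
have e10 : 0 < e1 by rewrite lt_min e00 divr_gt0.
have [e_ [e_gt0 e_le e_cv]] := step_sequence e10.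
have e_y n : e_ n < y.
  apply: (le_lt_trans (e_le n)); rewrite gt_min; apply/orP; right; lra.
have e_e0 n : e_ n <= e0 by rewrite (le_trans (e_le n))// ge_min lexx.
have pinned_upd x : y - e0 <= x -> x <= y + e0 ->
    pinned K pin0 pinC a (fun j => if j == K.-1 then x%:E else b j).
  move=> x1 x2; split; [split => //| |exact: pC].
  - by move=> j; case: eqP => // _; rewrite lee_fin (le_trans be0).
  - move=> j k; rewrite leq_eqVlt => /orP[/eqP->//|jk].
    case: (j =P K.-1) => [ji|ji]; case: (k =P K.-1) => [ki|ki].
    + by rewrite ji ki ltnn in jk.
    + by apply: le_trans (hi k _); [rewrite lee_fin|rewrite -ji].
    + by apply: le_trans (lo j _) _; [rewrite -ki|rewrite lee_fin].
    + by apply: bm; exact: ltnW.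
  - move=> hp; rewrite (_ : 0%N == K.-1 = false) ?p0//.
    by apply/negP => /eqP E; move: np; rewrite hp -E eqxx.
have momg p : mom p g = mom p (cutoff h y).
  apply: eq_mom => t t0; rewrite -gE//; apply: eq_bigr => j _; case: eqP => // ->.
  by rewrite bE.
have half (x : nat -> R) (D : I -> R) : (forall n, y - e0 <= x n <= y + e0) ->
    (forall i, i \in s -> (mom (q i) (cutoff h (x n)) - mom (q i) (cutoff h y)) / e_ n @[n --> \oo] --> D i) ->
    0 <= \sum_(i <- s) v i * D i.
  move=> xP xD; apply: (first_variation (g_ := fun n => cutoff h (x n)) (e_ := e_)) => //.
    move=> n; have /andP[x1 x2] := xP n.
    have E t : 0 < t -> simple K a (fun j => if j == K.-1 then (x n)%:E else b j) t = cutoff h (x n) t.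
      exact: gE.
    have dE : expdecay (simple K a (fun j => if j == K.-1 then (x n)%:E else b j)).
      by apply: eq_expdecay (cutoff_expdecay (x n) hh) => t t0; rewrite E.
    have := gmin (pinned_upd _ x1 x2) dE.
    rewrite /discrepancy; congr (_ <= _); apply: eq_bigr => i _.
    by rewrite (eq_mom _ E).
  by move=> i iS; rewrite momg; exact: xD.
have der i (iS : i \in s) := cutoff_derivative (q1 iS) y0 (fun x => cutoff_expdecay x hh) ch e_gt0 e_y e_cv.
have h1 : 0 <= \sum_(i <- s) v i * (y `^ q i * h y).
  apply: (half (fun n => y + e_ n)) => [n|i iS]; last by have [] := der i iS.
  by have := e_gt0 n; have := e_e0 n => A B; apply/andP; split; lra.
have h2 : 0 <= \sum_(i <- s) v i * - (y `^ q i * h y).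
  apply: (half (fun n => y - e_ n)) => [n|i iS]; last by have [] := der i iS.
  by have := e_gt0 n; have := e_e0 n => A B; apply/andP; split; lra.
have E : \sum_(i <- s) v i * (y `^ q i * h y) = P y * h y.
  by rewrite /P mulr_suml; apply: eq_bigr => i _; rewrite mulrA.
rewrite (eq_bigr (fun i => - (v i * (y `^ q i * h y)))) in h2; last by move=> i _; rewrite mulrN.
rewrite sumrN E oppr_ge0 in h2; rewrite E in h1.
apply/eqP; rewrite -(mulIr_eq0 _ (mulIf (lt0r_neq0 hy))).
by rewrite eq_le h2 h1.
Qed.

(** The number of kinks which are not cut-offs. *)
Let Kc := (K - pinC)%N.
Let chi j t : R := ((b j < t%:E)%E : bool)%:R.

Let chiE j t : (j < K)%N -> chi j t = (beta j < t)%R%:R.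
Proof. by move=> jK; rewrite /chi bE. Qed.

Let free_lt j : (j < Kc)%N -> free j.
Proof.
rewrite /free /Kc; case: pinC => /= jK; last by rewrite subn0 in jK; rewrite jK.
by rewrite (leq_trans jK (leq_subr _ _)) neq_ltn -subn1 jK.
Qed.

Let beyond t : 0 < t -> g t * chi Kc t = 0.
Proof.
move=> t0; have [_ _ pC] := pin; rewrite /chi /Kc; case: (boolP pinC) => hC; last first.
  by rewrite subn0 b_end// mulr0.
have K1 : (K.-1 < K)%N by rewrite prednK.
rewrite subn1 bE// lte_fin; have [h|h] := ltP (beta K.-1) t; last by rewrite mulr0.
rewrite /g /simple (bigD1 (Ordinal K1))//= pC// bE// kink_cut ger0_norm ?(ltW t0)//.
by rewrite leNgt h !mul0r.
Qed.

Let g_gt0 t : 0 < t -> (t%:E < b Kc)%E -> 0 < g t.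
Proof.
move=> t0 tb; rewrite /g /simple; apply: prodr_gt0 => j _.
have [fj|] := boolP (free j); first by rewrite aE// bE// kink_fin expR_gt0.
rewrite /free ltn_ord/= negbK => /andP[hC /eqP jE]; have [_ _ pC] := pin.
rewrite bE// jE pC// kink_cut ger0_norm ?(ltW t0)//.
move: tb; rewrite /Kc hC subn1 bE ?prednK// lte_fin => tb.
by rewrite (ltW tb).
Qed.

Let measurable_chi j : measurable_fun Rp (chi j).
Proof.
rewrite /chi; case: (b j) => [r| |].
- rewrite (_ : (fun t => _) = \1_(`]r, +oo[%classic)); first exact: measurable_indic.
  by apply/funext => t; rewrite indicE mem_setE in_itv/= andbT.
- by rewrite (_ : (fun t => _) = cst 0); first exact: measurable_cst.
- rewrite (_ : (fun t => _) = cst 1); first exact: measurable_cst.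
  by apply/funext => t; rewrite ltNyr.
Qed.

Let chi01 j t : 0 <= chi j t <= 1.
Proof. by rewrite /chi; case: (b j < _)%E; rewrite ?lexx ler01. Qed.

Let chi_expdecay j : expdecay (fun t => g t * chi j t).
Proof.
apply: (expdecayM (C := 1) dg (measurable_chi j)) => t t0; rewrite mul1r.
by have /andP[h1 h2] := chi01 j t; rewrite ger0_norm//; lra.
Qed.

Let hinge_expdecay j : (j < K)%N -> expdecay (fun t => g t * ((t - beta j) * chi j t)).
Proof.
move=> jK; apply: (expdecayM (C := 1) dg).
  apply: measurable_funM; last exact: measurable_chi.
  by apply: measurable_funB; [exact: measurable_id|exact: measurable_cst].
move=> t t0; rewrite mul1r chiE//; have := beta_ge0 jK.
case: (ltP (beta j) t) => h h1; last by rewrite mulr0 normr0; lra.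
by rewrite mulr1 ger0_norm; lra.
Qed.

Let L_zero u : (forall t, 0 < t -> u t = 0) -> L u = 0.
Proof.
move=> u0; rewrite /L big1// => i _; rewrite (@eq_mom _ _ (fun=> 0))//.
by rewrite /mom /Rintegral integral0_eq ?mulr0// => t _; rewrite mulr0.
Qed.

Let chi_stationary j : (pin0 <= j)%N -> (j <= Kc)%N -> L (fun t => g t * chi j t) = 0.
Proof.
rewrite leq_eqVlt [(j <= _)%N]leq_eqVlt => pj /orP[/eqP ->|jK]; first by apply: L_zero => t; exact: beyond.
have fj := free_lt jK; rewrite -(node_stationary fj).
  by congr L; apply/funext => t; rewrite chiE//; case/andP: fj.
by case: pin0 pj; case: (j).
Qed.

Let hinge_stationary j : (j <= Kc)%N -> L (fun t => g t * ((t - beta j) * chi j t)) = 0.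
Proof.
rewrite leq_eqVlt => /orP[/eqP ->|jK].
  by apply: L_zero => t t0; rewrite mulrCA beyond ?mulr0.
have fj := free_lt jK; rewrite -(slope_stationary fj).
have /andP[jK' _] := fj.
congr L; apply/funext => t; rewrite chiE//; congr (_ * _).
have [h|h] := ltP (beta j) t; first by rewrite mulr1 max_l//; lra.
by rewrite mulr0 max_r//; lra.
Qed.

(** [g] restricted to the piece between the nodes [i] and [i + 1]. *)
Let block i t : R := g t * (chi i t - chi i.+1 t).

(** (t - b_i) times the block is a combination of the functions of
    [hinge_stationary] for [i] and [i + 1] and of that of [chi_stationary] for
    [i + 1]. *)
Let block_moment i : (i < Kc)%N ->
  expdecay (fun t => (t - beta i) * block i t) /\ L (fun t => (t - beta i) * block i t) = 0.
Proof.
move=> iK; have /andP[iK' _] := free_lt iK.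
pose c := beta i.+1 - beta i.
pose T j t := g t * ((t - beta j) * chi j t).
have dT : expdecay (T i.+1).
  have [h|h] := ltnP i.+1 K; first exact: hinge_expdecay.
  apply: eq_expdecay (chi_expdecay i.+1) => t t0.
  by rewrite /T /chi b_end// !mulr0.
have E : (fun t => (t - beta i) * block i t) =
   T i \+ ((fun t => -1 * T i.+1 t) \+ (fun t => - c * (g t * chi i.+1 t))).
  by apply/funext => t; rewrite /block /T /c/=; ring.
have d1 := expdecayZ (-1) dT; have d2 := expdecayZ (- c) (chi_expdecay i.+1).
have d3 := hinge_expdecay iK'.
rewrite E; split; first by apply: expdecayD => //; exact: expdecayD.
have L1 := hinge_stationary (ltnW iK); have L2 := hinge_stationary iK.
have L3 := chi_stationary (leq_trans (leq_b1 pin0) (isT : 0 < i.+1)%N) iK.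
apply: etrans (functionalD v q1 d3 (expdecayD d1 d2)) _.
rewrite [X in X + _]L1 add0r; apply: etrans (functionalD v q1 d1 d2) _.
apply: etrans (f_equal2 +%R (functionalZ v q1 _ dT) (functionalZ v q1 _ (chi_expdecay i.+1))) _.
by rewrite [X in _ * X + _]L2 [X in _ + _ * X]L3 !mulr0 addr0.
Qed.

Let block_mean i : (i < Kc)%N -> (pin0 <= i)%N -> expdecay (block i) /\ L (block i) = 0.
Proof.
move=> iK pi.
have E : block i = (fun t => g t * chi i t) \+ (fun t => -1 * (g t * chi i.+1 t)).
  by apply/funext => t; rewrite /block/=; ring.
have d1 := expdecayZ (-1) (chi_expdecay i.+1); have d2 := chi_expdecay i.
rewrite E; split; first exact: expdecayD.
apply: etrans (functionalD v q1 d2 d1) _.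
apply: etrans (f_equal2 +%R erefl (functionalZ v q1 _ (chi_expdecay i.+1))) _.
have L1 := chi_stationary pi (ltnW iK); have L2 := chi_stationary (leqW pi) iK.
by rewrite [X in X + _]L1 [X in _ + _ * X]L2 mulr0 addr0.
Qed.

Let b_incr i : (i < Kc)%N -> (b i < b i.+1)%E.
Proof.
move=> iK; have /andP[iK' _] := free_lt iK; have [_ _ bi _ bf] := gen.
have [h|h] := ltnP i.+1 K; first exact: bi.
by rewrite (b_end h) bf.
Qed.

Let block_gt0 i t : (i < Kc)%N -> beta i < t -> (t%:E < b i.+1)%E -> 0 < t -> 0 < block i t.
Proof.
move=> iK bt tb t0; have /andP[iK' _] := free_lt iK; have [[_ _ bm] _ _] := pin.
have h : (b i.+1 < t%:E)%E = false by apply/negbTE; rewrite -leNgt ltW.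
rewrite /block chiE// bt /chi h/= subr0 mulr1 g_gt0//.
by apply: (lt_le_trans tb); exact: bm.
Qed.

Let block_eq0 i t : (i < Kc)%N -> t \notin [:: beta i.+1] ->
  ~ (beta i < t /\ (t%:E < b i.+1)%E) -> 0 < t -> block i t = 0.
Proof.
rewrite inE => iK tb H t0; have /andP[iK' _] := free_lt iK; have bi := b_incr iK.
have [h|h] := ltP (beta i) t.
  have nt : ~~ (t%:E < b i.+1)%E by apply/negP => h2; apply: H.
  have iK1 : (i.+1 < K)%N.
    by rewrite ltnNge; apply/negP => /b_end E; move: nt; rewrite E ltry.
  move: nt; rewrite bE// lte_fin -leNgt le_eqVlt eq_sym (negbTE tb)/= => h2.
  by rewrite /block !chiE// h h2 subrr mulr0.
have h2 : (b i.+1 < t%:E)%E = false.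
  apply/negbTE; rewrite -leNgt; apply: le_trans (ltW bi); rewrite bE//.
by rewrite /block chiE// ltNge h /= /chi h2 subrr mulr0.
Qed.

(** Two zeros of [P] in each piece, one in a first piece whose left end is pinned
    at [0], and one at a cut-off: in all as many zeros as free parameters, hence
    at least as many as [P] has terms. *)
Lemma stationary_matches : (size s <= K.*2 - pin0 - pinC)%N ->
  forall i, i \in s -> mom (q i) g = m i.
Proof.
move=> sz i iS; have [[a0 b0 bm] p0 pC] := pin.
have [||||zs [uzs szs zsP]] := @collect_zeros _ _ s q v b pin0 Kc.
- exact: b0.
- exact: b_incr.
- move=> Kc0 hp; have := block_moment Kc0; set u := (fun t => _) => -[du Lu].
  have /andP[K00 _] := free_lt Kc0.
  have be0 : beta 0%N = 0 by rewrite /beta p0.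
  have := @zero_in_piece _ _ s q v q1 u 0 (b 1%N) [:: beta 1%N] (lexx _) _ du Lu.
  rewrite p0//; apply.
  + by have := b_incr Kc0; rewrite p0.
  + move=> t t0 tz _ tb; rewrite /u be0 subr0 mulr_gt0// block_gt0// be0//.
  + by move=> t t0 tz H; rewrite /u block_eq0 ?mulr0// be0.
- move=> j jK np; have /andP[jK' _] := free_lt jK.
  have pj : (pin0 <= j)%N by case: pin0 np; case: (j).
  have [d1 L1] := block_moment jK; have [d0 L0] := block_mean jK pj.
  rewrite bE//; apply: (@two_zeros_in_piece _ _ s q v q1 (block j) (beta j) (b j.+1)
     [:: beta j.+1] (beta_ge0 jK') _ d0 L0 _ _ _ d1 L1) => //.
  + by rewrite -bE//; exact: b_incr.
  + by move=> t t0 _ bt tb; exact: block_gt0.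
  + by move=> t t0 tz H; exact: block_eq0.
have vi0 : forall i, i \in s -> v i = 0; last first.
  by apply/eqP; rewrite -subr_eq0; apply/eqP; exact: vi0.
pose zs' := if pinC then beta K.-1 :: zs else zs.
apply: (@many_zeros_eq0 _ _ s q v zs') => //.
- rewrite /zs'; case: (boolP pinC) => // hC; rewrite /= uzs andbT; apply/negP => /zsP[_ + _].
  by rewrite -bE ?prednK// /Kc hC subn1 ltxx.
- apply: leq_trans sz _; rewrite /zs' /Kc in szs *; move: n0 K0.
  case: (boolP pinC) szs => hC szs /=; rewrite szs; case: pin0; case: (K) => [|k] /=; lia.
- move=> z; rewrite /zs'; case: (boolP pinC) => hC; last by move/zsP => [].
  rewrite inE => /orP[/eqP ->|/zsP[]//]; split; last exact: cutoff_stationary.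
  have K1 : (K.-1 < K)%N by rewrite prednK.
  have [_ _ bi b00 _] := gen; rewrite -lte_fin -bE//.
  have [k0|k0] := posnP K.-1.
    rewrite k0 b00//; apply/negP => hp; move: n0 K0 k0; rewrite hp hC; lia.
  have E : K.-1 = K.-1.-1.+1 by rewrite prednK.
  by rewrite E; apply: le_lt_trans (b0 _) (bi _ _); rewrite -E.
Qed.

End Stationary.

(** * The continuity method *)
Section Continuation.
Variable R : realType.
Implicit Types (f g u : R -> R) (s t x y z l r e p c B C : R).

Local Notation mu := (@lebesgue_measure R).
Local Notation Rp := (`]0%R, +oo[%classic : set R).

Variables (K : nat) (pin0 pinC : bool) (I : eqType) (sI : seq I) (q : I -> R).
Hypotheses (us : uniq sI) (qi : {in sI &, injective q}) (q1 : forall i, i \in sI -> -1 < q i).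
Hypotheses (n0 : (0 < K.*2 - pin0 - pinC)%N) (sz : (size sI <= K.*2 - pin0 - pinC)%N).
Variable i0 : I.
Hypothesis i0s : i0 \in sI.

Let K0 : (0 < K)%N.
Proof. by move: n0; case: (K). Qed.

(** Nodes of index at least [K] are moved to [+oo], where they end the last
    piece. *)
Let truncate (b : nat -> \bar R) j := if (j < K)%N then b j else +oo%E.

Let simple_truncate a b t : simple K a (truncate b) t = simple K a b t.
Proof. by apply: eq_bigr => j _; rewrite /truncate ltn_ord. Qed.

Let pinned_truncate a b : pinned K pin0 pinC a b -> pinned K pin0 pinC a (truncate b).
Proof.
move=> [[a0 b0 bm] p0 pC]; split => //; last by rewrite /truncate K0.
split => //; first by move=> i; rewrite /truncate; case: ifP.
move=> i j ij; rewrite /truncate; case: (ltnP j K) => [jK|_]; last by rewrite leey.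
by rewrite (leq_ltn_trans ij jK) bm.
Qed.

Lemma cvg_sum_list (s : seq I) (x_ : I -> nat -> R) (l : I -> R) :
  (forall i, i \in s -> x_ i n @[n --> \oo] --> l i) ->
  (\sum_(i <- s) x_ i n) @[n --> \oo] --> \sum_(i <- s) l i.
Proof.
elim: s => [|i s IH] H.
  by under eq_cvg do rewrite big_nil; rewrite big_nil; exact: cvg_cst.
under eq_cvg do rewrite big_cons; rewrite big_cons.
apply: cvgD; first by apply: H; rewrite mem_head.
by apply: IH => j js; apply: H; rewrite inE js orbT.
Qed.

Lemma discrepancy_ge_term m f i : i \in sI -> (mom (q i) f - m i) ^+ 2 <= discrepancy sI q m f.
Proof.
move=> iS; rewrite /discrepancy (big_rem i)//= lerDl.
by apply: sumr_ge0 => j _; rewrite sqr_ge0.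
Qed.

Lemma moment_le_discrepancy m f i C : i \in sI -> discrepancy sI q m f <= C -> mom (q i) f <= m i + C + 1.
Proof.
move=> iS dC; have := le_trans (discrepancy_ge_term m f iS) dC.
move: (mom _ _) (m i) => x y h; have := sqr_ge0 (x - y - 1 / 2); nra.
Qed.

Lemma minimizer_exists m (a0 b0 : nat -> \bar R) : pinned K pin0 pinC a0 b0 -> expdecay (simple K a0 b0) ->
  exists a b, [/\ pinned K pin0 pinC a b, (forall j, (K <= j)%N -> b j = +oo%E),
    expdecay (simple K a b) &
    forall a' b', pinned K pin0 pinC a' b' -> expdecay (simple K a' b') ->
      discrepancy sI q m (simple K a b) <= discrepancy sI q m (simple K a' b')].
Proof.
move=> pin_0 d0.
(* a minimising sequence has a bounded moment, hence a limit *)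
pose V := [set d | exists ab : (nat -> \bar R) * (nat -> \bar R),
  [/\ pinned K pin0 pinC ab.1 ab.2, expdecay (simple K ab.1 ab.2) &
      d = discrepancy sI q m (simple K ab.1 ab.2)]].
have V0 : V !=set0 by exists (discrepancy sI q m (simple K a0 b0)), (a0, b0).
have disc0 f : 0 <= discrepancy sI q m f by apply: sumr_ge0 => i _; rewrite sqr_ge0.
have lbV : has_lbound V by exists 0 => _ [ab [_ _ ->]].
have hi : has_inf V by split.
have [ab abP] : exists ab : nat -> (nat -> \bar R) * (nat -> \bar R), forall n,
   [/\ pinned K pin0 pinC (ab n).1 (ab n).2, expdecay (simple K (ab n).1 (ab n).2) &
      discrepancy sI q m (simple K (ab n).1 (ab n).2) <= inf V + n.+1%:R^-1].
  have H n : exists ab : (nat -> \bar R) * (nat -> \bar R),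
     [/\ pinned K pin0 pinC ab.1 ab.2, expdecay (simple K ab.1 ab.2) &
      discrepancy sI q m (simple K ab.1 ab.2) <= inf V + n.+1%:R^-1].
    have [_ [x [h1 h2 ->]] h3] := @inf_adherent _ V n.+1%:R^-1 ltac:(by rewrite invr_gt0) hi.
    by exists x; split => //; exact: ltW.
  have [F FP] := choice H; by exists F.
have [phi [a [b [phi_inc pin dg cv _]]]] : exists (phi : nat -> nat) a b,
   [/\ (forall k, (phi k < phi k.+1)%N),
    pinned K pin0 pinC a b, expdecay (simple K a b),
    (forall p, -1 < p -> mom p (simple K (ab (phi n)).1 (ab (phi n)).2) @[n --> \oo] -->
        mom p (simple K a b)) & True].
  have [||phi [a [b [h1 h2 h3 h4 h5]]]] := @simple_compact _ K pin0 pinC (fun n => (ab n).1) (fun n => (ab n).2)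
     (q i0) (m i0 + (inf V + 1) + 1) K0 (q1 i0s).
  - by move=> n; have [] := abP n.
  - move=> n; have [_ d dd] := abP n; rewrite momE ?q1// lee_fin.
    apply: moment_le_discrepancy => //; apply: (le_trans dd).
    by rewrite lerD2l invf_le1 ?ler1n.
  - by exists phi, a, b; split.
have dcv : discrepancy sI q m (simple K (ab (phi n)).1 (ab (phi n)).2) @[n --> \oo] -->
    discrepancy sI q m (simple K a b).
  apply: cvg_sum_list => i iS; under eq_cvg do rewrite expr2; rewrite expr2.
  by apply: cvgM; apply: cvgB (cvg_cst _); apply: cv; exact: q1.
have dinf : discrepancy sI q m (simple K a b) <= inf V.
  have icv : (inf V + n.+1%:R^-1) @[n --> \oo] --> inf V + 0.
    by apply: cvgD; [exact: cvg_cst|exact: cvg_harmonic].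
  rewrite -[X in _ <= X]addr0; apply: (ler_cvg_to dcv icv); apply: nearW => n.
  have [_ _ h] := abP (phi n); apply: (le_trans h); rewrite lerD2l lef_pV2 ?posrE// ler_nat ltnS.
  exact: increasing_ge_id.
have E : simple K a (truncate b) = simple K a b by apply/funext => t; exact: simple_truncate.
exists a, (truncate b); split.
- exact: pinned_truncate.
- by move=> j; rewrite /truncate leqNgt => /negbTE ->.
- by rewrite E.
- move=> a' b' p' d'; rewrite E; apply: (le_trans dinf).
  by apply: (ge_inf lbV); exists (a', b').
Qed.

(** The supremum of the solvable parameters is solvable by compactness; if it were
    smaller than [1], minimisers for slightly larger parameters would be generic,
    hence solutions. *)
Lemma continuation (F : R -> R -> R) :
  (forall s, 0 <= s <= 1 -> expdecay (F s)) ->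
  (forall i (s_ : nat -> R) s, i \in sI -> (forall n, 0 <= s_ n <= 1) -> 0 <= s <= 1 ->
     s_ n @[n --> \oo] --> s -> mom (q i) (F (s_ n)) @[n --> \oo] --> mom (q i) (F s)) ->
  (exists a b, pinned K pin0 pinC a b /\ F 0 = simple K a b) ->
  (forall s a b, 0 <= s < 1 -> pinned K pin0 pinC a b -> expdecay (simple K a b) ->
     (forall i, i \in sI -> mom (q i) (simple K a b) = mom (q i) (F s)) ->
     generic_nodes K pin0 pinC a b) ->
  exists a b, [/\ pinned K pin0 pinC a b, expdecay (simple K a b) &
    forall i, i \in sI -> mom (q i) (simple K a b) = mom (q i) (F 1)].
Proof.
move=> dF cF [a0 [b0 [pin_0 F0]]] genF.
pose solved s a b := [/\ pinned K pin0 pinC a b, expdecay (simple K a b) &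
    forall i, i \in sI -> mom (q i) (simple K a b) = mom (q i) (F s)].
pose S := [set s | 0 <= s <= 1 /\ exists a b, solved s a b].
have S0 : S 0.
  split; first by rewrite lexx ler01.
  by exists a0, b0; rewrite /solved -F0; split => //; apply: dF; rewrite lexx ler01.
have ubS : ubound S 1 by move=> s [/andP[]].
have hS : has_sup S by split; [exists 0|exists 1].
pose s0 := sup S.
have s01 : 0 <= s0 <= 1.
  by rewrite (sup_upper_bound hS S0)/= ge_sup//; exists 0.
have cvg_near (s_ : nat -> R) (s : R) (A_ B_ : nat -> nat -> \bar R) :
    (forall n, 0 <= s_ n <= 1) -> 0 <= s <= 1 -> s_ n @[n --> \oo] --> s ->
    (forall n, pinned K pin0 pinC (A_ n) (B_ n)) ->
    (forall n, expdecay (simple K (A_ n) (B_ n))) ->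
    (forall i, i \in sI ->
       (mom (q i) (simple K (A_ n) (B_ n)) - mom (q i) (F (s_ n))) @[n --> \oo] --> 0) ->
    exists (phi : nat -> nat) a b, [/\ (forall k, (phi k < phi k.+1)%N), solved s a b &
      generic_nodes K pin0 pinC a b ->
      \forall n \near \oo, generic_nodes K pin0 pinC (A_ (phi n)) (B_ (phi n))].
  move=> s_P sP scv pinA dA mcv.
  have cvm i : i \in sI -> mom (q i) (simple K (A_ n) (B_ n)) @[n --> \oo] --> mom (q i) (F s).
    move=> iS; rewrite -[X in _ --> X]add0r.
    rewrite (_ : (fun n => _) = (fun n => (mom (q i) (simple K (A_ n) (B_ n)) -
       mom (q i) (F (s_ n))) + mom (q i) (F (s_ n)))); last by apply/funext => n; rewrite subrK.
    by apply: cvgD; [exact: mcv|exact: cF].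
  have [C HC] : exists C, forall n, mom (q i0) (simple K (A_ n) (B_ n)) <= C.
    have /cvg_seq_bounded[C [_ HC]] : cvgn (fun n => mom (q i0) (simple K (A_ n) (B_ n))).
      by apply/cvg_ex; exists (mom (q i0) (F s)); exact: cvm.
    exists (C + 1) => n; apply: le_trans (ler_norm _) _.
    by apply: (HC (C + 1)); rewrite ?ltrDl.
  have [||phi [a [b [phi_inc pin dg cv gen]]]] := @simple_compact _ K pin0 pinC A_ B_ (q i0) C K0 (q1 i0s).
  - exact: pinA.
  - by move=> n; rewrite momE ?q1// lee_fin.
  exists phi, a, b; split => //; split => // i iS.
  apply: (cvg_unique _ (cv _ (q1 iS))); first exact: norm_hausdorff.
  have phi_oo : phi n @[n --> \oo] --> \oo by move=> P hP; exact: (near_subsequence phi_inc hP).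
  by have := cvg_comp _ _ phi_oo (cvm i iS).
have Ss0 : S s0.
  split=> //.
  have H n : exists sab : R * ((nat -> \bar R) * (nat -> \bar R)),
     [/\ 0 <= sab.1 <= 1, s0 - n.+1%:R^-1 < sab.1, sab.1 <= s0 & solved sab.1 sab.2.1 sab.2.2].
    have [s Ss h] := @sup_adherent _ S n.+1%:R^-1 ltac:(by rewrite invr_gt0) hS.
    have [h1 [a [b h2]]] := Ss; exists (s, (a, b)); split => //.
    exact: sup_upper_bound.
  have [G GP] := choice H.
  have scv : (G n).1 @[n --> \oo] --> s0.
    apply: (@squeeze_cvgr _ _ _ _ (fun n => s0 - n.+1%:R^-1) (fun=> s0)).
    - by apply: nearW => n; have [_ /ltW -> ->] := GP n.
    - by rewrite -[X in _ --> X]subr0; apply: cvgB; [exact: cvg_cst|exact: cvg_harmonic].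
    - exact: cvg_cst.
  have [||||phi [a [b [_ sol _]]]] := cvg_near (fun n => (G n).1) s0 (fun n => (G n).2.1) (fun n => (G n).2.2) _ s01 scv.
  - by move=> n; have [] := GP n.
  - by move=> n; have [_ _ _ []] := GP n.
  - by move=> n; have [_ _ _ []] := GP n.
  - move=> i iS; apply: cvg_near_cst; apply: nearW => n.
    by have [_ _ _ [_ _ ->//]] := GP n; rewrite subrr.
  - by exists a, b.
have [_ [a1 [b1 [pin1 d1 m1]]]] := Ss0.
have [s0lt|] := ltP s0 1; last first.
  by case/andP: s01 => _ h1 h2; have <- : s0 = 1 by [apply/eqP; rewrite eq_le h1 h2]; exists a1, b1.
exfalso.
have s00 : 0 <= s0 by case/andP: s01.
pose s_ n := s0 + (1 - s0) * n.+1%:R^-1.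
have u1 n : 0 < n.+1%:R^-1 :> R /\ n.+1%:R^-1 <= 1 :> R.
  by rewrite invr_gt0 ltr0Sn invf_le1 ?ler1n ?ltr0Sn.
have s_P n : 0 <= s_ n <= 1.
  have := u1 n; rewrite /s_; move: (n.+1%:R^-1) => w [h1 h2].
  have h3 : 0 <= (1 - s0) * w by rewrite mulr_ge0 ?subr_ge0 ?ltW.
  have h4 : (1 - s0) * w <= 1 - s0 by rewrite ler_piMr// subr_ge0 ltW.
  by apply/andP; split; lra.
have s_gt n : s0 < s_ n by have [h1 h2] := u1 n; rewrite /s_ ltrDl mulr_gt0// subr_gt0.
have scv : s_ n @[n --> \oo] --> s0.
  rewrite -[X in _ --> X]addr0; apply: cvgD; first exact: cvg_cst.
  by rewrite -(mulr0 (1 - s0)); apply: cvgM; [exact: cvg_cst|exact: cvg_harmonic].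
have H n : exists ab : (nat -> \bar R) * (nat -> \bar R),
   [/\ pinned K pin0 pinC ab.1 ab.2, (forall j, (K <= j)%N -> ab.2 j = +oo%E),
    expdecay (simple K ab.1 ab.2) &
    forall a' b', pinned K pin0 pinC a' b' -> expdecay (simple K a' b') ->
      discrepancy sI q (fun i => mom (q i) (F (s_ n))) (simple K ab.1 ab.2) <=
      discrepancy sI q (fun i => mom (q i) (F (s_ n))) (simple K a' b')].
  by have [a [b ?]] := minimizer_exists (fun i => mom (q i) (F (s_ n))) pin1 d1; exists (a, b).
have [G GP] := choice H.
have mcv i : i \in sI ->
    (mom (q i) (simple K (G n).1 (G n).2) - mom (q i) (F (s_ n))) @[n --> \oo] --> 0.
  move=> iS.
  have dcv : discrepancy sI q (fun i => mom (q i) (F (s_ n))) (simple K a1 b1) @[n --> \oo] --> 0.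
    have -> : 0 = \sum_(i <- sI) (mom (q i) (simple K a1 b1) - mom (q i) (F s0)) ^+ 2.
      by rewrite big_seq big1// => j jS; rewrite m1// subrr expr2 mulr0.
    apply: cvg_sum_list => j jS; under eq_cvg do rewrite expr2; rewrite expr2.
    by apply: cvgM; apply: cvgB (cvg_cst _) _; apply: cF.
  have sq : (mom (q i) (simple K (G n).1 (G n).2) - mom (q i) (F (s_ n))) ^+ 2 @[n --> \oo] --> 0.
    apply: (@squeeze_cvgr _ _ _ _ (fun=> 0) _ _ _ _ (cvg_cst _) dcv).
    apply: nearW => n; rewrite sqr_ge0/=; have [_ _ _ h] := GP n.
    exact: le_trans (discrepancy_ge_term _ _ iS) (h _ _ pin1 d1).
  apply/cvgrPdist_lt => e e0; move/cvgrPdist_lt : sq => /(_ (e ^+ 2) (exprn_gt0 _ e0)).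
  apply: filterS => n; rewrite !sub0r !normrN normrX.
  by rewrite ltr_pXn2r// nnegrE ?normr_ge0// ltW.
have [||phi [a [b [phi_inc [pin dg mm] gen]]]] := cvg_near s_ s0 (fun n => (G n).1) (fun n => (G n).2) s_P s01 scv _ _ mcv.
- by move=> n; have [] := GP n.
- by move=> n; have [] := GP n.
have s0r : 0 <= s0 < 1 by rewrite s00.
have /gen [N _ /(_ N (leqnn N)) gN] := genF s0 a b s0r pin dg mm.
have [pN bN dN minN] := GP (phi N).
have sol := stationary_matches pN gN bN us qi q1 n0 dN minN sz.
have : s_ (phi N) <= s0.
  apply: (sup_upper_bound hS); split => //; exists (G (phi N)).1, (G (phi N)).2.
  by split.
by rewrite leNgt s_gt.
Qed.

End Continuation.

(** * A path from a simple function to the given function *)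
Section Path.
Variable R : realType.
Implicit Types (f g u : R -> R) (s t x y z l r e p c B C : R).

Local Notation mu := (@lebesgue_measure R).
Local Notation Rp := (`]0%R, +oo[%classic : set R).

(** Write [x2] as a combination of [x1] and [y], and use f(x1)^l >= f(x1). *)
Lemma halfLC_lipschitz f x1 x2 y : halfLC f -> 0 <= x1 -> x1 <= x2 -> x2 < y -> 0 < f y ->
  f x1 - f x2 <= - ln (f y) / (y - x2) * (x2 - x1).
Proof.
move=> hf x10 x12 x2y fy.
have y0 : 0 <= y by rewrite (le_trans x10)// (le_trans x12)// ltW.
have fy1 : f y <= 1 by exact: halfLC_le1.
have lny : 0 <= - ln (f y) by rewrite oppr_ge0 -(ln1 R) ler_ln ?posrE.
have [->|x12'] := eqVneq x1 x2; first by rewrite !subrr mulr0.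
have {x12 x12'}x12 : x1 < x2 by rewrite lt_neqAle x12' x12.
pose l := (y - x2) / (y - x1).
have d0 : 0 < y - x1 by lra.
have l01 : 0 < l < 1.
  by apply/andP; split; [rewrite divr_gt0// subr_gt0|rewrite /l ltr_pdivrMr// mul1r; lra].
have /andP[l0 l1] := l01.
have El : 1 - l = (x2 - x1) / (y - x1) by rewrite /l; field; rewrite gt_eqF.
have [_ _ _ /(_ x1 y l x10 y0 l01)] := hf.
have -> : l * x1 + (1 - l) * y = x2 by rewrite El /l; field; rewrite gt_eqF.
have f1 : f x1 <= 1 by exact: halfLC_le1.
have f0 : 0 < f x1 by rewrite (lt_le_trans fy)// halfLC_anti//; lra.
move=> h.
have h1 : f x1 <= f x1 `^ l.
  by rewrite -{1}(powRr1 (ltW f0)) ger_powR ?f0//= ltW.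
have h2 : 1 + (1 - l) * ln (f y) <= f y `^ (1 - l).
  by rewrite /powR gt_eqF// expR_ge1Dx.
have h3 : f x1 * (1 + (1 - l) * ln (f y)) <= f x2.
  apply: le_trans h; apply: (@le_trans _ _ (f x1 * f y `^ (1 - l))).
    by rewrite ler_wpM2l// ltW.
  by rewrite ler_wpM2r// powR_ge0.
have h4 : f x1 - f x2 <= (1 - l) * - ln (f y).
  move: lny h3; move: (ln _) => L lny h3.
  have : 0 <= (1 - f x1) * ((1 - l) * - L) by rewrite mulr_ge0// ?mulr_ge0// subr_ge0// ltW.
  by nra.
apply: (le_trans h4); rewrite El mulrC -mulrA ler_wpM2l//.
rewrite mulrC ler_wpM2r ?subr_ge0 ?(ltW x12)//.
by rewrite lef_pV2 ?posrE ?subr_gt0//; lra.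
Qed.

Lemma halfLC_cvg f (x_ : nat -> R) x y : halfLC f -> 0 <= x -> x < y -> 0 < f y ->
  (forall n, 0 <= x_ n) -> x_ n @[n --> \oo] --> x -> f (x_ n) @[n --> \oo] --> f x.
Proof.
move=> hf x0 xy fy xn0 xcv.
pose z := (x + y) / 2; pose C := - ln (f y) / (y - z) + 1.
have xz : x < z by rewrite midf_lt.
have zy : z < y by rewrite midf_lt.
have y0 : 0 <= y by lra.
have lny : 0 <= - ln (f y) by rewrite oppr_ge0 -(ln1 R) ler_ln ?posrE// halfLC_le1.
have C0 : 0 < C by rewrite ltr_pwDr// divr_ge0// subr_ge0 ltW.
have key (v w : R) : 0 <= v -> v <= w -> w < z -> `|f v - f w| <= C * `|v - w|.
  move=> u0 uv vz.
  rewrite ger0_norm ?subr_ge0; last exact: halfLC_anti.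
  rewrite ler0_norm ?subr_le0// opprB.
  have vy : w < y by lra.
  apply: (le_trans (halfLC_lipschitz hf u0 uv vy fy)); rewrite ler_wpM2r ?subr_ge0//.
  rewrite /C (@le_trans _ _ (- ln (f y) / (y - z)))//; last by rewrite lerDl.
  by rewrite ler_wpM2l// lef_pV2 ?posrE ?subr_gt0//; lra.
apply/cvgrPdist_lt => e e0.
have d0 : 0 < Num.min (z - x) (e / C) by rewrite lt_min subr_gt0 xz divr_gt0.
move/cvgrPdist_lt : xcv => /(_ _ d0); apply: filterS => n; rewrite lt_min => /andP[h1 h2].
apply: (@le_lt_trans _ _ (C * `|x - x_ n|)); last by rewrite mulrC -ltr_pdivlMr.
have [h|h] := leP x (x_ n).
  apply: key => //; move: h1; rewrite ler0_norm ?subr_le0//; lra.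
by rewrite distrC [X in C * X]distrC; apply: key => //; exact: ltW.
Qed.

(** A log-concave function is continuous on the half-line except at the right end
    of its support, so at most one [t] is excluded. *)
Lemma halfLC_scale_cvg f (s_ : nat -> R) s eta : halfLC f -> 0 < eta -> 0 < f eta ->
  0 <= s -> (forall n, 0 <= s_ n) -> s_ n @[n --> \oo] --> s ->
  exists zs : seq R, forall t, 0 < t -> t \notin zs -> f (s_ n * t) @[n --> \oo] --> f (s * t).
Proof.
move=> hf eta0 feta s0 sn0 scv.
have cv t : (s_ n * t) @[n --> \oo] --> s * t by apply: cvgM => //; exact: cvg_cst.
pose E := [set y | 0 <= y /\ 0 < f y].
have Eeta : E eta by split => //; exact: ltW.
have inE_ t y : 0 < t -> s * t < y -> 0 < f y -> f (s_ n * t) @[n --> \oo] --> f (s * t).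
  move=> t0 sy fy; apply: (halfLC_cvg hf _ sy fy) => //.
    by rewrite mulr_ge0// ltW.
  by move=> n; rewrite mulr_ge0// ltW.
have [all_pos|] := pselect (forall y, 0 <= y -> 0 < f y).
  exists [::] => t t0 _; apply: (inE_ t (s * t + 1)) => //; first by rewrite ltrDl.
  by apply: all_pos; rewrite addr_ge0// mulr_ge0// ltW.
move=> /existsNP[y1 /not_implyP[y10 fy1]].
have ubE : ubound E y1.
  move=> y [y0 fy]; rewrite leNgt; apply/negP => yy; apply: fy1.
  by apply: lt_le_trans fy _; apply: halfLC_anti => //; exact: ltW.
have hE : has_sup E by split; [exists eta|exists y1].
pose e := sup E.
have e0 : 0 < e by apply: (lt_le_trans eta0); exact: (sup_upper_bound hE Eeta).
exists [:: e / s] => t t0; rewrite inE => tz.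
have [h|h|h] := ltrgtP (s * t) e.
- have [y [y0 fy] sy] := @sup_adherent _ E (e - s * t) ltac:(by rewrite subr_gt0) hE.
  by apply: (inE_ t y) => //; move: sy; rewrite -/e; lra.
- have fz y : e < y -> f y = 0.
    move=> ey; apply/eqP; rewrite eq_le halfLC_ge0 ?andbT// ?(ltW (lt_trans e0 ey))//.
    rewrite leNgt; apply/negP => fy; have : y <= e.
      by apply: (sup_upper_bound hE); split => //; exact: ltW (lt_trans e0 ey).
    by rewrite leNgt ey.
  rewrite (fz _ h); apply: cvg_near_cst.
  have d0 : 0 < s * t - e by rewrite subr_gt0.
  move/cvgrPdist_lt : (cv t) => /(_ _ d0); apply: filterS => n hn.
  by apply: fz; move: hn; have := ler_norm (s * t - s_ n * t); lra.
- exfalso; move: tz; rewrite -h; have [s00|s00] := eqVneq s 0.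
    by move: e0; rewrite -h s00 mul0r ltxx.
  by rewrite (mulrC s) mulfK// eqxx.
Qed.

Variables f g : R -> R.
Hypotheses (hf : halfLC f) (hg : halfLC g).
Variables (Af Ag ef eg : R).
Hypotheses (Af0 : 0 < Af) (fAf : f Af < 1) (Ag0 : 0 < Ag) (gAg : g Ag < 1).
Hypotheses (ef0 : 0 < ef) (fef : 0 < f ef) (eg0 : 0 < eg) (geg : 0 < g eg).

(** The product of the two rescaled functions keeps a uniform decay, since one of
    the scales is at least 1/2; the Gaussian factor disappears at both ends. *)
Definition homotopy s t : R := f (s * t) * g ((1 - s) * t) * expR (- (s * (1 - s) * t ^+ 2)).

Lemma homotopy_halfLC s : 0 <= s <= 1 -> halfLC (homotopy s).
Proof.
move=> /andP[s0 s1]; apply: halfLCM; first apply: halfLCM.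
- exact: halfLC_scale.
- by apply: halfLC_scale => //; rewrite subr_ge0.
- by apply: halfLC_gauss; rewrite mulr_ge0// subr_ge0.
Qed.

Lemma homotopy0 t : homotopy 0 t = g t.
Proof.
have [f0 _ _ _] := hf.
by rewrite /homotopy subr0 !mul0r oppr0 expR0 f0 !mul1r mulr1.
Qed.

Lemma homotopy1 t : homotopy 1 t = f t.
Proof.
have [g0 _ _ _] := hg.
by rewrite /homotopy subrr mulr0 !mul0r oppr0 expR0 g0 mul1r !mulr1.
Qed.

Lemma homotopy_decay : exists B c, 0 < c /\ forall s t, 0 <= s <= 1 -> 0 < t ->
  `|homotopy s t| <= B * expR (- (c * t)).
Proof.
have half u A : halfLC u -> 0 < A -> u A < 1 ->
    exists B c, [/\ 0 <= B, 0 < c & forall t, 0 < t -> u (1 / 2 * t) <= B * expR (- (c * t))].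
  move=> hu A0 uA.
  have h2 : halfLC (fun t => u (1 / 2 * t)) by apply: halfLC_scale.
  have [|_ [B [c [c0 Bc]]]] := @halfLC_expdecay _ _ (2 * A) h2 (mulr_gt0 (ltr0Sn R 1) A0).
    by rewrite mulrA mul1r mulVf// mul1r.
  exists (Num.max B 0), c; split => // [|t t0]; first by rewrite le_max lexx orbT.
  apply: (le_trans (ler_norm _)); apply: (le_trans (Bc t t0)).
  by rewrite ler_wpM2r ?expR_ge0// le_max lexx.
have [B1 [c1 [B10 c10 H1]]] := half f Af hf Af0 fAf.
have [B2 [c2 [B20 c20 H2]]] := half g Ag hg Ag0 gAg.
exists (B1 + B2), (Num.min c1 c2); split; first by rewrite lt_min c10.
move=> s t s01 t0; have /andP[s0 s1] := s01; have t00 := ltW t0.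
have hp := homotopy_halfLC s01.
rewrite ger0_norm ?(halfLC_ge0 hp)//.
have e1 : expR (- (s * (1 - s) * t ^+ 2)) <= 1.
  rewrite -[X in _ <= X]expR0 ler_expR oppr_le0 mulr_ge0 ?sqr_ge0//.
  by rewrite mulr_ge0// subr_ge0.
have h2t : 0 <= 1 / 2 * t by rewrite mulr_ge0.
have st0 : 0 <= s * t by rewrite mulr_ge0.
have s't0 : 0 <= (1 - s) * t by rewrite mulr_ge0// subr_ge0.
have expB c B : 0 <= B -> Num.min c1 c2 <= c ->
    B * expR (- (c * t)) <= B * expR (- (Num.min c1 c2 * t)).
  by move=> B0 cc; rewrite ler_wpM2l// ler_expR lerN2 ler_wpM2r.
apply: (@le_trans _ _ (f (s * t) * g ((1 - s) * t))).
  by rewrite /homotopy ler_piMr// mulr_ge0// halfLC_ge0.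
rewrite [X in _ <= X]mulrDl; have [h|h] := leP (1 / 2) s.
  apply: (@le_trans _ _ (B1 * expR (- (Num.min c1 c2 * t)))); last first.
    by rewrite lerDl mulr_ge0 ?expR_ge0.
  apply: (@le_trans _ _ (f (1 / 2 * t))).
    apply: (@le_trans _ _ (f (s * t))).
      by apply: ler_piMr; [exact: halfLC_ge0|exact: halfLC_le1].
    by apply: halfLC_anti => //; rewrite ler_wpM2r.
  by apply: (le_trans (H1 t t0)); apply: expB => //; rewrite ge_min lexx.
apply: (@le_trans _ _ (B2 * expR (- (Num.min c1 c2 * t)))); last first.
  by rewrite lerDr mulr_ge0 ?expR_ge0.
apply: (@le_trans _ _ (g (1 / 2 * t))).
  apply: (@le_trans _ _ (g ((1 - s) * t))).
    by apply: ler_piMl; [exact: halfLC_ge0|exact: halfLC_le1].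
  by apply: halfLC_anti => //; rewrite ler_wpM2r//; lra.
by apply: (le_trans (H2 t t0)); apply: expB => //; rewrite ge_min lexx orbT.
Qed.

Lemma homotopy_expdecay s : 0 <= s <= 1 -> expdecay (homotopy s).
Proof.
move=> s01; have [B [c [c0 H]]] := homotopy_decay; split.
  by apply: halfLC_measurable; exact: homotopy_halfLC.
by exists B, c; split => // t t0; exact: H.
Qed.

Lemma homotopy_mom_cvg p (s_ : nat -> R) s : -1 < p -> (forall n, 0 <= s_ n <= 1) ->
  0 <= s <= 1 -> s_ n @[n --> \oo] --> s ->
  mom p (homotopy (s_ n)) @[n --> \oo] --> mom p (homotopy s).
Proof.
move=> p1 sn01 s01 scv; have /andP[s0 s1] := s01.
have sn0 n : 0 <= s_ n by case/andP: (sn01 n).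
have sn1 n : 0 <= 1 - s_ n by rewrite subr_ge0; case/andP: (sn01 n).
have s'cv : (1 - s_ n) @[n --> \oo] --> 1 - s by apply: cvgB => //; exact: cvg_cst.
have s'0 : 0 <= 1 - s by rewrite subr_ge0.
have [z1 H1] := halfLC_scale_cvg hf ef0 fef s0 sn0 scv.
have [z2 H2] := halfLC_scale_cvg hg eg0 geg s'0 sn1 s'cv.
have [B [c [c0 HB]]] := homotopy_decay.
apply: (mom_cvg (B := B) (c := c) (zs := z1 ++ z2)) => //.
- by move=> n; apply: halfLC_measurable; exact: homotopy_halfLC.
- by apply: halfLC_measurable; exact: homotopy_halfLC.
- by move=> n t t0; exact: HB.
- move=> t t0; rewrite mem_cat negb_or => /andP[t1 t2].
  apply: cvgM; first by apply: cvgM; [exact: H1|exact: H2].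
  apply: continuous_cvg; first exact: continuous_expR.
  apply: cvgN; apply: cvgM; last exact: cvg_cst.
  by apply: cvgM.
Qed.

(** Between the origin and its first positive node a simple function is
    log-convex, whereas the Gaussian factor is strictly log-concave. *)
Lemma homotopy_not_simple s K (a b : nat -> \bar R) : 0 < s < 1 -> admissible a b ->
  ~ {ae mu, forall t, Rp t -> homotopy s t = simple K a b t}.
Proof.
move=> /andP[s0 s1] adm ae.
have s01 : 0 <= s <= 1 by rewrite (ltW s0) (ltW s1).
have hh := homotopy_halfLC s01.
have [a0 b0 bm] := adm.
have [d [d0 fd gd nd]] : exists d, [/\ 0 < d, 0 < f (s * d), 0 < g ((1 - s) * d) &
    forall i, (i < K)%N -> (b i <= 0)%E \/ (d%:E <= b i)%E].
  have [d1 [d10 nd]] : exists d, 0 < d /\ forall i, (i < K)%N -> (b i <= 0)%E \/ (d%:E <= b i)%E.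
    elim: (K) => [|k [d [d0 IH]]]; first by exists 1.
    have [h|h] := leP (b k) 0%E.
      by exists d; split => // i; rewrite ltnS leq_eqVlt => /orP[/eqP ->|/IH //]; left.
    have [r [r0 rb]] : exists r, 0 < r /\ (r%:E <= b k)%E.
      by case: (b k) h => [r| |]//; [rewrite lte_fin => r0; exists r|exists 1; rewrite leey].
    exists (Num.min d r); split; first by rewrite lt_min d0.
    move=> i; rewrite ltnS leq_eqVlt => /orP[/eqP ->|/IH[h'|h']]; [right|by left|right].
      by apply: le_trans rb; rewrite lee_fin ge_min lexx orbT.
    by apply: le_trans h'; rewrite lee_fin ge_min lexx.
  have dd : 0 < Num.min d1 (Num.min ef eg) by rewrite !lt_min d10 ef0 eg0.
  exists (Num.min d1 (Num.min ef eg)); split => //.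
  - apply: (lt_le_trans fef); apply: halfLC_anti => //; first by rewrite mulr_ge0// ltW.
    apply: (@le_trans _ _ (Num.min d1 (Num.min ef eg))); last by rewrite !ge_min lexx orbT.
    by rewrite ler_piMl// ltW.
  - apply: (lt_le_trans geg); apply: halfLC_anti => //; first by rewrite mulr_ge0// ?subr_ge0 ltW.
    apply: (@le_trans _ _ (Num.min d1 (Num.min ef eg))); last by rewrite !ge_min lexx !orbT.
    by rewrite ler_piMl ?(ltW dd)//; lra.
  - move=> i /nd[h|h]; [by left|right]; apply: le_trans h.
    by rewrite lee_fin ge_min lexx.
have E t : 0 < t -> t < d -> homotopy s t = simple K a b t.
  move=> t0 td; apply: halfLC_simple_eq => // i /nd[h|h] bE.
    by move: h; rewrite bE lee_fin leNgt t0.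
  by move: h; rewrite bE lee_fin leNgt td.
have l2 : 0 < (1 / 2 : R) < 1 by apply/andP; split; lra.
pose x := d / 4; pose z := d / 2.
have x0 : 0 < x by rewrite divr_gt0.
have xz : x < z by rewrite /x /z; lra.
have zd : z < d by rewrite /z; lra.
have nk : ~ kink_in K a b x z.
  move=> [i [iK _ xb bz]]; have [h|h] := nd i iK.
    by have := lt_le_trans xb h; rewrite lte_fin ltNge (ltW x0).
  by have := le_lt_trans h bz; rewrite lte_fin ltNge (ltW zd).
have := simple_logconvex adm (ltW x0) (ltW xz) l2 nk.
set m := _ * x + _; have xm : x < m by rewrite /m; lra.
have mz : m < z by rewrite /m; lra.
have m0 := lt_trans x0 xm.
have z0 := lt_trans x0 xz.
rewrite -!E//; [|by lra|by lra].
pose h t := f (s * t) * g ((1 - s) * t).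
have hhh : halfLC h.
  by apply: halfLCM; apply: halfLC_scale => //; [exact: ltW|rewrite subr_ge0 ltW].
have hpos t : 0 < t -> t < d -> 0 < h t.
  move=> t0 td; have s'0 : 0 < 1 - s by lra.
  rewrite mulr_gt0//; [apply: (lt_le_trans fd)|apply: (lt_le_trans gd)]; apply: halfLC_anti => //.
  - by rewrite mulr_ge0 ?ltW.
  - by rewrite ler_pM2l// ltW.
  - by rewrite mulr_ge0 ?ltW.
  - by rewrite ler_pM2l// ltW.
have [_ _ _ /(_ x z (1 / 2) (ltW x0) (ltW z0) l2)] := hhh; rewrite -/m => hm.
have hE t : homotopy s t = h t * expR (- (s * (1 - s) * t ^+ 2)) by [].
clearbody h.
rewrite !hE; set k := s * (1 - s); have k0 : 0 < k by rewrite mulr_gt0//; lra.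
apply/negP; rewrite -ltNge.
have hx := hpos x x0 (lt_trans xz zd); have hz := hpos z z0 zd.
rewrite !powRM ?expR_ge0 ?(ltW hx) ?(ltW hz)//.
rewrite mulrACA; apply: (@le_lt_trans _ _ (h m * (expR (- (k * x ^+ 2)) `^ (1 / 2) *
    expR (- (k * z ^+ 2)) `^ (1 - 1 / 2)))).
  by apply: ler_wpM2r => //; apply: mulr_ge0; exact: powR_ge0.
rewrite ltr_pM2l; last exact: hpos m0 (lt_trans mz zd).
rewrite /powR !gt_eqF ?expR_gt0// !expRK -expRD ltr_expR -subr_gt0.
have -> : - (k * m ^+ 2) - (1 / 2 * - (k * x ^+ 2) + (1 - 1 / 2) * - (k * z ^+ 2)) =
   k * ((z - x) / 2) ^+ 2 by rewrite /m; field.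
by rewrite mulr_gt0// exprn_gt0// divr_gt0// subr_gt0.
Qed.

End Path.

(** * The starting point of the path *)
Section Anchor.
Variable R : realType.
Implicit Types (f g u : R -> R) (s t x y z l r e p c B C : R).

Local Notation mu := (@lebesgue_measure R).
Local Notation Rp := (`]0%R, +oo[%classic : set R).

Variables (K : nat) (pin0 pinC : bool).
Hypothesis n0 : (0 < K.*2 - pin0 - pinC)%N.

Let K0 : (0 < K)%N.
Proof. by move: n0; case: (K). Qed.

(** Equally spaced nodes, from [0] if the first one is pinned and from [1]
    otherwise. *)
Let beta j : R := (j.+1 - pin0)%:R.
Let a0 j : \bar R := if pinC && (j == K.-1) then +oo%E else 1%:E.
Let b0 j : \bar R := (beta j)%:E.
Let g0 := simple K a0 b0.

Let beta_ge0 j : 0 <= beta j. Proof. exact: ler0n. Qed.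

Let beta_ge1 j : (pin0 <= j)%N -> 1 <= beta j.
Proof. by move=> pj; rewrite /beta ler1n subSn. Qed.

Let beta_lt i j : (i < j)%N -> beta i + 1 <= beta j.
Proof. by move=> ij; rewrite /beta natr1 ler_nat -subSn; case: pin0; case: i ij; case: j; lia. Qed.

Let beta_half i j : (i < j)%N -> beta i + 1 / 2 <= beta j - 1 / 2.
Proof. by move/beta_lt; lra. Qed.

Let beta_half_ge j : (pin0 <= j)%N -> 1 / 4 <= beta j - 1 / 2.
Proof. by move/beta_ge1; lra. Qed.

Let quarter_gt0 : 0 < 1 / 4 :> R. Proof. by lra. Qed.

Let anchor_pinned : pinned K pin0 pinC a0 b0.
Proof.
split.
- split.
  + by move=> i; rewrite /a0; case: ifP; rewrite ?leey ?lee_fin.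
  + by move=> i; rewrite lee_fin.
  + by move=> i j ij; rewrite lee_fin ler_nat leq_sub2r.
- by rewrite /b0 /beta => ->; rewrite subnn.
- by rewrite /a0 => ->; rewrite eqxx.
Qed.

Let adm0 : admissible a0 b0. Proof. by case: anchor_pinned. Qed.

Let kink_gt0 j t : (j < K)%N -> 0 <= t -> (pinC -> t <= beta K.-1) -> 0 < kink (a0 j) (b0 j) t.
Proof.
move=> jK t0 tC; rewrite /a0; case: ifP => [/andP[hC /eqP ->]|_]; last first.
  by rewrite kink_fin expR_gt0.
by rewrite kink_cut ger0_norm// tC.
Qed.

Let anchor_gt0 t : 0 <= t -> (pinC -> t <= beta K.-1) -> 0 < g0 t.
Proof. by move=> t0 tC; apply: prodr_gt0 => j _; exact: kink_gt0. Qed.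

Let kink_lt1 j t : beta j < t -> kink (a0 j) (b0 j) t < 1.
Proof.
move=> bt; have t0 : 0 <= t by exact: le_trans (ltW bt).
rewrite /a0; case: ifP => _; first by rewrite kink_cut ger0_norm// leNgt bt ltr01.
rewrite kink_fin ger0_norm// mul1r max_l; last by rewrite subr_ge0 ltW.
by rewrite -[X in _ < X]expR0 ltr_expR oppr_lt0 subr_gt0.
Qed.

Let anchor_split j t : (j < K)%N ->
  g0 t = kink (a0 j) (b0 j) t * simple K (fun i => if i == j then 0%E else a0 i) b0 t.
Proof.
move=> jK; rewrite /g0 /simple (bigD1 (Ordinal jK))//= [in RHS](bigD1 (Ordinal jK))//=.
rewrite eqxx kink0 mul1r; congr (_ * _); apply: eq_bigr => i ij.
rewrite ifF//; apply/negbTE; apply: contra ij => /eqP ij; apply/eqP; exact/val_inj.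
Qed.

Let anchor_lt1 t : beta 0 < t -> g0 t < 1.
Proof.
move=> bt; have t0 : 0 <= t by exact: le_trans (ltW bt).
rewrite (anchor_split _ K0); apply: le_lt_trans (kink_lt1 bt).
rewrite ler_piMr ?kink_ge0// halfLC_le1//; apply: simple_halfLC.
have [h1 h2 h3] := adm0; split => // i; case: ifP => //.
Qed.

(** At a node of [g0] log-convexity fails strictly, so another representation of
    [g0] must have a node within 1/2. *)
Let anchor_kink j a b : (j < K)%N -> (pin0 <= j)%N -> admissible a b ->
  (forall t, simple K a b t = g0 t) -> kink_in K a b (beta j - 1 / 2) (beta j + 1 / 2).
Proof.
move=> jK pj adm E; apply: contrapT => nk.
have b1 := beta_ge1 pj.
have l2 : 0 < (1 / 2 : R) < 1 by apply/andP; split; lra.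
set x := beta j - 1 / 2 in nk *; set z := beta j + 1 / 2 in nk *.
have x0 : 0 <= x by rewrite /x; lra.
have xz : x <= z by rewrite /x /z; lra.
have z0 : 0 <= z by exact: le_trans xz.
have xb : x <= beta j by rewrite /x; lra.
have bz : beta j < z by rewrite /z; lra.
have mid : 1 / 2 * x + (1 - 1 / 2) * z = beta j by rewrite /x /z; field.
clearbody x z.
have := simple_logconvex adm x0 xz l2 nk.
rewrite mid !E; pose r := simple K (fun i => if i == j then 0%E else a0 i) b0.
have hr : halfLC r.
  apply: simple_halfLC; have [h1 h2 h3] := adm0; split => // i; by case: ifP.
have k1 t : 0 <= t -> t <= beta j -> kink (a0 j) (b0 j) t = 1.
  move=> t0 tb; rewrite /a0; case: ifP => _; first by rewrite kink_cut ger0_norm// tb.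
  by rewrite kink_fin ger0_norm// max_r ?subr_le0// mulr0 oppr0 expR0.
have gt0 : 0 < g0 (beta j).
  apply: anchor_gt0 => // _; rewrite ler_nat leq_sub2r// ltnS.
  by rewrite -ltnS prednK.
have [_ _ _ /(_ x z (1 / 2) x0 z0 l2)] := hr.
rewrite mid => hrb; apply/negP; rewrite -ltNge.
have gE t : g0 t = kink (a0 j) (b0 j) t * r t by exact: anchor_split.
have gb : g0 (beta j) = r (beta j) by rewrite gE k1// mul1r.
have gx : g0 x = r x by rewrite gE k1// mul1r.
rewrite gb gx (gE z) powRM ?kink_ge0 ?(halfLC_ge0 hr)//.
rewrite mulrCA; rewrite gb in gt0.
have kz : kink (a0 j) (b0 j) z `^ (1 - 1 / 2) < 1.
  have h1 : 1 `^ (1 - 1 / 2) = 1 :> R by rewrite powR1.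
  rewrite -[X in _ < X]h1; apply: gt0_ltr_powR.
  - by rewrite subr_gt0; case/andP: l2.
  - by rewrite nnegrE; apply: kink_ge0.
  - by rewrite nnegrE.
  - exact: kink_lt1.
apply: (@le_lt_trans _ _ (kink (a0 j) (b0 j) z `^ (1 - 1 / 2) * r (beta j))).
  by rewrite ler_wpM2l// powR_ge0.
by rewrite gtr_pMl.
Qed.

(** The nodes of index [phi j] lie in disjoint intervals, so [phi] is increasing
    from the indices of positive nodes to themselves, hence the identity.  A
    pinned first node is effective because [g0 < 1] before the second one, and
    slopes are finite because [g0 > 0] before a cut-off. *)
Let anchor_identified a b : pinned K pin0 pinC a b ->
  (forall t, simple K a b t = g0 t) -> generic_nodes K pin0 pinC a b.
Proof.
move=> [adm p0 pC] E; have [ha hb bm] := adm.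
have [phi phiP] : exists phi : nat -> nat, forall j, (pin0 <= j)%N -> (j < K)%N ->
    [/\ (phi j < K)%N, (0 < a (phi j))%E, ((beta j - 1 / 2)%:E < b (phi j))%E &
      (b (phi j) < (beta j + 1 / 2)%:E)%E].
  have H j : exists i, (pin0 <= j)%N -> (j < K)%N ->
    [/\ (i < K)%N, (0 < a i)%E, ((beta j - 1 / 2)%:E < b i)%E & (b i < (beta j + 1 / 2)%:E)%E].
    have [pj|pj] := boolP (pin0 <= j)%N; last by exists 0%N.
    have [jK|jK] := boolP (j < K)%N; last by exists 0%N.
    by have [i iP] := anchor_kink jK pj adm E; exists i.
  by have [phi phiH] := choice H; exists phi.
have mono j : (pin0 <= j)%N -> (j.+1 < K)%N -> (phi j < phi j.+1)%N.
  move=> pj jK; have [_ _ _ h1] := phiP j pj (ltnW jK).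
  have [_ _ h2 _] := phiP j.+1 (leqW pj) jK.
  rewrite ltnNge; apply/negP => /bm h3; have := lt_trans (lt_le_trans h2 h3) h1.
  by rewrite lte_fin ltNge beta_half.
have up j d : (pin0 <= j)%N -> (j + d < K)%N -> (phi j + d <= phi (j + d))%N.
  move=> pj; elim: d => [|d IH] jd; first by rewrite !addn0.
  rewrite !addnS in jd *; apply: leq_ltn_trans (IH (ltnW jd)) _.
  by apply: mono => //; rewrite (leq_trans pj)// leq_addr.
have phi_ge j : (pin0 <= j)%N -> (j < K)%N -> (j <= phi j)%N.
  move=> pj jK; have pK := leq_ltn_trans pj jK.
  have := up pin0 (j - pin0)%N (leqnn _); rewrite subnKC// => /(_ jK); apply: leq_trans.
  rewrite -{1}(subnKC pj) leq_add2r; case: (boolP pin0) => //= hp.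
  rewrite lt0n; apply/negP => /eqP h.
  have [_ _] := phiP pin0 (leqnn _) pK; rewrite hp /= h p0// lte_fin.
  by rewrite ltNge (le_trans (ltW quarter_gt0))//; apply: beta_half_ge; rewrite hp.
have phiE j : (pin0 <= j)%N -> (j < K)%N -> phi j = j.
  move=> pj jK; apply/eqP; rewrite eqn_leq phi_ge// andbT.
  have jK1 : (j <= K.-1)%N by rewrite -ltnS prednK.
  have K1 : (K.-1 < K)%N by rewrite prednK.
  have := up j (K.-1 - j)%N pj; rewrite subnKC// => /(_ K1).
  by have [h2 _ _ _] := phiP K.-1 (leq_trans pj jK1) K1; lia.
have bP j : (pin0 <= j)%N -> (j < K)%N ->
    [/\ (0 < a j)%E, ((beta j - 1 / 2)%:E < b j)%E & (b j < (beta j + 1 / 2)%:E)%E].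
  by move=> pj jK; have := phiP j pj jK; rewrite phiE// => -[].
have bfin j : (j < K)%N -> (b j < (beta j + 1 / 2)%:E)%E.
  move=> jK; have [pj|] := boolP (pin0 <= j)%N; first by case: (bP j pj jK).
  case: (boolP pin0) => // hp; case: j jK => // jK _; rewrite p0// lte_fin.
  by apply: ltr_wpDl.
split.
- move=> j jK; have [pj|] := boolP (pin0 <= j)%N; first by case: (bP j pj jK).
  case: (boolP pin0) => // hp; case: j jK => // jK _.
  have bb : beta 0%N = 0 by rewrite /beta hp subnn.
  have lt1 : simple K a b (1 / 4) < 1 by rewrite E; apply: anchor_lt1; rewrite bb.
  have [i [iK ai bi]] := simple_lt1 adm (ltW quarter_gt0) lt1.
  case: i iK ai bi => // i iK _ bi; have [] := bP i.+1 _ iK; first by rewrite hp.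
  move=> _ h _; have := lt_trans h bi; rewrite lte_fin.
  by rewrite ltNge beta_half_ge// hp.
- move=> j jK nC; have [tC|tC] := boolP (pinC && (beta K.-1 < beta j + 1 / 2)).
    have /andP[hC hb'] := tC; exfalso; move: nC; rewrite hC/= => jn.
    have : (j < K.-1)%N by rewrite ltn_neqAle jn/= -ltnS prednK.
    by move/beta_half/(lt_le_trans hb'); rewrite ltrDl oppr_gt0 ltNge divr_ge0.
  apply: (@simple_gt0_slope _ K a b (beta j + 1 / 2) j adm) => //.
  + by rewrite addr_ge0.
  + rewrite E; apply: anchor_gt0; first by rewrite addr_ge0.
    by move=> hC; move: tC; rewrite hC/= -leNgt.
  + exact: bfin.
- move=> j jK; have [] := bP j.+1 _ jK; first by case: pin0.
  move=> _ h _; apply: lt_trans (bfin j (ltnW jK)) _; apply: le_lt_trans h.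
  by rewrite lee_fin beta_half.
- move=> hp; have [] := bP 0%N _ K0; first by rewrite (negbTE hp).
  move=> _ h _; apply: le_lt_trans h; rewrite lee_fin.
  by rewrite (le_trans (ltW quarter_gt0))// beta_half_ge// (negbTE hp).
- by move=> j jK; apply: lt_trans (bfin j jK) _; rewrite ltry.
Qed.

(** The continuity method applied to [homotopy]. *)
Theorem simple_exists n f (p : 'I_n.+1 -> R) A eta : n = (K.*2 - pin0 - pinC)%N ->
  (forall i, -1 < p i) -> injective p ->
  halfLC f -> 0 < A -> f A < 1 -> 0 < eta -> 0 < f eta ->
  exists a b, [/\ pinned K pin0 pinC a b, expdecay (simple K a b) &
    forall i : 'I_n.+1, (i < n)%N -> mom (p i) (simple K a b) = mom (p i) f].
Proof.
move=> nE p1 pinj hf A0 fA eta0 feta.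
have hg : halfLC g0 by exact: simple_halfLC.
have n1 : (0 < n)%N by rewrite nE.
have Ag0 : 0 < beta 0 + 1 by rewrite ltr_wpDl.
have gA : g0 (beta 0 + 1) < 1 by apply: anchor_lt1; rewrite ltrDl.
have eg0 : 0 < (1 / 2 : R) by [].
have geg : 0 < g0 (1 / 2).
  apply: anchor_gt0 => // hC; have : 1 <= beta K.-1; last by lra.
  apply: beta_ge1; case: (boolP pin0) => // hp; move: n0; rewrite hp hC; case: (K) => [|[|k]] //.
pose sI := [seq i : 'I_n.+1 <- enum 'I_n.+1 | (i < n)%N].
have sIP (i : 'I_n.+1) : (i \in sI) = (i < n)%N by rewrite mem_filter mem_enum andbT.
have us : uniq sI by rewrite filter_uniq// enum_uniq.
have sz : (size sI <= K.*2 - pin0 - pinC)%N.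
  rewrite -nE /sI size_filter -ltnS -[X in (_ < X)%N](size_enum_ord n.+1).
  rewrite ltn_neqAle count_size andbT -all_count; apply/negP => /allP /(_ ord_max).
  by rewrite mem_enum ltnn => /(_ isT).
have i0s : ord0 \in sI by rewrite sIP.
have hs := homotopy_expdecay hf hg A0 fA Ag0 gA.
have F0 : homotopy f g0 0 = g0 by apply/funext => t; exact: homotopy0.
have F1 : homotopy f g0 1 = f by apply/funext => t; exact: homotopy1.
have [|||||a [b [pin dg mm]]] := @continuation _ K pin0 pinC _ sI p us _ _ n0 sz ord0 i0s (homotopy f g0) hs.
- by move=> i j _ _; exact: pinj.
- by move=> i _; exact: p1.
- move=> i s_ s _ sn01 s01 scv.
  exact: (homotopy_mom_cvg hf hg A0 fA Ag0 gA eta0 feta eg0 geg).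
- by exists a0, b0; rewrite F0.
- move=> s a b /andP[s0 s1] pin dg mm; have [adm p0 pC] := pin.
  apply: contrapT => ngen.
  have s01 : 0 <= s <= 1 by rewrite s0 ltW.
  have eqm (i : 'I_n.+1) : (i < n)%N ->
      mom (p i) (homotopy f g0 s) = mom (p i) (simple K a b).
    by move=> iN; rewrite mm ?sIP.
  have ae := degenerate_ae adm (homotopy_halfLC hf hg s01) p0 pC nE K0 n1 p1 pinj
     (hs s s01) dg eqm ngen.
  have [s00|sn0] := eqVneq s 0; last first.
    apply: (homotopy_not_simple hf hg eta0 feta eg0 geg _ adm ae) => //.
    by rewrite lt_neqAle eq_sym sn0 s0.
  apply: ngen; apply: anchor_identified => // t; apply: simple_ae_eq => //.
  by move: ae; rewrite s00 F0; apply: ae_imply => y H /H.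
- exists a, b; split => // i iN; by rewrite mm ?sIP ?F1.
Qed.

End Anchor.

(** * The two classes as products of kinks *)
Section Classes.
Variable R : realType.
Implicit Types (f g u : R -> R) (s t x y z l r e p c B C : R).

Local Notation mu := (@lebesgue_measure R).
Local Notation Rp := (`]0%R, +oo[%classic : set R).

Lemma expeRND (x y : \bar R) : (0 <= x)%E -> (0 <= y)%E ->
  expeR (- (x + y)) = (expeR (- x) * expeR (- y))%E.
Proof.
case: x => [x| |] //; case: y => [y| |] // _ _ /=; rewrite ?mule0 ?mul0e//.
by rewrite opprD expRD EFinM.
Qed.

Lemma hinge_ge0 (b : \bar R) t : (0 <= hinge b t)%E.
Proof. by rewrite /hinge le_max lexx orbT. Qed.

Lemma hinge0 t : hinge 0%E t = `|t|%:E.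
Proof. by rewrite /hinge sube0 max_l// lee_fin. Qed.

Lemma kinkE (a b : \bar R) t : (0 <= a)%E -> (kink a b t)%:E = expeR (- (a * hinge b t)).
Proof.
move=> a0; rewrite /kink; have := mule_ge0 a0 (hinge_ge0 b t).
by case: (a * hinge b t)%E.
Qed.

Lemma simpleE K (a b : nat -> \bar R) t : (forall i, (0 <= a i)%E) ->
  (simple K a b t)%:E = expeR (- (\sum_(0 <= i < K) a i * hinge (b i) t)%E).
Proof.
move=> a0; elim: K => [|K IH].
  by rewrite /simple big_ord0 big_nil oppe0/= expR0.
rewrite /simple big_ord_recr/= -/(simple K a b t) EFinM IH kinkE//.
rewrite big_nat_recr//= expeRND//; last exact: mule_ge0 (hinge_ge0 _ _).
by apply: sume_ge0 => i _; exact: mule_ge0 (hinge_ge0 _ _).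
Qed.

Lemma kink_cutoff (b : \bar R) t : (0 <= b)%E ->
  kink +oo%E b t = \1_[set u : R | (`|u|%:E <= b)%E] t.
Proof.
move=> b0; rewrite indicE; case: b b0 => [b| |] // b0.
  by rewrite kink_cut; congr (_%:R); congr nat_of_bool; apply/idP/idP; rewrite inE/= lee_fin.
by rewrite kink_pinfty mem_set//= leey.
Qed.

Lemma Lplus_odd_simple k g : Lplus_odd k g <->
  exists a b, pinned k.+1 true false a b /\ forall t, g t = simple k.+1 a b t.
Proof.
split=> [[a [b [[a0 b0 bm] gE]]]|[a [b [[[a0 b0 bm] p0 _] gE]]]].
  exists (fun j => a j.+1), (fun j => if j is 0%N then 0%E else b j.+1); split.
    split => //; split => //; first by case.
    by case=> [|i] [|j]//= ij; exact: bm.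
  move=> t; apply: EFin_inj; rewrite gE simpleE// [in RHS]big_nat_recl//= hinge0.
  by rewrite big_add1/= big_add1.
exists (fun j => a j.-1), (fun j => b j.-1); split.
  by split => // i j ij; apply: bm; rewrite -!subn1 leq_sub2r.
move=> t; rewrite gE simpleE// big_nat_recl//= p0// hinge0.
by rewrite big_add1/= big_add1.
Qed.

Lemma Lplus_even_simple k g : Lplus_even k g <->
  exists a b, pinned k false false a b /\ forall t, g t = simple k a b t.
Proof.
split=> [[a [b [[a0 b0 bm] gE]]]|[a [b [[[a0 b0 bm] p0 _] gE]]]].
  exists (fun j => a j.+1), (fun j => b j.+1); split.
    by split => //; split => // i j ij; exact: bm.
  by move=> t; apply: EFin_inj; rewrite gE simpleE// big_add1.
exists (fun j => a j.-1), (fun j => b j.-1); split.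
  by split => // i j ij; apply: bm; rewrite -!subn1 leq_sub2r.
by move=> t; rewrite gE simpleE// big_add1.
Qed.

Let simple_cutoff k (a b : nat -> \bar R) t : (forall i, (0 <= b i)%E) -> a k = +oo%E ->
  simple k.+1 a b t = simple k a b t * \1_[set u : R | (`|u|%:E <= b k)%E] t.
Proof. by move=> b0 ak; rewrite /simple big_ord_recr/= ak kink_cutoff. Qed.

Lemma Lminus_odd_simple k g : Lminus_odd k g <->
  exists a b, pinned k.+1 false true a b /\ forall t, g t = simple k.+1 a b t.
Proof.
split=> [[a [b [[a0 b0 bm] gE]]]|[a [b [[[a0 b0 bm] _ /(_ isT) pC] gE]]]].
  exists (fun j => if j == k then +oo%E else a j.+1), (fun j => b j.+1); split.
    split => // [|_]; last by rewrite eqxx.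
    by split => // [j|i j ij]; [case: eqP|exact: bm].
  move=> t; rewrite simple_cutoff ?eqxx//; apply: EFin_inj; rewrite gE EFinM simpleE.
    congr (expeR (- _)%E * _)%E; rewrite big_add1/= big_nat_cond [RHS]big_nat_cond.
    by apply: eq_bigr => i /andP[/andP[_ ik] _]; rewrite (ltn_eqF ik).
  by move=> j; case: eqP.
exists (fun j => a j.-1), (fun j => b j.-1); split.
  by split => // i j ij; apply: bm; rewrite -!subn1 leq_sub2r.
by move=> t; rewrite gE simple_cutoff// EFinM simpleE// big_add1.
Qed.

Lemma Lminus_even_simple k g : Lminus_even k.+1 g <->
  exists a b, pinned k.+2 true true a b /\ forall t, g t = simple k.+2 a b t.
Proof.
split=> [[a [b [[a0 b0 bm] gE]]]|[a [b [[[a0 b0 bm] p0 /(_ isT) pC] gE]]]].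
  exists (fun j => if j == k.+1 then +oo%E else a j.+1),
    (fun j => if j is 0%N then 0%E else b j.+1); split.
    split => // [|_]; last by rewrite eqxx.
    split => [j|[]//|[|i] [|j]//= ij]; [by case: eqP|exact: bm].
  move=> t; rewrite simple_cutoff ?eqxx//; last by case.
  apply: EFin_inj; rewrite gE EFinM simpleE; last by move=> j; case: eqP.
  congr (expeR (- _)%E * _)%E; rewrite [in RHS]big_nat_recl//= hinge0.
  congr (_ + _)%E; rewrite big_add1/= big_add1/= big_nat_cond [RHS]big_nat_cond.
  by apply: eq_bigr => i /andP[/andP[_ ik] _]; rewrite eqSS (ltn_eqF ik).
exists (fun j => a j.-1), (fun j => b j.-1); split.
  by split => // i j ij; apply: bm; rewrite -!subn1 leq_sub2r.
move=> t; rewrite gE simple_cutoff// EFinM simpleE// big_nat_recl//= p0// hinge0.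
by rewrite big_add1/= big_add1.
Qed.

Definition simples K pin0 pinC : set (R -> R) :=
  [set g | exists a b, pinned K pin0 pinC a b /\ forall t, g t = simple K a b t].

Lemma Lplus_simples n g : Lplus n g <-> simples (n./2 + odd n) (odd n) false g.
Proof.
rewrite /Lplus /simples/=; case: (odd n); rewrite ?addn1 ?addn0.
  exact: Lplus_odd_simple.
exact: Lplus_even_simple.
Qed.

Lemma Lminus_simples n g : (0 < n)%N -> Lminus n g <-> simples (n./2).+1 (~~ odd n) true g.
Proof.
rewrite /Lminus /simples/= => n0; case: (boolP (odd n)) => on /=.
  exact: Lminus_odd_simple.
have -> : n./2 = (n./2).-1.+1 by rewrite prednK// half_gt0; case: n n0 on => [|[]].
exact: Lminus_even_simple.
Qed.

End Classes.

(** * The theorem *)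
Section Final.
Variable R : realType.
Implicit Types (f g u : R -> R) (s t x y z l r e p c B C : R).

Local Notation mu := (@lebesgue_measure R).
Local Notation Rp := (`]0%R, +oo[%classic : set R).

Lemma eq_moment p u (w : R -> R) : (forall t, 0 < t -> u t = w t) -> moment p u = moment p w.
Proof.
move=> H; apply: eq_integral => t; rewrite inE/= in_itv/= andbT => t0.
by rewrite H.
Qed.

(** This separates the constant [1], the only case with infinite moments. *)
Lemma halfLC_expdecay_or_one u : halfLC u -> expdecay u \/ forall t, 0 <= t -> u t = 1.
Proof.
move=> hu; have [[A [A0 uA]]|H] := pselect (exists A, 0 < A /\ u A < 1).
  by left; exact: halfLC_expdecay uA.
right=> t; rewrite le_eqVlt => /predU1P[<-|t0]; first by case: hu.
apply/eqP; rewrite eq_le halfLC_le1 ?(ltW t0)//= leNgt; apply/negP => ut.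
by apply: H; exists t.
Qed.

Lemma moment_one p : -1 < p -> moment p (fun=> 1) = +oo%E :> \bar R.
Proof.
move=> p1; apply/eqyP => A A0.
have q0 : 0 < p + 1 by lra.
(* the point where the lower bound of [moment_lower] for the constant [1] is [A] *)
pose B := 2 * (2 * A) `^ (p + 1)^-1.
have B0 : 0 < B by apply: mulr_gt0 => //; apply: powR_gt0; exact: mulr_gt0.
have := moment_lower p1 (@halfLC1 R) B0; apply: le_trans.
rewrite lee_fin mul1r /B mulrAC mulfV// mul1r -powRrM mulVf ?gt_eqF// powRr1.
  by rewrite mulrAC mulfV// mul1r.
by rewrite mulr_ge0// ltW.
Qed.

Lemma one_not_expdecay u : (forall t, 0 <= t -> u t = 1) -> ~ expdecay u.
Proof.
move=> u1 du; have p1 : -1 < (0 : R) by rewrite oppr_lt0.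
have := momE p1 du; rewrite (@eq_moment _ u (fun=> 1)) ?moment_one//.
by move=> t t0; rewrite u1// ltW.
Qed.

Lemma moment_expdecay p u (w : R -> R) : -1 < p -> halfLC u -> halfLC w -> moment p u = moment p w ->
  expdecay u -> expdecay w.
Proof.
move=> p1 hu hw E du; have [//|w1] := halfLC_expdecay_or_one hw.
move: E; rewrite (momE p1 du) (@eq_moment _ w (fun=> 1)) ?moment_one//.
by move=> t t0; rewrite w1// ltW.
Qed.

Lemma count_greater n (p : 'I_n.+1 -> R) (s : {perm 'I_n.+1}) (k : 'I_n.+1) :
  (forall i j : 'I_n.+1, (i < j)%N -> p (s i) < p (s j)) -> s k = ord_max ->
  count (fun j => p ord_max < p j) (enum 'I_n.+1) = (n.+1 - k.+1)%N.
Proof.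
move=> inc sk; rewrite -sk -sum1_count big_enum_cond/=.
rewrite (reindex_inj (@perm_inj _ s))/=.
rewrite (eq_bigl (fun j : 'I_n.+1 => (k < j)%N)); last first.
  move=> j /=; apply/idP/idP => [|/inc//]; apply: contraTT; rewrite -leqNgt -leNgt leq_eqVlt.
  by case/orP => [/eqP/val_inj->//|/inc/ltW].
rewrite -(big_mkord (fun j => (k < j)%N) (fun=> 1%N)) big_mkcond.
have count_gt m (j : nat) : (\sum_(0 <= i < m) (if j < i then 1 else 0) = m - j.+1)%N.
  elim: m => [|m IH]; first by rewrite big_geq.
  by rewrite big_nat_recr//= IH; case: ltnP; lia.
exact: count_gt.
Qed.

Section Matching.
Variables (K : nat) (pin0 pinC : bool) (n : nat) (p : 'I_n.+1 -> R).
Hypotheses (nE : n = (K.*2 - pin0 - pinC)%N) (n0 : (0 < n)%N).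
Hypotheses (p1 : forall i, -1 < p i) (pinj : injective p).

Let K0 : (0 < K)%N.
Proof. by move: n0; rewrite nE; case: (K). Qed.

Let first_moment f g : same_moments p f g -> moment (p ord0) f = moment (p ord0) g.
Proof. by apply. Qed.

Lemma same_moments_expdecay f g : halfLC f -> halfLC g -> same_moments p f g ->
  expdecay f -> expdecay g.
Proof. by move=> hf hg /first_moment; exact: moment_expdecay. Qed.

Lemma same_moments_sym f g : same_moments p f g -> same_moments p g f.
Proof. by move=> H i /H. Qed.

Lemma same_moments_trans f g h : same_moments p f g -> same_moments p g h -> same_moments p f h.
Proof. by move=> H1 H2 i iN; rewrite H1// H2. Qed.

Lemma simples_halfLC g : simples K pin0 pinC g -> halfLC g.
Proof.
move=> [a [b [[adm _ _] gE]]]; have -> : g = simple K a b by apply/funext.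
exact: simple_halfLC.
Qed.

Lemma simples_even g t : simples K pin0 pinC g -> g (- t) = g t.
Proof. by move=> [a [b [_ gE]]]; rewrite !gE simpleN. Qed.

Let greater := count (fun j => p ord_max < p j) (enum 'I_n.+1).

Lemma simples_compare f g : halfLC f -> simples K pin0 pinC g -> same_moments p f g ->
  expdecay f -> let D := mom (p ord_max) g - mom (p ord_max) f in
  0 <= (-1) ^+ pinC * (-1) ^+ greater * D /\ (D = 0 -> {ae mu, forall t, Rp t -> f t = g t}).
Proof.
move=> hf sg sm df; have dg := same_moments_expdecay hf (simples_halfLC sg) sm df.
have [a [b [[adm pa pb] gE]]] := sg.
have E : g = simple K a b by apply/funext.
rewrite E in dg sm *; apply: (last_moment_sign adm hf pa pb nE K0 n0 p1 pinj df dg) => i iN.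
by have := sm i iN; rewrite !momE// => -[].
Qed.

(** The comparison between two simple functions holds in both directions, so the
    last moments agree as well. *)
Lemma simples_unique f g h : halfLC f -> simples K pin0 pinC g -> simples K pin0 pinC h ->
  same_moments p f g -> same_moments p f h -> g = h.
Proof.
move=> hf sg sh fg fh; have hg := simples_halfLC sg; have hh := simples_halfLC sh.
have gh := same_moments_trans (same_moments_sym fg) fh.
have hg' := same_moments_sym gh.
suff E t : 0 <= t -> g t = h t.
  apply/funext => t; have [/E//|t0] := leP 0 t.
  by rewrite -(simples_even t sg) -(simples_even t sh) E// oppr_ge0 ltW.
have [dg|g1] := halfLC_expdecay_or_one hg; last first.
  have [dh|h1] := halfLC_expdecay_or_one hh; last by move=> t0; rewrite g1// h1.
  by have := one_not_expdecay g1 (same_moments_expdecay hh hg hg' dh).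
have dh := same_moments_expdecay hg hh gh dg.
have [D1 ae] := simples_compare hg sh gh dg.
have [D2 _] := simples_compare hh sg hg' dh.
move=> _; have [a [b [[adg _ _] gE]]] := sg; have [a' [b' [[adh _ _] hE]]] := sh.
rewrite gE hE; apply: simple_ae_eq => //.
apply: ae_imply (ae _) => [y|]; first by rewrite gE hE.
move: D1 D2; move: (mom _ h) (mom _ g) => x y.
rewrite -(signr_odd _ greater) -signr_addb; case: (_ (+) _); rewrite ?expr0 ?expr1; lra.
Qed.

(** The indicator of the origin is the product of kinks with [a = +oo] and
    [b = 0]; the constant [1] is obtained from nodes at [+oo], a pinned first node
    having slope [0]. *)
Lemma simples_exists f : halfLC f -> exists g, simples K pin0 pinC g /\ same_moments p f g.
Proof.
move=> hf; have [df|f1] := halfLC_expdecay_or_one hf; last first.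
  pose a j : \bar R := if pinC && (j == K.-1) then +oo%E else 0%E.
  pose b j : \bar R := if pin0 && (j == 0%N) then 0%E else +oo%E.
  exists (simple K a b); split.
    exists a, b; split => //; split; rewrite /a /b.
    - split => [i|i|[|i] [|j] //= _]; do ?case: ifP => //; rewrite ?andbF ?leey//.
    - by move=> ->.
    - by move=> ->; rewrite eqxx.
  move=> i _; apply: eq_moment => t t0; rewrite f1 ?(ltW t0)//.
  rewrite /simple big1// => j _; rewrite /b; case: ifP => [/andP[hp /eqP j0]|_]; last exact: kink_pinfty.
  rewrite /a ifF ?kink0//; apply/negbTE; rewrite j0; apply/negP => /andP[hC /eqP k0].
  by move: n0; rewrite nE hp hC -(prednK K0) -k0.
have [A [A0 fA]] : exists A, 0 < A /\ f A < 1.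
  apply: contrapT => H; apply: (@one_not_expdecay f _ df) => t.
  rewrite le_eqVlt => /predU1P[<-|t0]; first by case: hf.
  apply/eqP; rewrite eq_le halfLC_le1 ?(ltW t0)//= leNgt; apply/negP => ut.
  by apply: H; exists t.
have [[eta [eta0 feta]]|fz] := pselect (exists eta, 0 < eta /\ 0 < f eta).
  have n1 : (0 < K.*2 - pin0 - pinC)%N by rewrite -nE.
  have [a [b [pin dg mm]]] := simple_exists n1 nE p1 pinj hf A0 fA eta0 feta.
  exists (simple K a b); split; first by exists a, b.
  by move=> i iN; rewrite !momE// mm.
exists (simple K (fun=> +oo%E) (fun=> 0%E)); split.
  by exists (fun=> +oo%E), (fun=> 0%E); split => //; split.
move=> i _; apply: eq_moment => t t0.
rewrite /simple (bigD1 (Ordinal K0))//= kink_cut ger0_norm ?(ltW t0)// leNgt t0/= mul0r.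
apply/eqP; rewrite eq_le halfLC_ge0 ?(ltW t0)// andbT leNgt; apply/negP => ft.
by apply: fz; exists t.
Qed.

Lemma simples_exists_unique f : halfLC f ->
  exists! g, simples K pin0 pinC g /\ same_moments p f g.
Proof.
move=> hf; have [g [sg fg]] := simples_exists hf; exists g; split => // h [sh fh].
exact: simples_unique hf sg sh fg fh.
Qed.

(** Off the nodes, their opposites and [0], equality holds everywhere. *)
Lemma ae_even f g : halfLC f -> (forall t, f (- t) = f t) -> simples K pin0 pinC g ->
  {ae mu, forall t, Rp t -> f t = g t} -> {ae mu, forall t, f t = g t}.
Proof.
move=> hf fN sg ae; have [a [b [[adm _ _] gE]]] := sg; have [a0 b0 bm] := adm.
have {}ae : {ae mu, forall t, Rp t -> f t = simple K a b t}.
  by apply: ae_imply ae => t; rewrite gE.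
pose zs := 0 :: nodes K b ++ [seq - z | z <- nodes K b].
exists [set` zs]; split.
- by apply: countable_measurable; [exact: measurable_set1|apply: finite_set_countable; exact: finite_seq].
- by apply: countable_lebesgue_measure0; apply: finite_set_countable; exact: finite_seq.
- move=> t /= nP; apply: contrapT => /negP; rewrite inE mem_cat !negb_or => /and3P[t0 t1 t2].
  apply: nP; rewrite gE; have [tp|tn|/eqP] := ltrgtP 0 t; last by rewrite eq_sym (negbTE t0).
    by apply: halfLC_simple_eq => //; exact: nodesP.
  rewrite -fN -simpleN; apply: halfLC_simple_eq => //; first by rewrite oppr_gt0.
  by apply: nodesP => //; apply: contra t2 => h; apply/mapP; exists (- t); rewrite ?opprK.
Qed.

Lemma simples_inequality f g : halfLC f -> (forall t, f (- t) = f t) ->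
  simples K pin0 pinC g -> same_moments p f g ->
  (~~ odd (pinC + greater) -> (moment (p ord_max) f <= moment (p ord_max) g)%E) /\
  (odd (pinC + greater) -> (moment (p ord_max) g <= moment (p ord_max) f)%E) /\
  (moment (p ord_max) f = moment (p ord_max) g -> {ae mu, forall t, f t = g t}).
Proof.
move=> hf fN sg fg; have hg := simples_halfLC sg.
have [df|f1] := halfLC_expdecay_or_one hf; last first.
  have [dg|g1] := halfLC_expdecay_or_one hg.
    by have := one_not_expdecay f1 (same_moments_expdecay hg hf (same_moments_sym fg) dg).
  have E : f = g.
    apply/funext => t; have [t0|t0] := leP 0 t; first by rewrite f1// g1.
    by rewrite -fN -(simples_even t sg) f1 ?g1// oppr_ge0 ltW.
  by rewrite E lexx; split => //; split => // _; exact: aeW.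
have dg := same_moments_expdecay hf hg fg df.
have [D1 D2] := simples_compare hf sg fg df.
rewrite !momE// !lee_fin.
move: D1; rewrite -exprD -signr_odd; case: (odd _) => /=; rewrite ?expr0 ?expr1 => D1; split => //.
- by split => [_|[E]]; [lra|apply: ae_even => //; apply: D2; rewrite E subrr].
- by move=> _; lra.
- by split => // -[E]; apply: ae_even => //; apply: D2; rewrite E subrr.
Qed.

End Matching.
End Final.

Theorem theorem7 (R : realType) (n : nat) (f : R -> R) (p : 'I_n.+1 -> R)
    (hn : (1 <= n)%N) (hf : calL f)
    (hp : forall i, -1 < p i) (hpinj : injective p) :
  (exists! fplus : R -> R, Lplus n fplus /\ same_moments p f fplus) /\
  (exists! fminus : R -> R, Lminus n fminus /\ same_moments p f fminus) /\
  (forall fplus fminus : R -> R,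
     Lplus n fplus -> same_moments p f fplus ->
     Lminus n fminus -> same_moments p f fminus ->
     (forall (s : {perm 'I_n.+1}) (k : 'I_n.+1),
        (forall i j : 'I_n.+1, (i < j)%N -> p (s i) < p (s j)) ->
        s k = ord_max ->
        (~~ odd (n.+1 - k.+1) ->
           (moment (p ord_max) fminus <= moment (p ord_max) f)%E /\
           (moment (p ord_max) f <= moment (p ord_max) fplus)%E) /\
        (odd (n.+1 - k.+1) ->
           (moment (p ord_max) fplus <= moment (p ord_max) f)%E /\
           (moment (p ord_max) f <= moment (p ord_max) fminus)%E)) /\
     (moment (p ord_max) f = moment (p ord_max) fplus ->
        {ae lebesgue_measure, forall t : R, f t = fplus t}) /\
     (moment (p ord_max) f = moment (p ord_max) fminus ->
        {ae lebesgue_measure, forall t : R, f t = fminus t})).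
Proof.
have hl := calL_halfLC hf; have [_ fN _] := hf.
have nh := odd_double_half n.
have nP : n = ((n./2 + odd n).*2 - odd n - false)%N.
  by rewrite subn0 doubleD -addnn; case: (odd n) nh => /=; lia.
have nM : n = ((n./2).+1.*2 - ~~ odd n - true)%N by case: (odd n) nh => /=; lia.
have uniq_class (C D : set (R -> R)) : (forall g, C g <-> D g) ->
    (exists! g, D g /\ same_moments p f g) -> exists! g, C g /\ same_moments p f g.
  move=> CD [g [[Dg fg] gu]]; exists g; split; first by split => //; apply/CD.
  by move=> h [/CD Dh fh]; exact: gu.
split; first by apply: uniq_class (Lplus_simples n) (simples_exists_unique nP hn hp hpinj hl).
split; first by apply: uniq_class (fun g => Lminus_simples g hn) (simples_exists_unique nM hn hp hpinj hl).
move=> fplus fminus /Lplus_simples sP mP /(Lminus_simples _ hn) sM mM.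
have [P1 [P2 P3]] := simples_inequality nP hn hp hpinj hl fN sP mP.
have [M1 [M2 M3]] := simples_inequality nM hn hp hpinj hl fN sM mM.
split=> // s k inc sk; rewrite -(count_greater inc sk); split => o.
  by split; [apply: M2; rewrite oddD/=|apply: P1; rewrite oddD/=].
by split; [apply: P2; rewrite oddD|apply: M1; rewrite oddD/= negbK].
Qed.
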